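(* Let $\lambda,\nu\in\mathbb{C}$ and suppose that $a:=\nu-\lambda$ is a non-negative integer. For $a>0$ define differential operators on $\mathbb{R}^2$ (homogeneous of order $a$) by $$\mathcal{D}_1:=a(2\lambda+a-1)\,\frac{\partial}{\partial x}\circ\mathcal{C}^{\lambda+\frac12}_{a-1},$$ $$\mathcal{D}_2:=\bigl(2\lambda^2+2(a-1)\lambda+a(a-1)\bigr)\frac{\partial}{\partial y}\circ\mathcal{C}^{\lambda+\frac12}_{a-1}+(\lambda-1)(2\lambda+1)\Bigl(\frac{\partial^2}{\partial x^2}+\frac{\partial^2}{\partial y^2}\Bigr)\circ\mathcal{C}^{\lambda+\frac32}_{a-2},$$ and for $a=0$ set $\mathcal{D}_1:=\mathrm{id}$, $\mathcal{D}_2:=0$. Then $\mathcal{D}:=\mathrm{Rest}_{y=0}\circ(\mathcal{D}_1,\mathcal{D}_2)$ and $\mathcal{D}^\vee:=\mathrm{Rest}_{y=0}\circ(\mathcal{D}_2,-\mathcal{D}_1)$ both satisfy the functional identity $(\mathcal{M}_{\lambda,\nu})$ for all $\vec F\in C^\infty(\mathbb{R}^2)\oplus C^\infty(\mathbb{R}^2)$. Moreover, for $\lambda,\nu\in\mathbb{C}$ with $2\lambda\notin\{0,-1,-2,\ldots\}$: a non-trivial (i.e. non-zero) solution to $(\mathcal{M}_{\lambda,\nu})$ exists only if $\nu-\lambda$ is a non-negative integer, and (when $\nu-\lambda$ is a non-negative integer) any solution to $(\mathcal{M}_{\lambda,\nu})$ is a linear combination of the operators $\mathcal{D}$ and $\mathcal{D}^\vee$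 above.
   Context: Functions are complex-valued and smooth; $(x,y)$ are the coordinates of $\mathbb{R}^2$; $\mathbb{R}^\times=\mathbb{R}\setminus\{0\}$. Twisted inversion: for $\lambda\in\mathbb{C}$ and a $\mathbb{C}^2$-valued function $\vec F=\begin{pmatrix}f\\ g\end{pmatrix}$ on $\mathbb{R}^2\setminus\{(0,0)\}$, define $\vec F^\vee_\lambda$ on $\mathbb{R}^2\setminus\{(0,0)\}$ by $$\vec F^\vee_\lambda(r\cos\theta,r\sin\theta):=r^{-2\lambda}\begin{pmatrix}\cos2\theta&-\sin2\theta\\ \sin2\theta&\cos2\theta\end{pmatrix}\vec F\Bigl(\frac{-\cos\theta}{r},\frac{\sin\theta}{r}\Bigr)\qquad(r>0).$$ For differential operators $\mathcal{D}_1,\mathcal{D}_2$ on $\mathbb{R}^2$, $\mathrm{Rest}_{y=0}\circ(\mathcal{D}_1,\mathcal{D}_2)$ denotes the linear map $C^\infty(\mathbb{R}^2)\oplus C^\infty(\mathbb{R}^2)\to C^\infty(\mathbb{R})$, $(f,g)\mapsto(\mathcal{D}_1f)(x,0)+(\mathcal{D}_2g)(x,0)$; by the same formula it is applied to functions defined on $\mathbb{R}^2\setminus\{(0,0)\}$, giving functions on $\mathbb{R}^\times$. Functional identity $(\mathcal{M}_{\lambda,\nu})$ for $\mathcal{D}=\mathrm{Rest}_{y=0}\circ(\mathcal{D}_1,\mathcal{D}_2)$: for every $\vec F\in C^\infty(\mathbb{R}^2)\oplus C^\infty(\mathbb{R}^2)$, $$(\mathcal{D}\vec F^\vee_\lambda)(x)=|x|^{-2\nu}(\mathcal{D}\vec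 F)\Bigl(-\frac1x\Bigr)\qquad\text{for all }x\in\mathbb{R}^\times .$$ A solution to $(\mathcal{M}_{\lambda,\nu})$ is an operator of the form $\mathcal{D}=\mathrm{Rest}_{y=0}\circ(\mathcal{D}_1,\mathcal{D}_2)$, where $\mathcal{D}_1,\mathcal{D}_2$ are differential operators on $\mathbb{R}^2$ with constant (complex) coefficients, which satisfies this identity for all $\vec F$. Solutions are regarded as linear maps $C^\infty(\mathbb{R}^2)\oplus C^\infty(\mathbb{R}^2)\to C^\infty(\mathbb{R})$. Gegenbauer polynomials: $$C^\alpha_\ell(t)=\sum_{k=0}^{[\ell/2]}(-1)^k\frac{\Gamma(\ell-k+\alpha)}{\Gamma(\alpha)\,\Gamma(\ell-2k+1)\,k!}(2t)^{\ell-2k},$$ where $[s]$ is the greatest integer not exceeding $s$, the quotient $\Gamma(\ell-k+\alpha)/\Gamma(\alpha)$ is read as the polynomial $\alpha(\alpha+1)\cdots(\alpha+\ell-k-1)$ in $\alpha$, and $C^\alpha_{-1}=0$ (empty sum). Inflated two-variable polynomial: $C^\alpha_\ell(s,t):=s^{\ell/2}C^\alpha_\ell(t/\sqrt s)$. The operator $\mathcal{C}^\alpha_\ell:=C^\alpha_\ell\bigl(-\frac{\partial^2}{\partial x^2},\frac{\partial}{\partial y}\bigr)$ is obtained by substituting $s=-\frac{\partial^2}{\partial x^2}$, $t=\frac{\partial}{\partial y}$; it is a homogeneous constant-coefficient differential operator of order $\ell$ on $\mathbb{R}^2$. *)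

(* Defs.v *)
From Stdlib Require Import Reals Lra Lia ZArith.
From Coquelicot Require Import Coquelicot.

Open Scope C_scope.

(* Real and imaginary part have iterated partial derivatives of all orders at
   (x, y), in any order of differentiation.  Since [Derive] is total, this is
   the usual notion only when it holds on an open set. *)
Definition infinitely_diff_at (f : R -> R -> C) (x y : R) : Prop :=
  forall n : nat,
    ex_diff_n (fun u v => Re (f u v)) n x y /\
    ex_diff_n (fun u v => Im (f u v)) n x y.

Definition smooth (f : R -> R -> C) : Prop :=
  forall x y : R, infinitely_diff_at f x y.

Definition smooth_pair (F : R -> R -> C * C) : Prop :=
  smooth (fun u v => fst (F u v)) /\ smooth (fun u v => snd (F u v)).

(* Operators act on all functions, so that they apply equally to functions on
   R^2 and (away from the origin) to functions on R^2 \ {(0,0)}. *)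
Definition operator : Type := (R -> R -> C) -> R -> R -> C.

Definition dx : operator := fun f x y =>
  (Derive (fun t => Re (f t y)) x, Derive (fun t => Im (f t y)) x).

Definition dy : operator := fun f x y =>
  (Derive (fun t => Re (f x t)) y, Derive (fun t => Im (f x t)) y).

Definition op_id : operator := fun f => f.
Definition op_zero : operator := fun _ _ _ => 0.
Definition op_add (A B : operator) : operator := fun f x y => A f x y + B f x y.
Definition op_opp (A : operator) : operator := fun f x y => - A f x y.
Definition op_scal (c : C) (A : operator) : operator := fun f x y => c * A f x y.
Definition op_comp (A B : operator) : operator := fun f => A (B f).
Definition op_pow (A : operator) (n : nat) : operator := Nat.iter n (op_comp A) op_id.
Definition op_sum (A : nat -> operator) (n : nat) : operator :=
  fun f x y => sum_n (fun k => A k f x y) n.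

Definition laplacian : operator := op_add (op_comp dx dx) (op_comp dy dy).

(* [D] is the operator \sum_{i,j <= N} c_ij d_x^i d_y^j.  The agreement is only
   required on functions smooth near the point, the values of the total [Derive]
   on other functions being irrelevant. *)
Definition const_coeff (D : operator) : Prop :=
  exists (N : nat) (c : nat -> nat -> C),
    forall (f : R -> R -> C) (x y : R),
      locally_2d (infinitely_diff_at f) x y ->
      D f x y =
      op_sum (fun i => op_sum (fun j =>
        op_scal (c i j) (op_comp (op_pow dx i) (op_pow dy j))) N) N f x y.

Definition Rest (D1 D2 : operator) (F : R -> R -> C * C) (x : R) : C :=
  D1 (fun u v => fst (F u v)) x 0%R + D2 (fun u v => snd (F u v)) x 0%R.

(* r^z = exp (z ln r), for r > 0. *)
Definition Rcpow (r : R) (z : C) : C :=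
  ((exp (Re z * ln r) * cos (Im z * ln r))%R,
   (exp (Re z * ln r) * sin (Im z * ln r))%R).

Definition polar_angle (x y : R) : R :=
  let t := acos (x / sqrt (x ^ 2 + y ^ 2)) in
  if Rle_dec 0 y then t else (- t)%R.

Definition twisted_inversion_polar (lam : C) (F : R -> R -> C * C) (r th : R)
    : C * C :=
  let P := F (- cos th / r)%R (sin th / r)%R in
  (Rcpow r (- (2 * lam)) * (cos (2 * th) * fst P - sin (2 * th) * snd P),
   Rcpow r (- (2 * lam)) * (sin (2 * th) * fst P + cos (2 * th) * snd P)).

(* Only meaningful away from the origin; see [twisted_inversionE]. *)
Definition twisted_inversion (lam : C) (F : R -> R -> C * C) (x y : R) : C * C :=
  twisted_inversion_polar lam F (sqrt (x ^ 2 + y ^ 2)) (polar_angle x y).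

Lemma polar_radius (r th : R) :
  (0 < r -> sqrt ((r * cos th) ^ 2 + (r * sin th) ^ 2) = r)%R.
Proof.
intros Hr.
replace ((r * cos th) ^ 2 + (r * sin th) ^ 2)%R
  with (r ^ 2 * (Rsqr (sin th) + Rsqr (cos th)))%R by (unfold Rsqr; ring).
rewrite sin2_cos2, Rmult_1_r.
apply sqrt_pow2; lra.
Qed.

Lemma polar_angle_cos_sin (r th : R) : (0 < r)%R ->
  cos (polar_angle (r * cos th) (r * sin th)) = cos th /\
  sin (polar_angle (r * cos th) (r * sin th)) = sin th.
Proof.
intros Hr; unfold polar_angle; rewrite (polar_radius r th Hr).
replace (r * cos th / r)%R with (cos th) by (field; lra).
pose proof (COS_bound th) as Hc.
assert (Hs : sin (acos (cos th)) = Rabs (sin th)).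
{ rewrite sin_acos by exact Hc.
  replace (1 - Rsqr (cos th))%R with (Rsqr (sin th))
    by (pose proof (sin2_cos2 th); lra).
  apply sqrt_Rsqr_abs. }
destruct (Rle_dec 0 (r * sin th)) as [H|H].
- split; [apply cos_acos; exact Hc|].
  rewrite Hs; apply Rabs_pos_eq; nra.
- rewrite cos_neg, sin_neg; split; [apply cos_acos; exact Hc|].
  rewrite Hs, Rabs_left by nra; ring.
Qed.

Lemma twisted_inversionE (lam : C) (F : R -> R -> C * C) (r th : R) :
  (0 < r)%R ->
  twisted_inversion lam F (r * cos th)%R (r * sin th)%R
  = twisted_inversion_polar lam F r th.
Proof.
intros Hr; unfold twisted_inversion.
rewrite (polar_radius r th Hr).
destruct (polar_angle_cos_sin r th Hr) as [Hc Hs].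
unfold twisted_inversion_polar.
now rewrite !cos_2a, !sin_2a, Hc, Hs.
Qed.

Definition functional_identity (lam nu : C)
    (T : (R -> R -> C * C) -> R -> C) : Prop :=
  forall F : R -> R -> C * C, smooth_pair F ->
  forall x : R, x <> 0%R ->
    T (twisted_inversion lam F) x =
    Rcpow (Rabs x) (- (2 * nu)) * T F (- (1 / x))%R.

Definition solution (lam nu : C) (D1 D2 : operator) : Prop :=
  const_coeff D1 /\ const_coeff D2 /\ functional_identity lam nu (Rest D1 D2).

(* Non-zero as a linear map on pairs of smooth functions on R^2. *)
Definition nontrivial (T : (R -> R -> C * C) -> R -> C) : Prop :=
  exists (F : R -> R -> C * C) (x : R), smooth_pair F /\ T F x <> 0.

(* alpha (alpha + 1) ... (alpha + n - 1) *)
Fixpoint rising (alpha : C) (n : nat) : C :=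
  match n with
  | O => 1
  | S m => rising alpha m * (alpha + INR m)
  end.

(* The coefficient of (2t)^(l - 2k), for 2k <= l. *)
Definition gegenbauer_coeff (alpha : C) (l k : nat) : C :=
  (- (1)) ^ k * (rising alpha (l - k) / (INR (fact (l - 2 * k)) * INR (fact k))).

Definition gegenbauer (alpha : C) (l : nat) (t : C) : C :=
  sum_n (fun k => gegenbauer_coeff alpha l k * (2 * t) ^ (l - 2 * k)) (l / 2).

Definition gegenbauer_inflated (alpha : C) (l : nat) (s t : C) : C :=
  sum_n (fun k => gegenbauer_coeff alpha l k * (s ^ k * (2 * t) ^ (l - 2 * k)))
        (l / 2).

(* s^(l/2) C(t / sqrt s), with w a square root of s. *)
Lemma gegenbauer_inflatedE (alpha : C) (l : nat) (w t : C) : w <> 0 ->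
  gegenbauer_inflated alpha l (w ^ 2) t = w ^ l * gegenbauer alpha l (t / w).
Proof.
intros Hw; unfold gegenbauer_inflated, gegenbauer.
change (w ^ l * sum_n (fun k => gegenbauer_coeff alpha l k *
                                (2 * (t / w)) ^ (l - 2 * k)) (l / 2))
  with (mult (K := C_Ring) (w ^ l) (sum_n (G := C_Ring) (fun k =>
          gegenbauer_coeff alpha l k * (2 * (t / w)) ^ (l - 2 * k)) (l / 2))).
rewrite <- (sum_n_mult_l (K := C_Ring)).
apply (sum_n_ext_loc (G := C_AbelianMonoid)); intros k Hk.
assert (Hkl : (2 * k <= l)%nat).
{ apply Nat.le_trans with (2 * (l / 2))%nat; [lia|].
  apply Nat.Div0.mul_div_le. }
change (gegenbauer_coeff alpha l k * ((w ^ 2) ^ k * (2 * t) ^ (l - 2 * k))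
  = w ^ l * (gegenbauer_coeff alpha l k * (2 * (t / w)) ^ (l - 2 * k))).
replace (w ^ l) with (w ^ (2 * k) * w ^ (l - 2 * k))
  by (rewrite <- Cpow_add_r; f_equal; lia).
rewrite Cpow_mult_r.
replace (2 * t) with (w * (2 * (t / w))) by (field; exact Hw).
rewrite Cpow_mult_l; ring.
Qed.

(* Substitution of s = - d_x^2 and t = d_y in [gegenbauer_inflated]; the index
   ranges over Z as l = -1 (the zero operator) is needed. *)
Definition gegenbauer_op (alpha : C) (l : Z) : operator :=
  if (l <? 0)%Z then op_zero else
  let n := Z.to_nat l in
  op_sum (fun k =>
    op_scal (gegenbauer_coeff alpha n k)
      (op_comp (op_pow (op_opp (op_comp dx dx)) k)
               (op_pow (op_scal 2 dy) (n - 2 * k)))) (n / 2).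

Definition D1 (lam : C) (a : nat) : operator :=
  if (a =? 0)%nat then op_id else
  op_scal (INR a * (2 * lam + INR a - 1))
    (op_comp dx (gegenbauer_op (lam + 1 / 2) (Z.of_nat a - 1))).

Definition D2 (lam : C) (a : nat) : operator :=
  if (a =? 0)%nat then op_zero else
  op_add
    (op_scal (2 * lam ^ 2 + 2 * (INR a - 1) * lam + INR a * (INR a - 1))
      (op_comp dy (gegenbauer_op (lam + 1 / 2) (Z.of_nat a - 1))))
    (op_scal ((lam - 1) * (2 * lam + 1))
      (op_comp laplacian (gegenbauer_op (lam + 3 / 2) (Z.of_nat a - 2)))).

(* Main.v *)
Require Import Defs.
From Stdlib Require Import Reals Lra Lia ZArith Factorial Classical.
From Coquelicot Require Import Coquelicot.

Open Scope C_scope.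

(** Put z = x + iy, write zb for its conjugate, and replace (f, g) by
    u = f + i g and v = f - i g.  The rotation by 2 theta multiplies u by z / zb and
    v by zb / z, so the twisted inversion acts separately on the two components
    ([twisted_inversion_comp]):
      u becomes |z|^(-2 lam) (z / zb) u(-1/z),
      v becomes |z|^(-2 lam) (zb / z) v(-1/z),
    and D1 f + D2 g = P u + Q v with P = (D1 - i D2) / 2 and Q = (D1 + i D2) / 2.
    The prefactors M satisfy z d_z M = al M and zb d_zb M = be M with
    (al, be) = (1 - lam, -1 - lam) for u and the swapped pair for v, and -1/z is
    holomorphic.  So the derivatives of M u(-1/z) are given by a product of
    two one-variable formulas, with coefficients c ([inv_coeff],
    [dzz_weight_pull]), and the functional identity for
    P = sum p_ij d_z^i d_zb^j says that, for all k, l and x,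
      sum_ij p_ij c(al,i,k) c(be,j,l) x^(-i-j-k-l) = |x|^(-2(nu - lam)) p_kl;
    likewise for Q with al and be exchanged.

    Let x tend to infinity.  The left-hand side behaves like p_kl x^(-2(k+l)), so
    p_kl can be non-zero only if nu - lam = k + l
    ([exponent_of_functional_identity]).  Thus nu - lam is a natural number a and p
    is homogeneous of degree a.  The equations with k + l = a - 1 then read
      (k+1) (al - k) p_(k+1,l) + (l+1) (be - l) p_(k,l+1) = 0,
    that is, T p = 0 for the Bessel operator
    T = al d_Z - Z d_Z^2 + be d_W - W d_W^2 acting on the polynomial
    p = sum p_ij Z^i W^j.  They imply the equations of lower order, because c is the
    matrix of exp(T) ([bessel_sum]).  So the solutions are exactly the pairs of
    homogeneous polynomials of degree a killed by T and by its swapped version.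

    The equation T p = 0 is a two-term recurrence along the antidiagonal.  If
    2 lam is not 0, -1, -2, ... then -1 - lam is not a natural number, and the
    recurrence can be solved from one end, so each of p and q varies in a space of
    dimension at most one ([bessel_proportional]).

    It remains to see that the operators D1, D2 of the theorem give solutions, and
    non-zero ones.  In the coordinates x and y the Bessel equation becomes a
    three-term relation between the coefficients of D1 and D2 ([bessel_xy],
    [bessel_of_bessel_xy]), which follows from the ratio of consecutive Gegenbauer
    coefficients ([bessel_xy_D]).  Neither P nor Q is zero
    ([symbol_chiral_part_neq_0]), so they span the solutions of the two Bessel
    equations; the pair (D1, D2) corresponds to (P, Q), and the dual pair
    (D2, - D1) to (i P, - i Q), and these two span everything. *)

(** * Wirtinger derivatives *)

Definition open_2d (U : R -> R -> Prop) : Prop :=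
  forall x y, U x y -> locally_2d U x y.

Definition smooth_on (U : R -> R -> Prop) (f : R -> R -> C) : Prop :=
  forall x y, U x y -> infinitely_diff_at f x y.

Definition eq_on (U : R -> R -> Prop) (f g : R -> R -> C) : Prop :=
  forall x y, U x y -> f x y = g x y.

(** The partial derivatives in x and y are a + b and i (a - b); that is, a and b
    are the values of d/dz and d/dzb, where zb is the conjugate of z = x + iy.
    Being a relation, it also records that the derivatives exist. *)
Definition is_wirtinger (f : R -> R -> C) (x y : R) (a b : C) : Prop :=
  (is_derive (fun t => Re (f t y)) x (Re (a + b)) /\
   is_derive (fun t => Im (f t y)) x (Im (a + b))) /\
  (is_derive (fun t => Re (f x t)) y (Re (Ci * (a - b))) /\
   is_derive (fun t => Im (f x t)) y (Im (Ci * (a - b)))).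

Definition dz : operator := fun f x y => (dx f x y - Ci * dy f x y) / 2.
Definition dzb : operator := fun f x y => (dx f x y + Ci * dy f x y) / 2.

Lemma is_wirtinger_dx f x y a b : is_wirtinger f x y a b -> dx f x y = a + b.
Proof.
intros [[H1 H2] _]; unfold dx.
apply injective_projections; now apply is_derive_unique.
Qed.

Lemma is_wirtinger_dy f x y a b :
  is_wirtinger f x y a b -> dy f x y = Ci * (a - b).
Proof.
intros [_ [H1 H2]]; unfold dy.
apply injective_projections; now apply is_derive_unique.
Qed.

Lemma Ci_sqr : Ci * Ci = - (1).
Proof. unfold Ci, Cmult, Copp, RtoC; simpl; f_equal; ring. Qed.

Lemma C2_neq_0 : (2 : C) <> 0.
Proof. intros H; apply RtoC_inj in H; lra. Qed.

Lemma is_wirtinger_unique f x y a b :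
  is_wirtinger f x y a b -> dz f x y = a /\ dzb f x y = b.
Proof.
intros H; unfold dz, dzb.
rewrite (is_wirtinger_dx _ _ _ _ _ H), (is_wirtinger_dy _ _ _ _ _ H).
replace (Ci * (Ci * (a - b))) with ((Ci * Ci) * (a - b)) by ring.
rewrite Ci_sqr; split; field; exact C2_neq_0.
Qed.

Lemma smooth_on_wirtinger U f x y : smooth_on U f -> U x y ->
  is_wirtinger f x y (dz f x y) (dzb f x y).
Proof.
intros Hf Hxy; destruct (Hf x y Hxy 1%nat) as [H1 H2]; simpl in H1, H2.
unfold is_wirtinger.
replace (dz f x y + dzb f x y) with (dx f x y)
  by (unfold dz, dzb; field; exact C2_neq_0).
replace (Ci * (dz f x y - dzb f x y)) with (dy f x y).
2: { unfold dz, dzb.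
     replace ((dx f x y - Ci * dy f x y) / 2 - (dx f x y + Ci * dy f x y) / 2)
       with (- Ci * dy f x y) by (field; exact C2_neq_0).
     replace (Ci * (- Ci * dy f x y)) with (- (Ci * Ci) * dy f x y) by ring.
     rewrite Ci_sqr; ring. }
unfold dx, dy; cbn [Re Im fst snd].
split; split; apply Derive_correct; tauto.
Qed.

Lemma is_wirtinger_ext_loc f g x y a b :
  locally_2d (fun u v => f u v = g u v) x y ->
  is_wirtinger f x y a b -> is_wirtinger g x y a b.
Proof.
intros [d Hd] [[H1 H2] [H3 H4]].
assert (Hx : locally x (fun t => f t y = g t y)).
{ exists d; intros t Ht; apply Hd; [exact Ht|].
  rewrite Rminus_diag; rewrite Rabs_R0; apply cond_pos. }
assert (Hy : locally y (fun t => f x t = g x t)).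
{ exists d; intros t Ht; apply Hd; [|exact Ht].
  rewrite Rminus_diag; rewrite Rabs_R0; apply cond_pos. }
split; split; (eapply is_derive_ext_loc; [|eassumption]);
  [revert Hx|revert Hx|revert Hy|revert Hy]; apply filter_imp;
  intros t ->; reflexivity.
Qed.

Lemma is_wirtinger_const c x y : is_wirtinger (fun _ _ => c) x y 0 0.
Proof.
unfold is_wirtinger.
replace (Ci * (0 - 0)) with (RtoC 0) by ring.
replace (0 + 0) with (RtoC 0) by ring.
split; split; apply (is_derive_const (V := R_NormedModule)).
Qed.

Lemma is_wirtinger_plus f g x y a b a' b' :
  is_wirtinger f x y a b -> is_wirtinger g x y a' b' ->
  is_wirtinger (fun u v => f u v + g u v) x y (a + a') (b + b').
Proof.
intros [[H1 H2] [H3 H4]] [[K1 K2] [K3 K4]]; unfold is_wirtinger.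
replace (a + a' + (b + b')) with ((a + b) + (a' + b')) by ring.
replace (Ci * (a + a' - (b + b'))) with (Ci * (a - b) + Ci * (a' - b')) by ring.
split; split; now apply (is_derive_plus (V := R_NormedModule)).
Qed.

Lemma is_derive_mult_R (f g : R -> R) x a b :
  is_derive f x a -> is_derive g x b ->
  is_derive (fun t => f t * g t)%R x (a * g x + f x * b)%R.
Proof.
intros Hf Hg.
apply (is_derive_mult f g x a b Hf Hg); intros; apply Rmult_comm.
Qed.

Lemma is_wirtinger_mult f g x y a b a' b' :
  is_wirtinger f x y a b -> is_wirtinger g x y a' b' ->
  is_wirtinger (fun u v => f u v * g u v) x y
    (a * g x y + f x y * a') (b * g x y + f x y * b').
Proof.
intros [[H1 H2] [H3 H4]] [[K1 K2] [K3 K4]]; unfold is_wirtinger.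
replace (a * g x y + f x y * a' + (b * g x y + f x y * b'))
  with ((a + b) * g x y + f x y * (a' + b')) by ring.
replace (Ci * (a * g x y + f x y * a' - (b * g x y + f x y * b')))
  with ((Ci * (a - b)) * g x y + f x y * (Ci * (a' - b'))) by ring.
revert H1 H2 H3 H4 K1 K2 K3 K4.
generalize (a + b) (Ci * (a - b)) (a' + b') (Ci * (a' - b')).
intros p q r s H1 H2 H3 H4 K1 K2 K3 K4.
pose proof (is_derive_mult_R _ _ _ _ _ H1 K1) as A1.
pose proof (is_derive_mult_R _ _ _ _ _ H2 K2) as A2.
pose proof (is_derive_mult_R _ _ _ _ _ H1 K2) as A3.
pose proof (is_derive_mult_R _ _ _ _ _ H2 K1) as A4.
pose proof (is_derive_mult_R _ _ _ _ _ H3 K3) as B1.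
pose proof (is_derive_mult_R _ _ _ _ _ H4 K4) as B2.
pose proof (is_derive_mult_R _ _ _ _ _ H3 K4) as B3.
pose proof (is_derive_mult_R _ _ _ _ _ H4 K3) as B4.
pose proof (is_derive_minus _ _ _ _ _ A1 A2) as C1.
pose proof (is_derive_plus _ _ _ _ _ A3 A4) as C2.
pose proof (is_derive_minus _ _ _ _ _ B1 B2) as C3.
pose proof (is_derive_plus _ _ _ _ _ B3 B4) as C4.
split; split;
[ refine (eq_rect _ (is_derive _ _) C1 _ _)
| refine (eq_rect _ (is_derive _ _) C2 _ _)
| refine (eq_rect _ (is_derive _ _) C3 _ _)
| refine (eq_rect _ (is_derive _ _) C4 _ _) ];
unfold minus, plus, opp, Re, Im; simpl; ring.
Qed.

Lemma is_wirtinger_z x y : is_wirtinger (fun u v => (u, v)) x y 1 0.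
Proof.
unfold is_wirtinger, Re, Im; simpl.
split; split; auto_derive; auto; ring.
Qed.

Lemma is_wirtinger_zb x y : is_wirtinger (fun u v => (u, - v)%R) x y 0 1.
Proof.
unfold is_wirtinger, Re, Im; simpl.
split; split; auto_derive; auto; ring.
Qed.

Definition punctured (x y : R) : Prop := x <> 0%R \/ y <> 0%R.

Lemma punctured_norm_pos x y : punctured x y -> (0 < x ^ 2 + y ^ 2)%R.
Proof. intros [H|H]; nra. Qed.

Lemma open_punctured : open_2d punctured.
Proof.
intros x y Hxy.
assert (H : continuity_2d_pt (fun u v => u * u + v * v)%R x y).
{ apply continuity_2d_pt_plus; apply continuity_2d_pt_mult;
  try apply continuity_2d_pt_id1; apply continuity_2d_pt_id2. }
apply continuity_2d_pt_neq_0 in H.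
2: { pose proof (punctured_norm_pos _ _ Hxy); lra. }
revert H; apply locally_2d_impl, locally_2d_forall; intros u v H.
destruct (Req_dec u 0); [right; intros ->; apply H; nra | now left].
Qed.

Definition zinv (x y : R) : C :=
  ((x / (x ^ 2 + y ^ 2))%R, (- y / (x ^ 2 + y ^ 2))%R).
Definition zbinv (x y : R) : C :=
  ((x / (x ^ 2 + y ^ 2))%R, (y / (x ^ 2 + y ^ 2))%R).

(** The base is |z|^2, so this is |z|^(-2 lam). *)
Definition norm_pow (lam : C) (x y : R) : C := Rcpow (x ^ 2 + y ^ 2) (- lam).

Lemma is_wirtinger_zinv x y : punctured x y ->
  is_wirtinger zinv x y (- (zinv x y * zinv x y)) 0.
Proof.
intros H; apply punctured_norm_pos in H; unfold is_wirtinger, zinv, Re, Im; simpl.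
split; split; auto_derive; try nra; field; nra.
Qed.

Lemma is_wirtinger_zbinv x y : punctured x y ->
  is_wirtinger zbinv x y 0 (- (zbinv x y * zbinv x y)).
Proof.
intros H; apply punctured_norm_pos in H; unfold is_wirtinger, zbinv, Re, Im; simpl.
split; split; auto_derive; try nra; field; nra.
Qed.

Lemma is_wirtinger_norm_pow lam x y : punctured x y ->
  is_wirtinger (norm_pow lam) x y
    (- lam * (zinv x y * norm_pow lam x y))
    (- lam * (zbinv x y * norm_pow lam x y)).
Proof.
intros H; apply punctured_norm_pos in H.
destruct lam as [l1 l2].
unfold is_wirtinger, norm_pow, Rcpow, zinv, zbinv, Re, Im; simpl.
split; split; auto_derive; try nra; field; nra.
Qed.

Lemma differentiable_of_smooth_on (U : R -> R -> Prop) (g : R -> R -> R) x y :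
  open_2d U -> (forall u v, U u v -> ex_diff_n g 1 u v) -> U x y ->
  differentiable_pt_lim g x y (Derive (fun t => g t y) x) (Derive (fun t => g x t) y).
Proof.
intros HU Hg Hxy.
apply filterdiff_differentiable_pt_lim.
apply (is_derive_filterdiff g x y (fun u v => Derive (fun t => g t v) u)).
- destruct (HU x y Hxy) as [d Hd]; exists d; intros [u v] [Hu Hv].
  apply Derive_correct; apply (Hg u v (Hd u v Hu Hv)).
- apply Derive_correct; apply (Hg x y Hxy).
- destruct (Hg x y Hxy) as (_ & _ & _ & [H _] & _).
  exact (proj1 (continuity_2d_pt_filterlim
                  (fun u v => Derive (fun t => g t v) u) x y) H).
Qed.

(** [inv_x] and [inv_y] are the coordinates of -1/z. *)
Definition inv_x (x y : R) : R := (- x / (x ^ 2 + y ^ 2))%R.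
Definition inv_y (x y : R) : R := (y / (x ^ 2 + y ^ 2))%R.

Definition pull (u : R -> R -> C) (x y : R) : C := u (inv_x x y) (inv_y x y).

Definition plane (x y : R) : Prop := True.

Lemma open_plane : open_2d plane.
Proof. intros x y _; apply locally_2d_forall; now intros. Qed.

(** The map -1/z is holomorphic with derivative 1/z^2, so the chain rule has no
    mixed terms: d/dz falls on d/dz only, and d/dzb on d/dzb. *)
Lemma is_wirtinger_pull u x y : smooth u -> punctured x y ->
  is_wirtinger (pull u) x y
    (zinv x y * zinv x y * pull (dz u) x y)
    (zbinv x y * zbinv x y * pull (dzb u) x y).
Proof.
intros Hu H; apply punctured_norm_pos in H.
assert (Hr : differentiable_pt_lim (fun s t => Re (u s t)) (inv_x x y) (inv_y x y)
  (Re (dx u (inv_x x y) (inv_y x y))) (Re (dy u (inv_x x y) (inv_y x y)))).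
{ apply (differentiable_of_smooth_on plane); [exact open_plane| |exact I].
  intros s t _; apply (Hu s t 1%nat). }
assert (Hi : differentiable_pt_lim (fun s t => Im (u s t)) (inv_x x y) (inv_y x y)
  (Im (dx u (inv_x x y) (inv_y x y))) (Im (dy u (inv_x x y) (inv_y x y)))).
{ apply (differentiable_of_smooth_on plane); [exact open_plane| |exact I].
  intros s t _; apply (Hu s t 1%nat). }
assert (X1 : is_derive (fun t => inv_x t y) x ((x ^ 2 - y ^ 2) / (x ^ 2 + y ^ 2) ^ 2)%R).
{ unfold inv_x; auto_derive; [nra|field; nra]. }
assert (X2 : is_derive (fun t => inv_y t y) x (- (2 * x * y) / (x ^ 2 + y ^ 2) ^ 2)%R).
{ unfold inv_y; auto_derive; [nra|field; nra]. }
assert (Y1 : is_derive (fun t => inv_x x t) y ((2 * x * y) / (x ^ 2 + y ^ 2) ^ 2)%R).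
{ unfold inv_x; auto_derive; [nra|field; nra]. }
assert (Y2 : is_derive (fun t => inv_y x t) y ((x ^ 2 - y ^ 2) / (x ^ 2 + y ^ 2) ^ 2)%R).
{ unfold inv_y; auto_derive; [nra|field; nra]. }
apply is_derive_Reals in X1, X2, Y1, Y2.
unfold is_wirtinger, pull, dz, dzb.
generalize dependent (dx u (inv_x x y) (inv_y x y)).
generalize dependent (dy u (inv_x x y) (inv_y x y)).
intros [p p'] [q q'] Hr Hi.
split; split; apply is_derive_Reals;
 match goal with |- derivable_pt_lim ?f _ _ => idtac end.
- pose proof (derivable_pt_lim_comp_2d _ (fun t => inv_x t y) (fun t => inv_y t y) _ _ _ _ _ Hr X1 X2) as K.
  refine (eq_rect _ (derivable_pt_lim _ _) K _ _).
  unfold zinv, zbinv, Re, Im; simpl; field; nra.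
- pose proof (derivable_pt_lim_comp_2d _ (fun t => inv_x t y) (fun t => inv_y t y) _ _ _ _ _ Hi X1 X2) as K.
  refine (eq_rect _ (derivable_pt_lim _ _) K _ _).
  unfold zinv, zbinv, Re, Im; simpl; field; nra.
- pose proof (derivable_pt_lim_comp_2d _ (fun t => inv_x x t) (fun t => inv_y x t) _ _ _ _ _ Hr Y1 Y2) as K.
  refine (eq_rect _ (derivable_pt_lim _ _) K _ _).
  unfold zinv, zbinv, Re, Im; simpl; field; nra.
- pose proof (derivable_pt_lim_comp_2d _ (fun t => inv_x x t) (fun t => inv_y x t) _ _ _ _ _ Hi Y1 Y2) as K.
  refine (eq_rect _ (derivable_pt_lim _ _) K _ _).
  unfold zinv, zbinv, Re, Im; simpl; field; nra.
Qed.

(** * Smooth functions off the origin *)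

Definition continuous_at (f : R -> R -> C) (x y : R) : Prop :=
  continuity_2d_pt (fun u v => Re (f u v)) x y /\
  continuity_2d_pt (fun u v => Im (f u v)) x y.

Lemma continuity_2d_pt_comp (f g h : R -> R -> R) (x y : R) :
  continuity_2d_pt f (g x y) (h x y) ->
  continuity_2d_pt g x y -> continuity_2d_pt h x y ->
  continuity_2d_pt (fun u v => f (g u v) (h u v)) x y.
Proof.
intros Hf Hg Hh eps; destruct (Hf eps) as [d Hd].
pose proof (locally_2d_and _ _ _ _ (Hg d) (Hh d)) as H.
revert H; apply locally_2d_impl, locally_2d_forall.
intros u v [H1 H2]; now apply Hd.
Qed.

(** All the functions met below, gathered in one class that is closed under
    differentiation.  Smoothness then follows for the whole class at once, with
    no separate treatment of products and compositions at each order. *)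
Inductive elementary (U : R -> R -> Prop) : (R -> R -> C) -> Prop :=
| elementary_smooth f : smooth_on U f -> elementary U f
| elementary_const c : elementary U (fun _ _ => c)
| elementary_z : elementary U (fun x y => (x, y))
| elementary_zb : elementary U (fun x y => (x, - y)%R)
| elementary_plus f g : elementary U f -> elementary U g ->
    elementary U (fun x y => f x y + g x y)
| elementary_mult f g : elementary U f -> elementary U g ->
    elementary U (fun x y => f x y * g x y)
| elementary_zinv : (forall x y, U x y -> punctured x y) -> elementary U zinv
| elementary_zbinv : (forall x y, U x y -> punctured x y) -> elementary U zbinv
| elementary_norm_pow lam : (forall x y, U x y -> punctured x y) ->
    elementary U (norm_pow lam)
| elementary_pull u : (forall x y, U x y -> punctured x y) -> smooth u ->
    elementary U (pull u).

Lemma continuity_2d_pt_norm x y : continuity_2d_pt (fun u v => u ^ 2 + v ^ 2)%R x y.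
Proof.
apply continuity_2d_pt_plus; simpl;
repeat apply continuity_2d_pt_mult;
auto using continuity_2d_pt_id1, continuity_2d_pt_id2, continuity_2d_pt_const.
Qed.

Lemma continuity_2d_pt_div_norm g x y : punctured x y ->
  continuity_2d_pt g x y ->
  continuity_2d_pt (fun u v => g u v / (u ^ 2 + v ^ 2))%R x y.
Proof.
intros Hp Hg; apply continuity_2d_pt_mult; [exact Hg|].
apply continuity_2d_pt_inv; [apply continuity_2d_pt_norm|].
pose proof (punctured_norm_pos _ _ Hp); lra.
Qed.

Lemma elementary_continuous U f x y :
  elementary U f -> U x y -> continuous_at f x y.
Proof.
intros Hf Hxy; induction Hf as
  [f Hf|c| | |f g _ [IF1 IF2] _ [IG1 IG2]|f g _ [IF1 IF2] _ [IG1 IG2]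
  |HU|HU|lam HU|u HU Hu]; unfold continuous_at; simpl.
- destruct (Hf x y Hxy 0%nat) as [[H1 _] [H2 _]]; now split.
- split; apply continuity_2d_pt_const.
- split; [apply continuity_2d_pt_id1|apply continuity_2d_pt_id2].
- split; [apply continuity_2d_pt_id1|].
  apply continuity_2d_pt_opp, continuity_2d_pt_id2.
- split; now apply continuity_2d_pt_plus.
- split; [apply continuity_2d_pt_minus|apply continuity_2d_pt_plus];
  now apply continuity_2d_pt_mult.
- split; apply continuity_2d_pt_div_norm; auto using continuity_2d_pt_id1,
    continuity_2d_pt_id2, continuity_2d_pt_opp.
- split; apply continuity_2d_pt_div_norm; auto using continuity_2d_pt_id1,
    continuity_2d_pt_id2.
- pose proof (punctured_norm_pos _ _ (HU _ _ Hxy)) as Hn.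
  assert (Hl : continuity_2d_pt (fun u v => ln (u ^ 2 + v ^ 2)) x y).
  { apply continuity_1d_2d_pt_comp; [|apply continuity_2d_pt_norm].
    apply derivable_continuous_pt; exists (/ (x ^ 2 + y ^ 2))%R.
    now apply derivable_pt_lim_ln. }
  split; apply continuity_2d_pt_mult; apply continuity_1d_2d_pt_comp;
  try (apply continuity_2d_pt_mult; [apply continuity_2d_pt_const|exact Hl]);
  apply derivable_continuous_pt;
  [apply derivable_pt_exp|apply derivable_pt_cos|apply derivable_pt_exp
  |apply derivable_pt_sin].
- pose proof (HU _ _ Hxy) as Hp.
  destruct (Hu (inv_x x y) (inv_y x y) 0%nat) as [[H1 _] [H2 _]].
  assert (G1 : continuity_2d_pt inv_x x y).
  { apply continuity_2d_pt_div_norm; auto using continuity_2d_pt_id1,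
      continuity_2d_pt_opp. }
  assert (G2 : continuity_2d_pt inv_y x y).
  { apply continuity_2d_pt_div_norm; auto using continuity_2d_pt_id2. }
  split.
  + exact (continuity_2d_pt_comp (fun s t => Re (u s t)) _ _ x y H1 G1 G2).
  + exact (continuity_2d_pt_comp (fun s t => Im (u s t)) _ _ x y H2 G1 G2).
Qed.

Lemma smooth_on_dx U f : smooth_on U f -> smooth_on U (dx f).
Proof.
intros Hf x y Hxy n; destruct (Hf x y Hxy (S n)) as [H1 H2].
simpl in H1, H2; split; [apply H1|apply H2].
Qed.

Lemma smooth_on_dy U f : smooth_on U f -> smooth_on U (dy f).
Proof.
intros Hf x y Hxy n; destruct (Hf x y Hxy (S n)) as [H1 H2].
simpl in H1, H2; split; [apply H1|apply H2].
Qed.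

Lemma elementary_lin U (a b : C) f g : elementary U f -> elementary U g ->
  elementary U (fun x y => a * f x y + b * g x y).
Proof.
intros Hf Hg; apply elementary_plus; apply elementary_mult;
auto using elementary_const.
Qed.

Lemma elementary_derive U f : elementary U f ->
  exists f1 f2, elementary U f1 /\ elementary U f2 /\
    forall x y, U x y -> is_wirtinger f x y (f1 x y) (f2 x y).
Proof.
intros Hf; induction Hf as
  [f Hf|c| | |f g Hf (f1 & f2 & F1 & F2 & F) Hg (g1 & g2 & G1 & G2 & G)
  |f g Hf (f1 & f2 & F1 & F2 & F) Hg (g1 & g2 & G1 & G2 & G)
  |HU|HU|lam HU|u HU Hu].
- exists (fun x y => / 2 * dx f x y + (- Ci / 2) * dy f x y),
    (fun x y => / 2 * dx f x y + (Ci / 2) * dy f x y).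
  split; [|split].
  1, 2: apply elementary_lin; apply elementary_smooth;
    [now apply smooth_on_dx|now apply smooth_on_dy].
  intros x y Hxy.
  replace (/ 2 * dx f x y + - Ci / 2 * dy f x y) with (dz f x y)
    by (unfold dz; field; exact C2_neq_0).
  replace (/ 2 * dx f x y + Ci / 2 * dy f x y) with (dzb f x y)
    by (unfold dzb; field; exact C2_neq_0).
  now apply (smooth_on_wirtinger U).
- exists (fun _ _ => 0), (fun _ _ => 0).
  split; [apply elementary_const|split; [apply elementary_const|]].
  intros x y _; apply is_wirtinger_const.
- exists (fun _ _ => 1), (fun _ _ => 0).
  split; [apply elementary_const|split; [apply elementary_const|]].
  intros x y _; apply is_wirtinger_z.
- exists (fun _ _ => 0), (fun _ _ => 1).
  split; [apply elementary_const|split; [apply elementary_const|]].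
  intros x y _; apply is_wirtinger_zb.
- exists (fun x y => f1 x y + g1 x y), (fun x y => f2 x y + g2 x y).
  split; [now apply elementary_plus|split; [now apply elementary_plus|]].
  intros x y Hxy; apply is_wirtinger_plus; auto.
- exists (fun x y => f1 x y * g x y + f x y * g1 x y),
    (fun x y => f2 x y * g x y + f x y * g2 x y).
  split; [|split].
  1, 2: apply elementary_plus; now apply elementary_mult.
  intros x y Hxy; apply is_wirtinger_mult; auto.
- exists (fun x y => (- (1)) * (zinv x y * zinv x y)), (fun _ _ => 0).
  split; [|split; [apply elementary_const|]].
  + apply elementary_mult; [apply elementary_const|].
    apply elementary_mult; now apply elementary_zinv.
  + intros x y Hxy.
    replace (- (1) * (zinv x y * zinv x y)) with (- (zinv x y * zinv x y)) by ring.
    apply is_wirtinger_zinv; auto.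
- exists (fun _ _ => 0), (fun x y => (- (1)) * (zbinv x y * zbinv x y)).
  split; [apply elementary_const|split].
  + apply elementary_mult; [apply elementary_const|].
    apply elementary_mult; now apply elementary_zbinv.
  + intros x y Hxy.
    replace (- (1) * (zbinv x y * zbinv x y)) with (- (zbinv x y * zbinv x y)) by ring.
    apply is_wirtinger_zbinv; auto.
- exists (fun x y => - lam * (zinv x y * norm_pow lam x y)),
    (fun x y => - lam * (zbinv x y * norm_pow lam x y)).
  split; [|split].
  1, 2: apply elementary_mult; [apply elementary_const|];
    apply elementary_mult; auto using elementary_zinv, elementary_zbinv,
      elementary_norm_pow.
  intros x y Hxy; apply is_wirtinger_norm_pow; auto.
- exists (fun x y => zinv x y * zinv x y *
            (/ 2 * pull (dx u) x y + (- Ci / 2) * pull (dy u) x y)),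
    (fun x y => zbinv x y * zbinv x y *
            (/ 2 * pull (dx u) x y + (Ci / 2) * pull (dy u) x y)).
  assert (Hu' : smooth_on plane u) by (intros x y _; apply Hu).
  assert (H : forall a : C, elementary U
            (fun x y => / 2 * pull (dx u) x y + a * pull (dy u) x y)).
  { intros a; apply elementary_lin; apply elementary_pull; auto.
    - intros x y; now apply (smooth_on_dx plane).
    - intros x y; now apply (smooth_on_dy plane). }
  split; [|split].
  1, 2: apply elementary_mult; auto;
    apply elementary_mult; auto using elementary_zinv, elementary_zbinv.
  intros x y Hxy.
  replace (/ 2 * pull (dx u) x y + - Ci / 2 * pull (dy u) x y)
    with (pull (dz u) x y) by (unfold pull, dz; field; exact C2_neq_0).
  replace (/ 2 * pull (dx u) x y + Ci / 2 * pull (dy u) x y)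
    with (pull (dzb u) x y) by (unfold pull, dzb; field; exact C2_neq_0).
  apply is_wirtinger_pull; auto.
Qed.

(** The partial derivatives of a member agree on U with members, so the order of
    differentiability can be raised one step at a time.  The agreement has to
    hold near each point, whence the open set. *)
Lemma elementary_smooth_on U f : open_2d U -> elementary U f -> smooth_on U f.
Proof.
intros HU Hf x y Hxy n; revert f Hf x y Hxy.
induction n as [|n IH]; intros f Hf x y Hxy.
- destruct (elementary_continuous U f x y Hf Hxy); simpl; tauto.
- destruct (elementary_continuous U f x y Hf Hxy) as [C1 C2].
  destruct (elementary_derive U f Hf) as (f1 & f2 & F1 & F2 & F).
  assert (G1 : elementary U (fun u v => 1 * f1 u v + 1 * f2 u v))
    by now apply elementary_lin.
  assert (G2 : elementary U (fun u v => Ci * f1 u v + - Ci * f2 u v))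
    by now apply elementary_lin.
  destruct (F x y Hxy) as [[D1 D2] [D3 D4]].
  pose proof (IH _ G1 x y Hxy) as [I1 I2].
  pose proof (IH _ G2 x y Hxy) as [I3 I4].
  assert (E1 : locally_2d (fun u v => 1 * f1 u v + 1 * f2 u v = dx f u v) x y).
  { apply locally_2d_impl with (2 := HU x y Hxy), locally_2d_forall.
    intros u v Huv; rewrite (is_wirtinger_dx _ _ _ _ _ (F u v Huv)); ring. }
  assert (E2 : locally_2d (fun u v => Ci * f1 u v + - Ci * f2 u v = dy f u v) x y).
  { apply locally_2d_impl with (2 := HU x y Hxy), locally_2d_forall.
    intros u v Huv; rewrite (is_wirtinger_dy _ _ _ _ _ (F u v Huv)); ring. }
  simpl; split; (split; [assumption|]; split; [eexists; eassumption|];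
    split; [eexists; eassumption|]; split).
  + eapply ex_diff_n_ext_loc; [|exact I1].
    revert E1; apply locally_2d_impl, locally_2d_forall; intros u v ->; reflexivity.
  + eapply ex_diff_n_ext_loc; [|exact I3].
    revert E2; apply locally_2d_impl, locally_2d_forall; intros u v ->; reflexivity.
  + eapply ex_diff_n_ext_loc; [|exact I2].
    revert E1; apply locally_2d_impl, locally_2d_forall; intros u v ->; reflexivity.
  + eapply ex_diff_n_ext_loc; [|exact I4].
    revert E2; apply locally_2d_impl, locally_2d_forall; intros u v ->; reflexivity.
Qed.

Lemma smooth_on_ext U f g : open_2d U -> eq_on U f g ->
  smooth_on U f -> smooth_on U g.
Proof.
intros HU E Hf x y Hxy n; destruct (Hf x y Hxy n) as [H1 H2].
split; [eapply ex_diff_n_ext_loc; [|exact H1]|eapply ex_diff_n_ext_loc; [|exact H2]];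
apply locally_2d_impl with (2 := HU x y Hxy), locally_2d_forall;
intros u v Huv; now rewrite (E u v Huv).
Qed.

Lemma smooth_on_plus U f g : open_2d U -> smooth_on U f -> smooth_on U g ->
  smooth_on U (fun x y => f x y + g x y).
Proof.
intros HU Hf Hg; apply elementary_smooth_on; [exact HU|].
apply (elementary_plus U f g); now apply elementary_smooth.
Qed.

Lemma smooth_on_scal U c f : open_2d U -> smooth_on U f ->
  smooth_on U (fun x y => c * f x y).
Proof.
intros HU Hf; apply elementary_smooth_on; [exact HU|].
apply (elementary_mult U (fun _ _ => c) f);
[apply elementary_const|now apply elementary_smooth].
Qed.

Lemma smooth_on_const U c : open_2d U -> smooth_on U (fun _ _ => c).
Proof.
intros HU; apply elementary_smooth_on; [exact HU|apply elementary_const].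
Qed.

Lemma smooth_on_dz U f : open_2d U -> smooth_on U f -> smooth_on U (dz f).
Proof.
intros HU Hf.
apply (smooth_on_ext U (fun x y => / 2 * dx f x y + - Ci / 2 * dy f x y) _ HU).
- intros x y _; unfold dz; field; exact C2_neq_0.
- apply (smooth_on_plus U (fun x y => / 2 * dx f x y) _ HU);
  apply smooth_on_scal; auto using smooth_on_dx, smooth_on_dy.
Qed.

Lemma smooth_on_dzb U f : open_2d U -> smooth_on U f -> smooth_on U (dzb f).
Proof.
intros HU Hf.
apply (smooth_on_ext U (fun x y => / 2 * dx f x y + Ci / 2 * dy f x y) _ HU).
- intros x y _; unfold dzb; field; exact C2_neq_0.
- apply (smooth_on_plus U (fun x y => / 2 * dx f x y) _ HU);
  apply smooth_on_scal; auto using smooth_on_dx, smooth_on_dy.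
Qed.

Lemma dx_dy_comm U f : open_2d U -> smooth_on U f ->
  eq_on U (dx (dy f)) (dy (dx f)).
Proof.
intros HU Hf x y Hxy; unfold dx, dy; cbn [Re Im fst snd].
assert (K : forall g : R -> R -> R,
  (forall u v, U u v -> ex_diff_n g 2 u v) ->
  Derive (fun t => Derive (fun s => g t s) y) x =
  Derive (fun t => Derive (fun s => g s t) x) y).
{ intros g Hg; apply Schwarz.
  - apply locally_2d_impl with (2 := HU x y Hxy), locally_2d_forall.
    intros u v Huv; specialize (Hg u v Huv); simpl in Hg; tauto.
  - specialize (Hg x y Hxy); simpl in Hg; tauto.
  - specialize (Hg x y Hxy); simpl in Hg; tauto. }
f_equal; apply K; intros u v Huv; apply (Hf u v Huv 2%nat).
Qed.

(** * Finite sums and constant-coefficient operators *)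

Fixpoint Csum (n : nat) (F : nat -> C) : C :=
  match n with O => 0 | S m => Csum m F + F m end.

Lemma Csum_ext n F G : (forall i, (i < n)%nat -> F i = G i) -> Csum n F = Csum n G.
Proof.
induction n as [|n IH]; intros H; [reflexivity|]; simpl.
rewrite IH, H by auto; reflexivity.
Qed.

Lemma Csum_0 n (F : nat -> C) : (forall i, (i < n)%nat -> F i = 0) -> Csum n F = 0.
Proof.
induction n as [|n IH]; intros H; [reflexivity|]; simpl.
rewrite IH, H by auto; ring.
Qed.

Lemma Csum_plus n F G : Csum n (fun i => F i + G i) = Csum n F + Csum n G.
Proof. induction n as [|n IH]; simpl; [ring|rewrite IH; ring]. Qed.

Lemma Csum_scal n c F : Csum n (fun i => c * F i) = c * Csum n F.
Proof. induction n as [|n IH]; simpl; [ring|rewrite IH; ring]. Qed.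

Lemma Csum_swap n m (F : nat -> nat -> C) :
  Csum n (fun i => Csum m (F i)) = Csum m (fun j => Csum n (fun i => F i j)).
Proof.
induction n as [|n IH]; simpl.
- symmetry; now apply Csum_0.
- now rewrite IH, <- Csum_plus.
Qed.

Lemma Csum_first n F : Csum (S n) F = F O + Csum n (fun i => F (S i)).
Proof.
induction n as [|n IH]; [simpl; ring|].
change (Csum (S (S n)) F) with (Csum (S n) F + F (S n)).
rewrite IH; simpl; ring.
Qed.

Lemma Csum_extend n m (F : nat -> C) : (n <= m)%nat ->
  (forall i, (n <= i)%nat -> F i = 0) -> Csum m F = Csum n F.
Proof.
intros H HF; induction H as [|m H IH]; [reflexivity|]; simpl.
rewrite IH, (HF m H); ring.
Qed.

Lemma Csum_single n k (F : nat -> C) : (k < n)%nat ->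
  (forall i, i <> k -> F i = 0) -> Csum n F = F k.
Proof.
intros Hk HF; rewrite (Csum_extend (S k) n F Hk) by (intros; apply HF; lia).
simpl; rewrite Csum_0 by (intros; apply HF; lia); ring.
Qed.

Lemma sum_n_Csum (F : nat -> C) n : sum_n F n = Csum (S n) F.
Proof.
induction n as [|n IH]; [rewrite sum_O; simpl; ring|].
rewrite sum_Sn, IH; reflexivity.
Qed.

Lemma smooth_on_Csum U n (F : nat -> R -> R -> C) : open_2d U ->
  (forall i, (i < n)%nat -> smooth_on U (F i)) ->
  smooth_on U (fun x y => Csum n (fun i => F i x y)).
Proof.
intros HU; induction n as [|n IH]; intros HF; simpl.
- now apply smooth_on_const.
- apply smooth_on_plus; auto.
Qed.

(** As [Derive] is total, differentiation is additive, and insensitive to a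
    change of the function outside U, only on functions smooth on U.  These are
    the facts that remain. *)
Record linear_on (U : R -> R -> Prop) (D : operator) : Prop := {
  linear_on_smooth f : smooth_on U f -> smooth_on U (D f);
  linear_on_ext f g : smooth_on U f -> eq_on U f g -> eq_on U (D f) (D g);
  linear_on_plus f g : smooth_on U f -> smooth_on U g ->
    eq_on U (D (fun x y => f x y + g x y)) (fun x y => D f x y + D g x y);
  linear_on_scal c f : smooth_on U f ->
    eq_on U (D (fun x y => c * f x y)) (fun x y => c * D f x y)
}.

Lemma is_wirtinger_scal c f x y a b : is_wirtinger f x y a b ->
  is_wirtinger (fun u v => c * f u v) x y (c * a) (c * b).
Proof.
intros H.
pose proof (is_wirtinger_mult _ _ _ _ _ _ _ _ (is_wirtinger_const c x y) H) as K.
simpl in K; replace (c * a) with (0 * f x y + c * a) by ring.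
replace (c * b) with (0 * f x y + c * b) by ring; exact K.
Qed.

Lemma dz_dzb_linear_on U : open_2d U -> linear_on U dz /\ linear_on U dzb.
Proof.
intros HU.
assert (Hext : forall f g, smooth_on U f -> eq_on U f g -> forall x y, U x y ->
          is_wirtinger g x y (dz f x y) (dzb f x y)).
{ intros f g Hf E x y Hxy.
  apply is_wirtinger_ext_loc with f; [|now apply (smooth_on_wirtinger U)].
  apply locally_2d_impl with (2 := HU x y Hxy), locally_2d_forall; exact E. }
split; split.
- intros f; now apply smooth_on_dz.
- intros f g Hf E x y Hxy; symmetry.
  eapply is_wirtinger_unique, Hext; eassumption.
- intros f g Hf Hg x y Hxy.
  eapply is_wirtinger_unique, is_wirtinger_plus;
    eapply smooth_on_wirtinger; eassumption.
- intros c f Hf x y Hxy.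
  eapply is_wirtinger_unique, is_wirtinger_scal, smooth_on_wirtinger; eassumption.
- intros f; now apply smooth_on_dzb.
- intros f g Hf E x y Hxy; symmetry.
  eapply is_wirtinger_unique, Hext; eassumption.
- intros f g Hf Hg x y Hxy.
  eapply is_wirtinger_unique, is_wirtinger_plus;
    eapply smooth_on_wirtinger; eassumption.
- intros c f Hf x y Hxy.
  eapply is_wirtinger_unique, is_wirtinger_scal, smooth_on_wirtinger; eassumption.
Qed.

Lemma linear_on_dz U : open_2d U -> linear_on U dz.
Proof. apply dz_dzb_linear_on. Qed.

Lemma linear_on_dzb U : open_2d U -> linear_on U dzb.
Proof. apply dz_dzb_linear_on. Qed.

Lemma linear_on_id U : linear_on U op_id.
Proof. split; unfold op_id; auto; intros; now intros x y _. Qed.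

Lemma linear_on_zero U : open_2d U -> linear_on U op_zero.
Proof.
intros HU; split; unfold op_zero.
- intros; now apply smooth_on_const.
- now intros f g _ _ x y _.
- intros f g _ _ x y _; ring.
- intros c f _ x y _; ring.
Qed.

Lemma eq_on_sym U f g : eq_on U f g -> eq_on U g f.
Proof. intros H x y Hxy; symmetry; auto. Qed.

Lemma eq_on_trans U f g h : eq_on U f g -> eq_on U g h -> eq_on U f h.
Proof. intros H K x y Hxy; rewrite H; auto. Qed.

(** Variant of [linear_on_ext] in which the function known to be smooth is the
    second one. *)
Lemma linear_on_ext_r U D f g : linear_on U D -> smooth_on U g ->
  eq_on U f g -> eq_on U (D f) (D g).
Proof.
intros HD Hg E; apply eq_on_sym, (linear_on_ext _ _ HD); auto using eq_on_sym.
Qed.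

Lemma linear_on_comp U A B : open_2d U ->
  linear_on U A -> linear_on U B -> linear_on U (op_comp A B).
Proof.
intros HU HA HB; unfold op_comp; split.
- intros f Hf; now apply HA, HB.
- intros f g Hf E; apply (linear_on_ext _ _ HA); [now apply HB|].
  now apply (linear_on_ext _ _ HB).
- intros f g Hf Hg.
  pose proof (linear_on_smooth _ _ HB _ Hf); pose proof (linear_on_smooth _ _ HB _ Hg).
  eapply eq_on_trans; [|now apply (linear_on_plus _ _ HA)].
  apply linear_on_ext_r; auto; [now apply smooth_on_plus|].
  now apply (linear_on_plus _ _ HB).
- intros c f Hf.
  pose proof (linear_on_smooth _ _ HB _ Hf).
  eapply eq_on_trans; [|now apply (linear_on_scal _ _ HA)].
  apply linear_on_ext_r; auto; [now apply smooth_on_scal|].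
  now apply (linear_on_scal _ _ HB).
Qed.

Lemma linear_on_add U A B : open_2d U ->
  linear_on U A -> linear_on U B -> linear_on U (op_add A B).
Proof.
intros HU HA HB; unfold op_add; split.
- intros f Hf; apply smooth_on_plus; auto; [now apply HA|now apply HB].
- intros f g Hf E x y Hxy.
  rewrite (linear_on_ext _ _ HA f g Hf E x y Hxy).
  now rewrite (linear_on_ext _ _ HB f g Hf E x y Hxy).
- intros f g Hf Hg x y Hxy.
  rewrite (linear_on_plus _ _ HA f g Hf Hg x y Hxy).
  rewrite (linear_on_plus _ _ HB f g Hf Hg x y Hxy); ring.
- intros c f Hf x y Hxy.
  rewrite (linear_on_scal _ _ HA c f Hf x y Hxy).
  rewrite (linear_on_scal _ _ HB c f Hf x y Hxy); ring.
Qed.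

Lemma linear_on_op_scal U a A : open_2d U ->
  linear_on U A -> linear_on U (op_scal a A).
Proof.
intros HU HA; unfold op_scal; split.
- intros f Hf; apply smooth_on_scal; auto; now apply HA.
- intros f g Hf E x y Hxy.
  now rewrite (linear_on_ext _ _ HA f g Hf E x y Hxy).
- intros f g Hf Hg x y Hxy.
  rewrite (linear_on_plus _ _ HA f g Hf Hg x y Hxy); ring.
- intros c f Hf x y Hxy.
  rewrite (linear_on_scal _ _ HA c f Hf x y Hxy); ring.
Qed.

(** Two operators with the same values need not be convertible, so linearity is
    transported along pointwise equality. *)
Lemma linear_on_op_ext U A B : open_2d U -> (forall f x y, A f x y = B f x y) ->
  linear_on U A -> linear_on U B.
Proof.
intros HU E HA; split.
- intros f Hf; apply (smooth_on_ext U (A f)); auto; [intros x y _; apply E|].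
  now apply HA.
- intros f g Hf Efg x y Hxy; rewrite <- !E.
  now apply (linear_on_ext _ _ HA).
- intros f g Hf Hg x y Hxy; rewrite <- !E; now apply (linear_on_plus _ _ HA).
- intros c f Hf x y Hxy; rewrite <- !E; now apply (linear_on_scal _ _ HA).
Qed.

Lemma linear_on_pow U A n : open_2d U -> linear_on U A -> linear_on U (op_pow A n).
Proof.
intros HU HA; induction n as [|n IH]; [apply linear_on_id|].
now apply (linear_on_comp U A (op_pow A n)).
Qed.

Lemma linear_on_0 U D : open_2d U -> linear_on U D ->
  eq_on U (D (fun _ _ => 0)) (fun _ _ => 0).
Proof.
intros HU HD x y Hxy.
assert (H0 : smooth_on U (fun _ _ => 0)) by now apply smooth_on_const.
transitivity (D (fun _ _ => 0 * 0) x y).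
- apply linear_on_ext with U; auto; intros u v _; ring.
- rewrite (linear_on_scal _ _ HD 0 _ H0 x y Hxy); ring.
Qed.

Lemma linear_on_Csum U D n (F : nat -> R -> R -> C) : open_2d U ->
  linear_on U D -> (forall i, (i < n)%nat -> smooth_on U (F i)) ->
  eq_on U (D (fun x y => Csum n (fun i => F i x y)))
          (fun x y => Csum n (fun i => D (F i) x y)).
Proof.
intros HU HD; induction n as [|n IH]; intros HF.
- now apply linear_on_0.
- intros x y Hxy; simpl.
  rewrite <- IH by auto.
  apply (linear_on_plus U D HD (fun x y => Csum n (fun i => F i x y)) (F n)); auto.
  apply smooth_on_Csum; auto.
Qed.

(** Operators described by how they are built, which makes induction available.
    The operators D1 and D2, and the sums occurring in [const_coeff], all are of
    this form. *)
Inductive const_coeff_op : operator -> Prop :=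
| cc_id : const_coeff_op op_id
| cc_zero : const_coeff_op op_zero
| cc_dx : const_coeff_op dx
| cc_dy : const_coeff_op dy
| cc_comp A B : const_coeff_op A -> const_coeff_op B -> const_coeff_op (op_comp A B)
| cc_add A B : const_coeff_op A -> const_coeff_op B -> const_coeff_op (op_add A B)
| cc_scal c A : const_coeff_op A -> const_coeff_op (op_scal c A)
| cc_opp A : const_coeff_op A -> const_coeff_op (op_opp A)
| cc_sum A n : (forall k, const_coeff_op (A k)) -> const_coeff_op (op_sum A n).

Lemma cc_pow A n : const_coeff_op A -> const_coeff_op (op_pow A n).
Proof.
intros HA; induction n as [|n IH]; [apply cc_id|now apply (cc_comp A (op_pow A n))].
Qed.

Lemma dx_wirtinger f x y : dx f x y = dz f x y + dzb f x y.
Proof. unfold dz, dzb; field; exact C2_neq_0. Qed.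

Lemma dy_wirtinger f x y : dy f x y = Ci * dz f x y + - Ci * dzb f x y.
Proof.
unfold dz, dzb.
replace (Ci * ((dx f x y - Ci * dy f x y) / 2) +
  - Ci * ((dx f x y + Ci * dy f x y) / 2)) with (- (Ci * Ci) * dy f x y)
  by (field; exact C2_neq_0).
rewrite Ci_sqr; ring.
Qed.

Lemma op_sum_S A n f x y :
  op_sum A (S n) f x y = op_add (op_sum A n) (A (S n)) f x y.
Proof. unfold op_sum, op_add; now rewrite sum_Sn. Qed.

Lemma op_sum_O A f x y : op_sum A 0 f x y = A O f x y.
Proof. unfold op_sum; now rewrite sum_O. Qed.

Lemma cc_linear_on U D : open_2d U -> const_coeff_op D -> linear_on U D.
Proof.
intros HU HD; induction HD as [| | | |A B _ HA _ HB|A B _ HA _ HB|c A _ HA|A _ HA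
  |A n _ HA].
- apply linear_on_id.
- now apply linear_on_zero.
- apply (linear_on_op_ext U (op_add dz dzb)); auto.
  + intros; symmetry; apply dx_wirtinger.
  + apply linear_on_add; auto using linear_on_dz, linear_on_dzb.
- apply (linear_on_op_ext U (op_add (op_scal Ci dz) (op_scal (- Ci) dzb))); auto.
  + intros; symmetry; apply dy_wirtinger.
  + apply linear_on_add; auto using linear_on_dz, linear_on_dzb, linear_on_op_scal.
- now apply linear_on_comp.
- now apply linear_on_add.
- now apply linear_on_op_scal.
- apply (linear_on_op_ext U (op_scal (- (1)) A)); auto using linear_on_op_scal.
  intros; unfold op_scal, op_opp; ring.
- induction n as [|n IH].
  + apply (linear_on_op_ext U (A O)); auto.
    intros; symmetry; apply op_sum_O.
  + apply (linear_on_op_ext U (op_add (op_sum A n) (A (S n)))); auto.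
    * intros; symmetry; apply op_sum_S.
    * now apply linear_on_add.
Qed.

Definition commute_on (U : R -> R -> Prop) (A B : operator) : Prop :=
  forall f, smooth_on U f -> eq_on U (A (B f)) (B (A f)).

(** It is enough to commute with dx and dy, out of which D is built. *)
Lemma cc_commute_on U E D : open_2d U -> linear_on U E ->
  commute_on U E dx -> commute_on U E dy -> const_coeff_op D -> commute_on U E D.
Proof.
intros HU HE Ex Ey HD; induction HD as [| | | |A B HA IA HB IB|A B HA IA HB IB
  |c A HA IA|A HA IA|A n HA IA]; auto.
- now intros f _ x y _.
- intros f _; now apply (linear_on_0 U E).
- intros f Hf; unfold op_comp.
  apply (cc_linear_on U) in HA; apply (cc_linear_on U) in HB; auto.
  eapply eq_on_trans; [apply IA, HB, Hf|].
  apply (linear_on_ext _ _ HA); [apply HE, HB, Hf|now apply IB].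
- intros f Hf x y Hxy; unfold op_add.
  apply (cc_linear_on U) in HA; apply (cc_linear_on U) in HB; auto.
  rewrite <- (IA f Hf x y Hxy), <- (IB f Hf x y Hxy).
  apply (linear_on_plus _ _ HE (A f) (B f)); auto; [apply HA, Hf|apply HB, Hf].
- intros f Hf x y Hxy; unfold op_scal.
  apply (cc_linear_on U) in HA; auto.
  rewrite <- (IA f Hf x y Hxy).
  apply (linear_on_scal _ _ HE); auto; apply HA, Hf.
- intros f Hf x y Hxy; unfold op_opp.
  apply (cc_linear_on U) in HA; auto.
  rewrite <- (IA f Hf x y Hxy).
  transitivity (- (1) * E (A f) x y); [|ring].
  rewrite <- (linear_on_scal _ _ HE (- (1)) (A f)); auto; [|apply HA, Hf].
  apply (linear_on_ext_r U); auto; [apply smooth_on_scal; auto; apply HA, Hf|].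
  intros u v _; ring.
- intros f Hf x y Hxy.
  assert (HA' : forall k, linear_on U (A k)) by (intros; now apply cc_linear_on).
  unfold op_sum; rewrite sum_n_Csum.
  transitivity (Csum (S n) (fun k => E (A k f) x y)).
  + rewrite <- (linear_on_Csum U E (S n) (fun k => A k f)); auto.
    2: { intros; apply HA', Hf. }
    apply (linear_on_ext_r U); auto.
    * apply smooth_on_Csum; auto; intros; apply HA', Hf.
    * intros u v _; apply sum_n_Csum.
  + apply Csum_ext; intros k _; now apply IA.
Qed.

Lemma dx_commute_on U D : open_2d U -> const_coeff_op D -> commute_on U dx D.
Proof.
intros HU; apply cc_commute_on; auto.
- apply cc_linear_on; auto using cc_dx.
- now intros f _ x y _.
- intros f Hf; now apply dx_dy_comm.
Qed.

Lemma dy_commute_on U D : open_2d U -> const_coeff_op D -> commute_on U dy D.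
Proof.
intros HU; apply cc_commute_on; auto.
- apply cc_linear_on; auto using cc_dy.
- intros f Hf; now apply eq_on_sym, dx_dy_comm.
- now intros f _ x y _.
Qed.

Lemma dzb_dz_comm U : open_2d U -> commute_on U dzb dz.
Proof.
intros HU f Hf.
set (Z := op_add (op_scal (/ 2) dx) (op_scal (- Ci / 2) dy)).
assert (HZ : const_coeff_op Z).
{ apply cc_add; apply cc_scal; [apply cc_dx|apply cc_dy]. }
pose proof (cc_linear_on U Z HU HZ) as LZ.
assert (EZ : forall g x y, dz g x y = Z g x y).
{ intros; unfold Z, dz, op_add, op_scal; field; exact C2_neq_0. }
intros x y Hxy; rewrite EZ; unfold dzb at 1.
pose proof (smooth_on_dz U f HU Hf) as Hz.
assert (Ef : eq_on U (dz f) (Z f)) by (intros u v _; apply EZ).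
assert (Hx : dx (dz f) x y = Z (dx f) x y).
{ rewrite <- (dx_commute_on U Z HU HZ f Hf x y Hxy).
  now apply (linear_on_ext U dx (cc_linear_on U dx HU cc_dx)). }
assert (Hy : dy (dz f) x y = Z (dy f) x y).
{ rewrite <- (dy_commute_on U Z HU HZ f Hf x y Hxy).
  now apply (linear_on_ext U dy (cc_linear_on U dy HU cc_dy)). }
rewrite Hx, Hy.
pose proof (smooth_on_dx U f Hf) as Sx; pose proof (smooth_on_dy U f Hf) as Sy.
transitivity (/ 2 * Z (dx f) x y + Ci / 2 * Z (dy f) x y);
  [field; exact C2_neq_0|].
rewrite <- (linear_on_scal _ _ LZ (/ 2) (dx f) Sx x y Hxy).
rewrite <- (linear_on_scal _ _ LZ (Ci / 2) (dy f) Sy x y Hxy).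
rewrite <- (linear_on_plus _ _ LZ (fun x y => / 2 * dx f x y)
  (fun x y => Ci / 2 * dy f x y)); auto using smooth_on_scal.
apply (linear_on_ext U Z LZ); auto using smooth_on_plus, smooth_on_scal.
intros u v _; unfold dzb; field; exact C2_neq_0.
Qed.

(** * Expansion in Wirtinger derivatives *)

Definition Csum2 (N : nat) (F : nat -> nat -> C) : C :=
  Csum N (fun i => Csum N (F i)).

Lemma Csum2_ext N (F G : nat -> nat -> C) :
  (forall i j, (i < N)%nat -> (j < N)%nat -> F i j = G i j) -> Csum2 N F = Csum2 N G.
Proof. intros H; apply Csum_ext; intros; apply Csum_ext; auto. Qed.

Lemma Csum2_plus N F G :
  Csum2 N (fun i j => F i j + G i j) = Csum2 N F + Csum2 N G.
Proof.
unfold Csum2; rewrite <- Csum_plus; apply Csum_ext; intros; apply Csum_plus.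
Qed.

Lemma Csum2_scal N c F : Csum2 N (fun i j => c * F i j) = c * Csum2 N F.
Proof.
unfold Csum2; rewrite <- Csum_scal; apply Csum_ext; intros; apply Csum_scal.
Qed.

Lemma Csum2_0 N (F : nat -> nat -> C) :
  (forall i j, (i < N)%nat -> (j < N)%nat -> F i j = 0) -> Csum2 N F = 0.
Proof. intros H; apply Csum_0; intros; apply Csum_0; auto. Qed.

Lemma Csum2_swap N (F : nat -> nat -> nat -> nat -> C) :
  Csum2 N (fun i j => Csum2 N (F i j)) =
  Csum2 N (fun k l => Csum2 N (fun i j => F i j k l)).
Proof.
unfold Csum2.
transitivity (Csum N (fun i => Csum N (fun k => Csum N (fun j => Csum N (F i j k))))).
{ apply Csum_ext; intros; apply Csum_swap. }
rewrite Csum_swap; apply Csum_ext; intros k _.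
transitivity (Csum N (fun i => Csum N (fun l => Csum N (fun j => F i j k l)))).
{ apply Csum_ext; intros; apply Csum_swap. }
apply Csum_swap.
Qed.

Lemma Csum2_transpose N F : Csum2 N F = Csum2 N (fun i j => F j i).
Proof. apply Csum_swap. Qed.

Lemma Csum2_extend N M (F : nat -> nat -> C) : (N <= M)%nat ->
  (forall i j, (N <= i)%nat \/ (N <= j)%nat -> F i j = 0) -> Csum2 M F = Csum2 N F.
Proof.
intros H HF; unfold Csum2.
rewrite (Csum_extend N M) by (auto; intros; apply Csum_0; intros; apply HF; auto).
apply Csum_ext; intros i _; apply Csum_extend; auto.
Qed.

Lemma Csum2_single N k l (F : nat -> nat -> C) : (k < N)%nat -> (l < N)%nat ->
  (forall i j, (i, j) <> (k, l) -> F i j = 0) -> Csum2 N F = F k l.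
Proof.
intros Hk Hl HF; unfold Csum2.
rewrite (Csum_single N k) by
 (auto; intros i Hi; apply Csum_0; intros; apply HF; intros E; now injection E).
apply Csum_single; auto; intros j Hj; apply HF; intros E; now injection E.
Qed.

Definition dzz (i j : nat) : operator := op_comp (op_pow dz i) (op_pow dzb j).

(** That p vanishes outside the square makes it possible to enlarge N and to
    shift indices without boundary terms. *)
Definition expands (D : operator) (N : nat) (p : nat -> nat -> C) : Prop :=
  (forall i j, (N <= i)%nat \/ (N <= j)%nat -> p i j = 0) /\
  forall U f, open_2d U -> smooth_on U f ->
    eq_on U (D f) (fun x y => Csum2 N (fun i j => p i j * dzz i j f x y)).

Definition expandable (D : operator) : Prop := exists N p, expands D N p.

Lemma linear_on_dzz U i j : open_2d U -> linear_on U (dzz i j).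
Proof.
intros HU; apply linear_on_comp; auto;
apply linear_on_pow; auto using linear_on_dz, linear_on_dzb.
Qed.

Lemma smooth_on_dzz U i j f : open_2d U -> smooth_on U f -> smooth_on U (dzz i j f).
Proof. intros HU; now apply linear_on_dzz. Qed.

Lemma dzz_S_r U i j f : open_2d U -> smooth_on U f ->
  eq_on U (dzb (dzz i j f)) (dzz i (S j) f).
Proof.
intros HU Hf; induction i as [|i IH]; [now intros x y _|].
change (dzz (S i) j f) with (dz (dzz i j f)).
change (dzz (S i) (S j) f) with (dz (dzz i (S j) f)).
eapply eq_on_trans; [apply dzb_dz_comm; auto using smooth_on_dzz|].
apply linear_on_ext_r; auto using linear_on_dz, smooth_on_dzz.
Qed.

Lemma expands_weaken D N M p : (N <= M)%nat -> expands D N p -> expands D M p.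
Proof.
intros H [Hp HD]; split; [intros i j Hij; apply Hp; lia|].
intros U f HU Hf x y Hxy; rewrite (HD U f HU Hf x y Hxy); symmetry.
apply Csum2_extend; auto; intros i j Hij; rewrite Hp by auto; ring.
Qed.

Lemma expandable_ext D E : (forall U f, open_2d U -> smooth_on U f ->
  eq_on U (D f) (E f)) -> expandable D -> expandable E.
Proof.
intros H (N & p & Hp & HD); exists N, p; split; auto.
intros U f HU Hf; eapply eq_on_trans; [apply eq_on_sym, H|apply HD]; auto.
Qed.

Lemma expandable_zero : expandable op_zero.
Proof.
exists O, (fun _ _ => 0); split; [reflexivity|].
now intros U f _ _ x y _.
Qed.

Lemma expandable_id : expandable op_id.
Proof.
exists 1%nat, (fun i j => match i, j with O, O => 1 | _, _ => 0 end); split.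
- intros [|i] [|j] H; auto; lia.
- intros U f HU Hf x y Hxy; unfold Csum2; simpl.
  unfold dzz, op_pow, op_comp, op_id; simpl; unfold op_id; ring.
Qed.

Lemma expandable_scal c D : expandable D -> expandable (op_scal c D).
Proof.
intros (N & p & Hp & HD); exists N, (fun i j => c * p i j); split.
- intros; rewrite Hp by auto; ring.
- intros U f HU Hf x y Hxy; unfold op_scal; rewrite (HD U f HU Hf x y Hxy).
  rewrite <- Csum2_scal; apply Csum2_ext; intros; ring.
Qed.

Lemma expandable_add D E : expandable D -> expandable E -> expandable (op_add D E).
Proof.
intros (N & p & HD) (M & q & HE).
apply (expands_weaken D N (max N M)) in HD; [|lia].
apply (expands_weaken E M (max N M)) in HE; [|lia].
destruct HD as [Hp HD], HE as [Hq HE].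
exists (max N M), (fun i j => p i j + q i j); split.
- intros; rewrite Hp, Hq by auto; ring.
- intros U f HU Hf x y Hxy; unfold op_add.
  rewrite (HD U f HU Hf x y Hxy), (HE U f HU Hf x y Hxy).
  rewrite <- Csum2_plus; apply Csum2_ext; intros; ring.
Qed.

Lemma linear_on_Csum2 U D N (p : nat -> nat -> C) (F : nat -> nat -> R -> R -> C) :
  open_2d U -> linear_on U D -> (forall i j, smooth_on U (F i j)) ->
  eq_on U (D (fun x y => Csum2 N (fun i j => p i j * F i j x y)))
    (fun x y => Csum2 N (fun i j => p i j * D (F i j) x y)).
Proof.
intros HU HD HF.
assert (HS : forall i, smooth_on U (fun x y => Csum N (fun j => p i j * F i j x y))).
{ intros i; apply (smooth_on_Csum U N (fun j x y => p i j * F i j x y)); auto.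
  intros; apply smooth_on_scal; auto. }
intros x y Hxy; unfold Csum2.
rewrite (linear_on_Csum U D N
  (fun i x y => Csum N (fun j => p i j * F i j x y)) HU HD) by auto.
apply Csum_ext; intros i _.
rewrite (linear_on_Csum U D N (fun j x y => p i j * F i j x y) HU HD)
  by (auto; intros; apply smooth_on_scal; auto).
apply Csum_ext; intros j _.
now apply (linear_on_scal _ _ HD).
Qed.

Lemma smooth_on_Csum2 U N (p : nat -> nat -> C) (F : nat -> nat -> R -> R -> C) :
  open_2d U -> (forall i j, smooth_on U (F i j)) ->
  smooth_on U (fun x y => Csum2 N (fun i j => p i j * F i j x y)).
Proof.
intros HU HF; unfold Csum2.
apply (smooth_on_Csum U N (fun i x y => Csum N (fun j => p i j * F i j x y))); auto.
intros i _; apply (smooth_on_Csum U N (fun j x y => p i j * F i j x y)); auto.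
intros; apply smooth_on_scal; auto.
Qed.

Lemma expandable_dz D : expandable D -> expandable (op_comp dz D).
Proof.
intros (N & p & Hp & HD).
exists (S N), (fun i j => match i with O => RtoC 0 | S i' => p i' j end); split.
- intros [|i] j H; auto; apply Hp; lia.
- intros U f HU Hf x y Hxy; unfold op_comp.
  assert (HS : forall i j, smooth_on U (dzz i j f)) by auto using smooth_on_dzz.
  rewrite (linear_on_ext_r U dz _ _ (linear_on_dz U HU)
             (smooth_on_Csum2 U N p (fun i j => dzz i j f) HU HS) (HD U f HU Hf)) by auto.
  rewrite (linear_on_Csum2 U dz N p (fun i j => dzz i j f) HU (linear_on_dz U HU)) by auto.
  unfold Csum2; rewrite Csum_first.
  rewrite (Csum_0 (S N)) by (intros; ring); rewrite Cplus_0_l.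
  apply Csum_ext; intros i _; rewrite (Csum_extend N (S N)); auto.
  intros j Hj; rewrite Hp by auto; ring.
Qed.

Lemma expandable_dzb D : expandable D -> expandable (op_comp dzb D).
Proof.
intros (N & p & Hp & HD).
exists (S N), (fun i j => match j with O => RtoC 0 | S j' => p i j' end); split.
- intros i [|j] H; auto; apply Hp; lia.
- intros U f HU Hf x y Hxy; unfold op_comp.
  assert (HS : forall i j, smooth_on U (dzz i j f)) by auto using smooth_on_dzz.
  rewrite (linear_on_ext_r U dzb _ _ (linear_on_dzb U HU)
             (smooth_on_Csum2 U N p (fun i j => dzz i j f) HU HS) (HD U f HU Hf)) by auto.
  rewrite (linear_on_Csum2 U dzb N p (fun i j => dzz i j f) HU (linear_on_dzb U HU)) by auto.
  rewrite (Csum2_transpose (S N)).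
  unfold Csum2 at 2; rewrite Csum_first.
  rewrite (Csum_0 (S N)) by (intros; ring); rewrite Cplus_0_l.
  rewrite Csum2_transpose; unfold Csum2.
  apply Csum_ext; intros j _; rewrite (Csum_extend N (S N)); auto.
  + apply Csum_ext; intros i _; f_equal; now apply (dzz_S_r U).
  + intros i Hi; rewrite Hp by auto; ring.
Qed.

(** Composing with dz or dzb on the left shifts the coefficients, and dx, dy are
    combinations of dz and dzb. *)
Lemma cc_expandable D : const_coeff_op D -> expandable D.
Proof.
intros HD; (* Strengthened to compositions D o E with E expandable, for the sake of the
   composition case. *)
change D with (op_comp D op_id).
generalize expandable_id; generalize op_id.
induction HD as [| | | |A B HA IA HB IB|A B HA IA HB IB|c A HA IA|A HA IA
  |A n HA IA]; intros E HE.
- exact HE.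
- exact expandable_zero.
- apply (expandable_ext (op_add (op_comp dz E) (op_comp dzb E))).
  + intros U f _ _ x y _; unfold op_add, op_comp; now rewrite dx_wirtinger.
  + apply expandable_add; auto using expandable_dz, expandable_dzb.
- apply (expandable_ext
    (op_add (op_scal Ci (op_comp dz E)) (op_scal (- Ci) (op_comp dzb E)))).
  + intros U f _ _ x y _; unfold op_add, op_scal, op_comp; now rewrite dy_wirtinger.
  + apply expandable_add; auto using expandable_scal, expandable_dz, expandable_dzb.
- exact (IA (op_comp B E) (IB E HE)).
- exact (expandable_add _ _ (IA E HE) (IB E HE)).
- exact (expandable_scal c _ (IA E HE)).
- apply (expandable_ext (op_scal (- (1)) (op_comp A E))).
  + intros U f _ _ x y _; unfold op_scal, op_comp, op_opp; ring.
  + apply expandable_scal; auto.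
- induction n as [|n IH].
  + apply (expandable_ext (op_comp (A O) E)); auto.
    intros U f _ _ x y _; symmetry; apply op_sum_O.
  + apply (expandable_ext (op_add (op_comp (op_sum A n) E) (op_comp (A (S n)) E))).
    * intros U f _ _ x y _; symmetry; apply op_sum_S.
    * apply expandable_add; auto.
Qed.

(** The falling factorial k (k - 1) ... (k - i + 1). *)
Fixpoint falling (k i : nat) {struct i} : C :=
  match i, k with
  | O, _ => 1
  | S _, O => 0
  | S i', S k' => INR (S k') * falling k' i'
  end.

Lemma falling_lt k i : (k < i)%nat -> falling k i = 0.
Proof.
revert k; induction i as [|i IH]; intros [|k] H; try lia; [reflexivity|].
cbn [falling]; rewrite IH by lia; ring.
Qed.

Lemma falling_fact k : falling k k = INR (fact k).
Proof.
induction k as [|k IH]; [reflexivity|].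
cbn [falling]; rewrite IH, fact_simpl, mult_INR; apply eq_sym, RtoC_mult.
Qed.

Lemma op_pow_S_r A n f : op_pow A (S n) f = op_pow A n (A f).
Proof.
induction n as [|n IH]; [reflexivity|].
change (A (op_pow A (S n) f) = A (op_pow A n (A f))); now rewrite IH.
Qed.

(** The functions e form an Appell sequence for A: on them A acts as d/dt acts on
    the powers t^k. *)
Lemma appell_pow U A (e : nat -> R -> R -> C) i k : open_2d U -> linear_on U A ->
  (forall k, smooth_on U (e k)) ->
  eq_on U (A (e O)) (fun _ _ => 0) ->
  (forall k, eq_on U (A (e (S k))) (fun x y => INR (S k) * e k x y)) ->
  eq_on U (op_pow A i (e k)) (fun x y => falling k i * e (k - i)%nat x y).
Proof.
intros HU HA He H0 HS; revert k; induction i as [|i IH]; intros k x y Hxy.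
- rewrite Nat.sub_0_r; simpl; unfold op_id; ring.
- rewrite op_pow_S_r.
  pose proof (linear_on_pow U A i HU HA) as HAi.
  destruct k as [|k].
  + rewrite (linear_on_ext_r U _ _ _ HAi (smooth_on_const U 0 HU) H0 x y Hxy).
    rewrite (linear_on_0 U _ HU HAi x y Hxy); simpl; ring.
  + rewrite (linear_on_ext_r U _ _ _ HAi (smooth_on_scal U _ _ HU (He k)) (HS k) x y Hxy).
    rewrite (linear_on_scal _ _ HAi _ _ (He k) x y Hxy), (IH k x y Hxy).
    cbn [falling]; replace (S k - S i)%nat with (k - i)%nat by lia; ring.
Qed.

(** * Derivatives of inverted functions *)

Lemma INR_0 : RtoC (INR 0) = 0.
Proof. reflexivity. Qed.

Lemma INR_S n : RtoC (INR (S n)) = INR n + 1.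
Proof. rewrite S_INR; apply RtoC_plus. Qed.

Lemma is_wirtinger_pow f x y a b n : is_wirtinger f x y a b ->
  is_wirtinger (fun u v => f u v ^ n) x y
    (INR n * f x y ^ (n - 1) * a) (INR n * f x y ^ (n - 1) * b).
Proof.
intros H; induction n as [|n IH].
- rewrite INR_0; rewrite !Cmult_0_l; exact (is_wirtinger_const 1 x y).
- pose proof (is_wirtinger_mult _ _ _ _ _ _ _ _ H IH) as K; cbv beta in K.
  apply (is_wirtinger_ext_loc _ (fun u v => f u v ^ S n)) in K.
  2: { apply locally_2d_forall; intros; reflexivity. }
  rewrite INR_S; replace (S n - 1)%nat with n by lia.
  assert (E : INR n * f x y ^ n = INR n * (f x y * f x y ^ (n - 1))).
  { destruct n as [|n]; [rewrite INR_0; ring|].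
    replace (S n - 1)%nat with n by lia; now rewrite Cpow_S. }
  replace ((INR n + 1) * f x y ^ n * a)
    with (a * f x y ^ n + INR n * f x y ^ n * a) by ring.
  replace ((INR n + 1) * f x y ^ n * b)
    with (b * f x y ^ n + INR n * f x y ^ n * b) by ring.
  rewrite E.
  replace (INR n * (f x y * f x y ^ (n - 1)) * a)
    with (f x y * (INR n * f x y ^ (n - 1) * a)) by ring.
  replace (INR n * (f x y * f x y ^ (n - 1)) * b)
    with (f x y * (INR n * f x y ^ (n - 1) * b)) by ring.
  exact K.
Qed.

Lemma elementary_pow U f n : elementary U f -> elementary U (fun x y => f x y ^ n).
Proof.
intros H; induction n as [|n IH]; [exact (elementary_const U 1)|].
now apply (elementary_mult U f (fun x y => f x y ^ n)).
Qed.

Lemma smooth_on_plane u : smooth_on plane u <-> smooth u.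
Proof.
split; intros H x y; [exact (H x y I)|intros _; exact (H x y)].
Qed.

(** The monomial (z - t)^k (zb - t)^l, with t real. *)
Definition zmon (t : R) (k l : nat) (x y : R) : C :=
  ((x, y) - t) ^ k * ((x, (- y)%R) - t) ^ l.

Lemma smooth_on_zmon U t k l : open_2d U -> smooth_on U (zmon t k l).
Proof.
intros HU; apply elementary_smooth_on; auto; unfold zmon.
apply (elementary_mult U (fun x y => ((x, y) - t) ^ k)
  (fun x y => ((x, (- y)%R) - t) ^ l)).
- apply (elementary_pow U (fun x y => (x, y) - t)).
  apply (elementary_plus U (fun x y => (x, y)) (fun _ _ => - t));
  auto using elementary_z, elementary_const.
- apply (elementary_pow U (fun x y => (x, (- y)%R) - t)).
  apply (elementary_plus U (fun x y => (x, (- y)%R)) (fun _ _ => - t));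
  auto using elementary_zb, elementary_const.
Qed.

Lemma is_wirtinger_zmon t k l x y :
  is_wirtinger (zmon t k l) x y
    (INR k * zmon t (k - 1) l x y) (INR l * zmon t k (l - 1) x y).
Proof.
assert (H1 : is_wirtinger (fun u v => (u, v) - t) x y 1 0).
{ pose proof (is_wirtinger_plus _ _ _ _ _ _ _ _ (is_wirtinger_z x y)
    (is_wirtinger_const (- t) x y)) as H; rewrite !Cplus_0_r in H; exact H. }
assert (H2 : is_wirtinger (fun u v => (u, (- v)%R) - t) x y 0 1).
{ pose proof (is_wirtinger_plus _ _ _ _ _ _ _ _ (is_wirtinger_zb x y)
    (is_wirtinger_const (- t) x y)) as H; rewrite !Cplus_0_r in H; exact H. }
pose proof (is_wirtinger_mult _ _ _ _ _ _ _ _ (is_wirtinger_pow _ _ _ _ _ k H1)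
  (is_wirtinger_pow _ _ _ _ _ l H2)) as H; cbv beta in H.
unfold zmon.
refine (eq_rect _ (fun c => is_wirtinger _ x y c _) _ _ _).
- refine (eq_rect _ (is_wirtinger _ x y _) H _ _); ring.
- ring.
Qed.

Lemma dzz_zmon t k l i j x y :
  dzz i j (zmon t k l) x y =
  falling k i * falling l j * zmon t (k - i) (l - j) x y.
Proof.
pose proof open_plane as HP.
assert (Hb : eq_on plane (op_pow dzb j (zmon t k l))
               (fun x y => falling l j * zmon t k (l - j) x y)).
{ apply (appell_pow plane dzb (zmon t k)); auto using linear_on_dzb, smooth_on_zmon.
  - intros u v _; destruct (is_wirtinger_unique _ _ _ _ _ (is_wirtinger_zmon t k 0 u v))
      as [_ ->]; rewrite INR_0; ring.
  - intros l' u v _; destruct (is_wirtinger_unique _ _ _ _ _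
      (is_wirtinger_zmon t k (S l') u v)) as [_ ->].
    now replace (S l' - 1)%nat with l' by lia. }
assert (Ha : eq_on plane (op_pow dz i (zmon t k (l - j)))
               (fun x y => falling k i * zmon t (k - i) (l - j) x y)).
{ apply (appell_pow plane dz (fun k => zmon t k (l - j)));
    auto using linear_on_dz, smooth_on_zmon.
  - intros u v _; destruct (is_wirtinger_unique _ _ _ _ _
      (is_wirtinger_zmon t 0 (l - j) u v)) as [-> _]; rewrite INR_0; ring.
  - intros k' u v _; destruct (is_wirtinger_unique _ _ _ _ _
      (is_wirtinger_zmon t (S k') (l - j) u v)) as [-> _].
    now replace (S k' - 1)%nat with k' by lia. }
pose proof (linear_on_pow plane dz i HP (linear_on_dz plane HP)) as HL.
unfold dzz, op_comp.
rewrite (linear_on_ext_r plane _ _ _ HL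
  (smooth_on_scal plane _ _ HP (smooth_on_zmon plane t k (l - j) HP)) Hb x y I).
rewrite (linear_on_scal _ _ HL _ _ (smooth_on_zmon plane t k (l - j) HP) x y I).
rewrite (Ha x y I); ring.
Qed.

Lemma zmon_center t k l : (k, l) <> (O, O) -> zmon t k l t 0 = 0.
Proof.
intros H; unfold zmon.
replace ((t, 0%R) - t) with (RtoC 0)
  by (unfold Cminus, Cplus, Copp, RtoC; simpl; f_equal; ring).
replace ((t, (- 0)%R) - t) with (RtoC 0)
  by (unfold Cminus, Cplus, Copp, RtoC; simpl; f_equal; ring).
destruct k; [destruct l; [now elim H|]|]; rewrite Cpow_S; ring.
Qed.

(** Up to factorials these monomials are dual to the operators dz^i dzb^j at the
    point t, which is how coefficients are read off. *)
Lemma dzz_zmon_center t k l i j :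
  dzz i j (zmon t k l) t 0 =
  if (Nat.eqb i k && Nat.eqb j l)%bool then INR (fact k) * INR (fact l) else 0.
Proof.
rewrite dzz_zmon.
destruct (Nat.eqb_spec i k) as [->|Hi]; [destruct (Nat.eqb_spec j l) as [->|Hj]|];
simpl.
- rewrite !Nat.sub_diag, !falling_fact; unfold zmon; simpl; ring.
- destruct (Nat.lt_ge_cases l j) as [H|H].
  + rewrite (falling_lt l j) by auto; ring.
  + rewrite zmon_center; [ring|]. intros E; injection E; lia.
- destruct (Nat.lt_ge_cases k i) as [H|H].
  + rewrite (falling_lt k i) by auto; ring.
  + rewrite zmon_center; [ring|]. intros E; injection E; lia.
Qed.

Lemma INR_fact_C_neq_0 n : RtoC (INR (fact n)) <> 0.
Proof. intros H; apply RtoC_inj in H; revert H; apply not_0_INR, fact_neq_0. Qed.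

Lemma Csum2_dzz_zmon N (A : nat -> nat -> C) t k l :
  (k < N)%nat -> (l < N)%nat ->
  Csum2 N (fun i j => A i j * dzz i j (zmon t k l) t 0) =
  A k l * (INR (fact k) * INR (fact l)).
Proof.
intros Hk Hl; rewrite (Csum2_single N k l); auto.
- now rewrite dzz_zmon_center, !Nat.eqb_refl.
- intros i j Hij; rewrite dzz_zmon_center.
  destruct (Nat.eqb_spec i k) as [->|]; [destruct (Nat.eqb_spec j l) as [->|]|];
  simpl; try ring; now elim Hij.
Qed.

Lemma expands_zmon D N p t k l : expands D N p ->
  D (zmon t k l) t 0 = p k l * (INR (fact k) * INR (fact l)).
Proof.
intros [Hp HD].
rewrite (HD plane _ open_plane (smooth_on_zmon plane t k l open_plane) t 0 I).
destruct (Nat.lt_ge_cases k N) as [Hk|Hk].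
- destruct (Nat.lt_ge_cases l N) as [Hl|Hl].
  + now apply Csum2_dzz_zmon.
  + rewrite Hp by auto; rewrite Csum2_0; [ring|]; intros i j _ Hj.
    rewrite dzz_zmon_center; destruct (Nat.eqb_spec j l) as [->|]; [lia|].
    rewrite Bool.andb_false_r; ring.
- rewrite Hp by auto; rewrite Csum2_0; [ring|]; intros i j Hi _.
  rewrite dzz_zmon_center; destruct (Nat.eqb_spec i k) as [->|]; [lia|].
  simpl; ring.
Qed.

(** The coefficients c(i,k) in
      (d/dz)^i (z^al u(-1/z)) = sum_k c(i,k) z^(al - i - k) u^(k)(-1/z);
    differentiating the right-hand side once more gives the recursion.  In closed
    form c(i,k) = binom(i,k) (al - k) (al - k - 1) ... (al - i + 1). *)
Fixpoint inv_coeff (al : C) (i k : nat) : C :=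
  match i with
  | O => match k with O => 1 | S _ => 0 end
  | S i' => (al - INR i' - INR k) * inv_coeff al i' k +
            match k with O => RtoC 0 | S k' => inv_coeff al i' k' end
  end.

Lemma inv_coeff_gt al i k : (i < k)%nat -> inv_coeff al i k = 0.
Proof.
revert k; induction i as [|i IH]; intros [|k] H; try lia; [reflexivity|].
cbn [inv_coeff]; rewrite !IH by lia; ring.
Qed.

Lemma inv_coeff_diag al i : inv_coeff al i i = 1.
Proof.
induction i as [|i IH]; [reflexivity|].
cbn [inv_coeff]; rewrite IH, inv_coeff_gt by lia; ring.
Qed.

(** Clear from the closed form; here it is obtained from the recursion, by
    induction on i. *)
Lemma inv_coeff_ratio al i k :
  (INR i - INR k) * inv_coeff al i k =
  (INR k + 1) * (al - INR k) * inv_coeff al i (S k).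
Proof.
revert k; induction i as [|i IH]; intros k.
- destruct k as [|k]; cbn [inv_coeff]; rewrite INR_0; ring.
- transitivity ((INR i + 1) * (al - INR i) * inv_coeff al i k).
  + destruct k as [|k]; cbn [inv_coeff]; rewrite ?INR_S.
    * rewrite INR_0; ring.
    * transitivity ((INR i - INR k) * (al - INR i - (INR k + 1)) *
        inv_coeff al i (S k) + (INR i - INR k) * inv_coeff al i k); [ring|].
      rewrite IH; ring.
  + cbn [inv_coeff]; rewrite ?INR_S.
    transitivity ((al - INR i - (INR k + 1)) *
      ((INR k + 1) * (al - INR k) * inv_coeff al i (S k)) +
      (INR k + 1) * (al - INR k) * inv_coeff al i k); [|ring].
    rewrite <- IH; ring.
Qed.

(** Together with c(i,i) = 1 this says that the matrix c is the exponential of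
    the operator al d_Z - Z d_Z^2, which sends Z^i to i (al - i + 1) Z^(i-1). *)
Lemma inv_coeff_lower al i k :
  (INR (S i) - INR k) * inv_coeff al (S i) k =
  INR (S i) * (al - INR i) * inv_coeff al i k.
Proof.
rewrite inv_coeff_ratio; cbn [inv_coeff]; rewrite ?INR_S.
transitivity ((al - INR i - (INR k + 1)) *
  ((INR k + 1) * (al - INR k) * inv_coeff al i (S k)) +
  (INR k + 1) * (al - INR k) * inv_coeff al i k); [ring|].
rewrite <- inv_coeff_ratio; ring.
Qed.

(** M is differentiated like z^al zb^be, a function which need not exist on the
    whole punctured plane. *)
Definition has_weights (al be : C) (M : R -> R -> C) : Prop :=
  smooth_on punctured M /\
  forall x y, punctured x y ->
    is_wirtinger M x y (al * (zinv x y * M x y)) (be * (zbinv x y * M x y)).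

Lemma weights_zbinv_pow al be M m : has_weights al be M ->
  has_weights al (be - INR m) (fun x y => M x y * zbinv x y ^ m).
Proof.
intros [HS HM]; split.
- apply elementary_smooth_on; [exact open_punctured|].
  apply (elementary_mult punctured M (fun x y => zbinv x y ^ m));
  [now apply elementary_smooth|].
  apply elementary_pow, elementary_zbinv; auto.
- intros x y Hxy.
  pose proof (is_wirtinger_mult _ _ _ _ _ _ _ _ (HM x y Hxy)
    (is_wirtinger_pow _ _ _ _ _ m (is_wirtinger_zbinv x y Hxy))) as H; cbv beta in H.
  refine (eq_rect _ (fun c => is_wirtinger _ x y c _) _ _ _).
  + refine (eq_rect _ (is_wirtinger _ x y _) H _ _).
    destruct m as [|m]; [rewrite INR_0; simpl; ring|].
    replace (S m - 1)%nat with m by lia; rewrite Cpow_S; ring.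
  + ring.
Qed.

Lemma smooth_on_weight_pull al be M W n v : has_weights al be M ->
  elementary punctured W -> smooth v ->
  smooth_on punctured (fun x y => M x y * W x y ^ n * pull v x y).
Proof.
intros [HS _] HW Hv; apply elementary_smooth_on; [exact open_punctured|].
apply (elementary_mult punctured (fun x y => M x y * W x y ^ n) (pull v)).
- apply (elementary_mult punctured M (fun x y => W x y ^ n));
  [now apply elementary_smooth|now apply elementary_pow].
- apply elementary_pull; auto.
Qed.

Lemma dz_weight_pull al be M n v x y : has_weights al be M -> smooth v ->
  punctured x y ->
  dz (fun x y => M x y * zinv x y ^ n * pull v x y) x y =
  (al - INR n) * (M x y * zinv x y ^ S n * pull v x y) +
  M x y * zinv x y ^ S (S n) * pull (dz v) x y.
Proof.
intros [_ HM] Hv Hxy.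
pose proof (is_wirtinger_mult _ _ _ _ _ _ _ _
  (is_wirtinger_mult _ _ _ _ _ _ _ _ (HM x y Hxy)
    (is_wirtinger_pow _ _ _ _ _ n (is_wirtinger_zinv x y Hxy)))
  (is_wirtinger_pull v x y Hv Hxy)) as H; cbv beta in H.
destruct (is_wirtinger_unique _ _ _ _ _ H) as [-> _].
destruct n as [|n]; [simpl; ring|].
replace (S n - 1)%nat with n by lia; rewrite !Cpow_S, INR_S; ring.
Qed.

Lemma dzb_weight_pull al be M n v x y : has_weights al be M -> smooth v ->
  punctured x y ->
  dzb (fun x y => M x y * zbinv x y ^ n * pull v x y) x y =
  (be - INR n) * (M x y * zbinv x y ^ S n * pull v x y) +
  M x y * zbinv x y ^ S (S n) * pull (dzb v) x y.
Proof.
intros [_ HM] Hv Hxy.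
pose proof (is_wirtinger_mult _ _ _ _ _ _ _ _
  (is_wirtinger_mult _ _ _ _ _ _ _ _ (HM x y Hxy)
    (is_wirtinger_pow _ _ _ _ _ n (is_wirtinger_zbinv x y Hxy)))
  (is_wirtinger_pull v x y Hv Hxy)) as H; cbv beta in H.
destruct (is_wirtinger_unique _ _ _ _ _ H) as [_ ->].
destruct n as [|n]; [simpl; ring|].
replace (S n - 1)%nat with n by lia; rewrite !Cpow_S, INR_S; ring.
Qed.

(** Written for an abstract derivation A and function W so as to cover both
    dz with 1/z and dzb with 1/zb. *)
Lemma pow_pull (A : operator) (K W : R -> R -> C) (al : C) N :
  linear_on punctured A -> (forall v, smooth v -> smooth (A v)) ->
  (forall n v, smooth v ->
     smooth_on punctured (fun x y => K x y * W x y ^ n * pull v x y)) ->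
  (forall n v x y, smooth v -> punctured x y ->
     A (fun x y => K x y * W x y ^ n * pull v x y) x y =
     (al - INR n) * (K x y * W x y ^ S n * pull v x y) +
     K x y * W x y ^ S (S n) * pull (A v) x y) ->
  forall i u, (i < N)%nat -> smooth u ->
  eq_on punctured (op_pow A i (fun x y => K x y * pull u x y))
    (fun x y => Csum N (fun k =>
       inv_coeff al i k * (K x y * W x y ^ (i + k) * pull (op_pow A k u) x y))).
Proof.
intros HA HAs HKs HK i u Hi Hu.
assert (Hpow : forall k, smooth (op_pow A k u)).
{ induction k as [|k IH]; [exact Hu|now apply HAs]. }
pose proof open_punctured as HP.
induction i as [|i IH]; intros x y Hxy.
- rewrite (Csum_single N O); [|lia|intros [|k] H; [now elim H|cbn [inv_coeff]; ring]].
  simpl; unfold op_id; ring.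
- change (op_pow A (S i) ?f) with (A (op_pow A i f)).
  set (X := fun k x y => K x y * W x y ^ (i + k) * pull (op_pow A k u) x y).
  assert (HX : forall k, smooth_on punctured (X k)) by (intros; apply HKs; auto).
  assert (HcX : forall k, (k < N)%nat ->
            smooth_on punctured (fun x y => inv_coeff al i k * X k x y)).
  { intros; apply smooth_on_scal; auto. }
  rewrite (linear_on_ext_r punctured A _
    (fun x y => Csum N (fun k => inv_coeff al i k * X k x y)) HA
    (smooth_on_Csum punctured N (fun k x y => inv_coeff al i k * X k x y) HP HcX)
    (IH ltac:(lia)) x y Hxy).
  rewrite (linear_on_Csum punctured A N (fun k x y => inv_coeff al i k * X k x y)
    HP HA HcX x y Hxy).
  set (Y := fun k => K x y * W x y ^ (S i + k) * pull (op_pow A k u) x y).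
  transitivity (Csum N (fun k => (al - INR i - INR k) * inv_coeff al i k * Y k) +
                Csum N (fun k => inv_coeff al i k * Y (S k))).
  { rewrite <- Csum_plus; apply Csum_ext; intros k _.
    rewrite (linear_on_scal _ _ HA _ _ (HX k) x y Hxy); unfold X.
    rewrite HK by auto; unfold Y.
    replace (S i + k)%nat with (S (i + k)) by lia.
    replace (S i + S k)%nat with (S (S (i + k))) by lia.
    rewrite plus_INR, RtoC_plus.
    change (op_pow A (S k) u) with (A (op_pow A k u)); ring. }
  destruct N as [|N]; [lia|].
  assert (E : Csum (S N) (fun k => inv_coeff al i k * Y (S k)) =
    Csum (S N) (fun k => match k with
                         | O => RtoC 0 | S k' => inv_coeff al i k' * Y (S k') end)).
  { rewrite (Csum_first N (fun k => match k with O => _ | S _ => _ end)).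
    cbn [Csum]; rewrite (inv_coeff_gt al i N) by lia; ring. }
  rewrite E, <- Csum_plus; apply Csum_ext; intros k _.
  cbn [inv_coeff]; unfold Y; destruct k as [|k]; ring.
Qed.

(** As dzb does not see 1/z and dz does not see 1/zb, the formula is the product
    of the two one-variable formulas.  The sums may run up to N because
    [inv_coeff] vanishes for k > i. *)
Lemma dzz_weight_pull al be M u N i j : has_weights al be M -> smooth u ->
  (i < N)%nat -> (j < N)%nat ->
  eq_on punctured (dzz i j (fun x y => M x y * pull u x y))
    (fun x y => Csum2 N (fun k l => inv_coeff al i k * inv_coeff be j l *
       (M x y * zinv x y ^ (i + k) * zbinv x y ^ (j + l) * pull (dzz k l u) x y))).
Proof.
intros HM Hu Hi Hj x y Hxy.
pose proof open_punctured as HP.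
assert (Sz : forall v, smooth v -> smooth (dz v)).
{ intros v Hv; apply smooth_on_plane, smooth_on_dz;
  [exact open_plane|now apply smooth_on_plane]. }
assert (Sb : forall v, smooth v -> smooth (dzb v)).
{ intros v Hv; apply smooth_on_plane, smooth_on_dzb;
  [exact open_plane|now apply smooth_on_plane]. }
assert (Sp : forall l, smooth (op_pow dzb l u)).
{ induction l as [|l IH]; [exact Hu|now apply Sb]. }
pose (Y := fun l x y => M x y * zbinv x y ^ (j + l) * pull (op_pow dzb l u) x y).
assert (HY : forall l, smooth_on punctured (Y l)).
{ intros l; apply (smooth_on_weight_pull al be); auto.
  apply elementary_zbinv; auto. }
assert (H1 : eq_on punctured (op_pow dzb j (fun x y => M x y * pull u x y))
  (fun x y => Csum N (fun l => inv_coeff be j l * Y l x y))).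
{ apply (pow_pull dzb M zbinv be N); auto using linear_on_dzb.
  - intros n v Hv; apply (smooth_on_weight_pull al be); auto.
    apply elementary_zbinv; auto.
  - intros n v s t Hv Hst; now apply (dzb_weight_pull al). }
assert (H2 : forall l, eq_on punctured (op_pow dz i (Y l))
  (fun x y => Csum N (fun k => inv_coeff al i k *
     (M x y * zbinv x y ^ (j + l) * zinv x y ^ (i + k) *
      pull (dzz k l u) x y)))).
{ intros l; pose proof (weights_zbinv_pow al be M (j + l) HM) as HW.
  apply (pow_pull dz (fun x y => M x y * zbinv x y ^ (j + l)) zinv al N);
    auto using linear_on_dz.
  - intros n v Hv; eapply (smooth_on_weight_pull al); eauto.
    apply elementary_zinv; auto.
  - intros n v s t Hv Hst; now apply (dz_weight_pull al _ _ n v s t HW). }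
pose proof (linear_on_pow punctured dz i HP (linear_on_dz punctured HP)) as HL.
unfold dzz at 1, op_comp.
assert (HYs : forall l, smooth_on punctured (fun x y => inv_coeff be j l * Y l x y))
  by (intros; apply smooth_on_scal; auto).
rewrite (linear_on_ext_r punctured _ _ _ HL
  (smooth_on_Csum punctured N (fun l x y => inv_coeff be j l * Y l x y) HP
     (fun l _ => HYs l)) H1 x y Hxy).
rewrite (linear_on_Csum punctured _ N (fun l x y => inv_coeff be j l * Y l x y) HP HL
  (fun l _ => HYs l) x y Hxy).
rewrite Csum2_transpose; unfold Csum2; apply Csum_ext; intros l _.
rewrite (linear_on_scal _ _ HL _ _ (HY l) x y Hxy), (H2 l x y Hxy).
rewrite <- Csum_scal; apply Csum_ext; intros k _; ring.
Qed.

Lemma expands_weight_pull D N p al be M u : expands D N p ->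
  has_weights al be M -> smooth u ->
  eq_on punctured (D (fun x y => M x y * pull u x y))
    (fun x y => M x y * Csum2 N (fun k l =>
       Csum2 N (fun i j => p i j * inv_coeff al i k * inv_coeff be j l *
         (zinv x y ^ (i + k) * zbinv x y ^ (j + l))) * pull (dzz k l u) x y)).
Proof.
intros [Hp HD] HM Hu x y Hxy.
assert (HS : smooth_on punctured (fun x y => M x y * pull u x y)).
{ apply elementary_smooth_on; [exact open_punctured|].
  apply elementary_mult; [apply elementary_smooth, HM|].
  apply elementary_pull; auto. }
rewrite (HD punctured _ open_punctured HS x y Hxy).
transitivity (Csum2 N (fun i j => Csum2 N (fun k l => M x y *
  (p i j * inv_coeff al i k * inv_coeff be j l *
         (zinv x y ^ (i + k) * zbinv x y ^ (j + l)) * pull (dzz k l u) x y)))).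
{ apply Csum2_ext; intros i j Hi Hj.
  rewrite (dzz_weight_pull al be M u N i j HM Hu Hi Hj x y Hxy).
  rewrite <- Csum2_scal; apply Csum2_ext; intros k l _ _; ring. }
rewrite Csum2_swap, <- Csum2_scal; apply Csum2_ext; intros k l _ _.
rewrite Csum2_scal; f_equal.
rewrite Cmult_comm, <- Csum2_scal; apply Csum2_ext; intros i j _ _; ring.
Qed.

(** * The Bessel equation on coefficients *)

Definition homogeneous (a : nat) (p : nat -> nat -> C) : Prop :=
  forall i j, (i + j <> a)%nat -> p i j = 0.

(** Writing p also for the polynomial sum p_ij Z^i W^j, this is the coefficient of
    Z^i W^j in (al d_Z - Z d_Z^2 + be d_W - W d_W^2) p, an operator of Bessel
    type. *)
Definition bessel (al be : C) (p : nat -> nat -> C) (i j : nat) : C :=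
  INR (S i) * (al - INR i) * p (S i) j + INR (S j) * (be - INR j) * p i (S j).

Lemma Cmult_cancel_l (c x y : C) : c <> 0 -> c * x = c * y -> x = y.
Proof.
intros Hc H; replace x with (/ c * (c * x)) by (field; auto).
rewrite H; field; auto.
Qed.

Lemma Csum_shift n (G : nat -> C) : G O = 0 -> G n = 0 ->
  Csum n G = Csum n (fun i => G (S i)).
Proof.
intros H0 Hn.
transitivity (Csum (S n) G); [simpl; rewrite Hn; ring|].
rewrite Csum_first, H0; ring.
Qed.

(** The array on the left is exp(T) p, for T the Bessel operator of [bessel], and
    the one on the right is exp(T) T p.  Both are related through the degree:
    on a homogeneous p, the part of exp(T) p that is lower by m is T^m p / m!, so
    that m times it is the part of exp(T) T p lower by m - 1.  In coefficients,
    (i - k) + (j - l) is the constant m, and [inv_coeff_lower] absorbs each of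
    the two factors. *)
Lemma bessel_sum N a al be (p : nat -> nat -> C) k l :
  (forall i j, (N <= i)%nat \/ (N <= j)%nat -> p i j = 0) ->
  homogeneous a p ->
  (INR a - INR k - INR l) *
    Csum2 N (fun i j => p i j * inv_coeff al i k * inv_coeff be j l) =
  Csum2 N (fun i j => inv_coeff al i k * inv_coeff be j l * bessel al be p i j).
Proof.
intros HN Ha.
rewrite <- Csum2_scal.
transitivity (
  Csum2 N (fun j i => p i j * ((INR i - INR k) * inv_coeff al i k) * inv_coeff be j l) +
  Csum2 N (fun i j => p i j * inv_coeff al i k * ((INR j - INR l) * inv_coeff be j l))).
{ rewrite (Csum2_transpose N (fun j i => p i j *
    ((INR i - INR k) * inv_coeff al i k) * inv_coeff be j l)), <- Csum2_plus.
  apply Csum2_ext; intros i j _ _.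
  destruct (Nat.eq_dec (i + j) a) as [<-|H]; [|rewrite (Ha i j) by auto; ring].
  rewrite plus_INR, RtoC_plus; ring. }
transitivity (
  Csum2 N (fun j i => p (S i) j * (INR (S i) * (al - INR i) * inv_coeff al i k)
     * inv_coeff be j l) +
  Csum2 N (fun i j => p i (S j) * inv_coeff al i k *
     (INR (S j) * (be - INR j) * inv_coeff be j l))).
{ f_equal; apply Csum_ext; intros m _; rewrite Csum_shift.
  - apply Csum_ext; intros i _; now rewrite inv_coeff_lower.
  - rewrite INR_0; destruct k as [|k]; [rewrite INR_0; ring|cbn [inv_coeff]; ring].
  - rewrite HN by auto; ring.
  - apply Csum_ext; intros j _; now rewrite inv_coeff_lower.
  - rewrite INR_0; destruct l as [|l]; [rewrite INR_0; ring|cbn [inv_coeff]; ring].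
  - rewrite HN by auto; ring. }
rewrite (Csum2_transpose N (fun j i => p (S i) j *
  (INR (S i) * (al - INR i) * inv_coeff al i k) * inv_coeff be j l)), <- Csum2_plus.
apply Csum2_ext; intros i j _ _; unfold bessel; ring.
Qed.

(** If T p = 0 then exp(T) p = p. *)
Lemma inv_sum_of_bessel N a al be (p : nat -> nat -> C) k l :
  (forall i j, (N <= i)%nat \/ (N <= j)%nat -> p i j = 0) ->
  homogeneous a p -> (forall i j, (S (i + j) = a)%nat -> bessel al be p i j = 0) ->
  Csum2 N (fun i j => p i j * inv_coeff al i k * inv_coeff be j l) = p k l.
Proof.
intros HN Ha Hs.
destruct (Nat.eq_dec (k + l) a) as [Hkl|Hkl].
- assert (Hz : forall i j, (i, j) <> (k, l) ->
            p i j * inv_coeff al i k * inv_coeff be j l = 0).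
  { intros i j Hij.
    destruct (Nat.eq_dec (i + j) a) as [H|H]; [|rewrite Ha by auto; ring].
    destruct (Nat.lt_ge_cases i k) as [H1|H1]; [rewrite (inv_coeff_gt al) by auto; ring|].
    destruct (Nat.lt_ge_cases j l) as [H2|H2]; [rewrite (inv_coeff_gt be) by auto; ring|].
    elim Hij; f_equal; lia. }
  destruct (Nat.lt_ge_cases k N) as [Hk|Hk]; [destruct (Nat.lt_ge_cases l N) as [Hl|Hl]|].
  + rewrite (Csum2_single N k l) by auto; rewrite !inv_coeff_diag; ring.
  + rewrite (HN k l) by auto; apply Csum2_0; intros i j Hi Hj; apply Hz.
    intros E; injection E; lia.
  + rewrite (HN k l) by auto; apply Csum2_0; intros i j Hi Hj; apply Hz.
    intros E; injection E; lia.
- rewrite (Ha k l) by auto.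
  apply (Cmult_cancel_l (INR a - INR k - INR l)); cycle 1.
  + rewrite (bessel_sum N a al be p k l HN Ha), Csum2_0; [ring|].
    intros i j _ _.
    destruct (Nat.eq_dec (S (i + j)) a) as [H|H]; [rewrite Hs by auto; ring|].
    unfold bessel; rewrite (Ha (S i) j), (Ha i (S j)) by lia; ring.
  + intros E; apply Hkl; apply INR_eq, RtoC_inj.
    rewrite plus_INR, RtoC_plus.
    replace (RtoC (INR a)) with (INR a - INR k - INR l + (INR k + INR l)) by ring.
    rewrite E; ring.
Qed.

(** The component of exp(T) p one degree below p is T p. *)
Lemma bessel_of_inv_sum N a al be (p : nat -> nat -> C) k l :
  (forall i j, (N <= i)%nat \/ (N <= j)%nat -> p i j = 0) ->
  homogeneous a p -> (S (k + l) = a)%nat ->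
  Csum2 N (fun i j => p i j * inv_coeff al i k * inv_coeff be j l) = 0 ->
  bessel al be p k l = 0.
Proof.
intros HN Ha Hkl H.
destruct (Nat.lt_ge_cases k N) as [Hk|Hk].
2: { unfold bessel; rewrite !HN by auto; ring. }
destruct (Nat.lt_ge_cases l N) as [Hl|Hl].
2: { unfold bessel; rewrite !HN by auto; ring. }
pose proof (bessel_sum N a al be p k l HN Ha) as E.
rewrite H, (Csum2_single N k l), !inv_coeff_diag in E; auto.
- rewrite Cmult_0_r in E; rewrite E; ring.
- intros i j Hij.
  destruct (Nat.lt_ge_cases i k) as [H1|H1]; [rewrite (inv_coeff_gt al) by auto; ring|].
  destruct (Nat.lt_ge_cases j l) as [H2|H2]; [rewrite (inv_coeff_gt be) by auto; ring|].
  assert (i + j <> k + l)%nat by (intros ?; elim Hij; f_equal; lia).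
  unfold bessel; rewrite (Ha (S i) j), (Ha i (S j)) by lia; ring.
Qed.

Lemma Rcpow_plus s z w : Rcpow s (z + w) = Rcpow s z * Rcpow s w.
Proof.
destruct z as [z1 z2], w as [w1 w2]; unfold Rcpow, Cmult; simpl.
rewrite !Rmult_plus_distr_r, exp_plus, cos_plus, sin_plus; f_equal; ring.
Qed.

Lemma Rcpow_mult s t z : (0 < s)%R -> (0 < t)%R ->
  Rcpow (s * t) z = Rcpow s z * Rcpow t z.
Proof.
intros Hs Ht; destruct z as [z1 z2]; unfold Rcpow, Cmult; simpl.
rewrite ln_mult by auto.
rewrite !Rmult_plus_distr_l, exp_plus, cos_plus, sin_plus; f_equal; ring.
Qed.

Lemma Rcpow_0 s : Rcpow s 0 = 1.
Proof.
unfold Rcpow; simpl; rewrite !Rmult_0_l, exp_0, cos_0, sin_0.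
unfold RtoC; f_equal; ring.
Qed.

Lemma Rcpow_INR s n : (0 < s)%R -> Rcpow s (INR n) = s ^ n.
Proof.
intros Hs; induction n as [|n IH]; [rewrite INR_0; apply Rcpow_0|].
rewrite INR_S, Rcpow_plus, IH, Cpow_S, Cmult_comm; f_equal.
unfold Rcpow, RtoC; simpl; rewrite Rmult_0_l, cos_0, sin_0, Rmult_1_l, exp_ln by auto.
f_equal; ring.
Qed.

Lemma Rcpow_opp s z : Rcpow s z * Rcpow s (- z) = 1.
Proof. rewrite <- Rcpow_plus, <- (Rcpow_0 s); f_equal; ring. Qed.

Lemma Rcpow_neq_0 s z : Rcpow s z <> 0.
Proof.
intros H; pose proof (Rcpow_opp s z) as E; rewrite H, Cmult_0_l in E.
apply RtoC_inj in E; lra.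
Qed.

Lemma Rcpow_inv s z : (0 < s)%R -> Rcpow (/ s) z = Rcpow s (- z).
Proof.
intros Hs; destruct z as [z1 z2]; unfold Rcpow; simpl; rewrite ln_Rinv by auto.
f_equal; f_equal; f_equal; ring.
Qed.

(** The modulus determines the real part of z, and the argument, which has to
    vanish for every s, the imaginary part. *)
Lemma Rcpow_eq_pow z n :
  (forall s, (0 < s <= 1)%R -> Rcpow s z = s ^ n) -> z = INR n.
Proof.
intros H; destruct z as [a b].
assert (K : forall L, (L <= 0)%R ->
  (exp (a * L) * cos (b * L) = exp (INR n * L) /\ exp (a * L) * sin (b * L) = 0)%R).
{ intros L HL; specialize (H (exp L)).
  assert (Hs : (0 < exp L <= 1)%R).
  { split; [apply exp_pos|]; rewrite <- exp_0.
    destruct (Rle_lt_or_eq_dec _ _ HL) as [HL1|HL1]; [left; now apply exp_increasing|rewrite HL1; lra]. }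
  rewrite <- (Rcpow_INR (exp L)) in H by apply exp_pos.
  specialize (H Hs); unfold Rcpow in H; simpl in H; rewrite ln_exp in H.
  injection H as H1 H2; rewrite Rmult_0_l, cos_0, Rmult_1_r in H1.
  rewrite Rmult_0_l, sin_0, Rmult_0_r in H2; auto. }
assert (Ha : a = INR n).
{ destruct (K (-1)%R) as [K1 K2]; [lra|].
  pose proof (exp_pos (a * -1)) as P1; pose proof (exp_pos (INR n * -1)) as P2.
  assert (Hsin : sin (b * -1) = 0%R) by nra.
  pose proof (sin2_cos2 (b * -1)) as E; unfold Rsqr in E; rewrite Hsin in E.
  assert (Hcos : cos (b * -1) = 1%R) by nra.
  rewrite Hcos, Rmult_1_r in K1; apply exp_inv in K1; lra. }
assert (Hb : b = 0%R).
{ destruct (Req_dec b 0) as [|Hb]; auto; exfalso.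
  pose proof PI_RGT_0 as HPI; pose proof (Rabs_pos_lt b Hb) as HB.
  (* At this L the cosine is -1. *)
  destruct (K (- (PI / Rabs b))%R) as [K1 _].
  { assert (0 < PI / Rabs b)%R by (now apply Rdiv_lt_0_compat); lra. }
  rewrite Ha in K1; pose proof (exp_pos (INR n * - (PI / Rabs b))) as P.
  assert (Hc : cos (b * - (PI / Rabs b)) = (-1)%R).
  { unfold Rabs; destruct (Rcase_abs b).
    - replace (b * - (PI / - b))%R with PI by (field; lra); apply cos_PI.
    - replace (b * - (PI / b))%R with (- PI)%R by (field; lra).
      rewrite cos_neg; apply cos_PI. }
  rewrite Hc in K1; nra. }
now rewrite Ha, Hb.
Qed.

(** F(s) = O(s^m) as s tends to 0. *)
Definition vanishes_to (m : nat) (F : R -> C) : Prop :=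
  exists B, forall s, (0 < s <= 1)%R -> (Cmod (F s) <= B * s ^ m)%R.

Lemma vanishes_to_plus m F G : vanishes_to m F -> vanishes_to m G ->
  vanishes_to m (fun s => F s + G s).
Proof.
intros [B HB] [B' HB']; exists (B + B')%R; intros s Hs.
eapply Rle_trans; [apply Cmod_triangle|].
specialize (HB s Hs); specialize (HB' s Hs); nra.
Qed.

Lemma pow_le_1 s n : (0 < s <= 1)%R -> (0 < s ^ n <= 1)%R.
Proof.
intros Hs; split; [apply pow_lt; lra|].
rewrite <- (pow1 n); apply pow_incr; lra.
Qed.

Lemma vanishes_to_monomial m n (c : C) : c = 0 \/ (m <= n)%nat ->
  vanishes_to m (fun s => c * s ^ n).
Proof.
intros H; exists (Cmod c); intros s Hs.
pose proof (Cmod_ge_0 c); pose proof (pow_le_1 s m Hs).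
destruct H as [->|H].
- rewrite Cmult_0_l, Cmod_0; nra.
- rewrite Cmod_mult, Cmod_pow, Cmod_R, Rabs_pos_eq by lra.
  replace n with (m + (n - m))%nat by lia; rewrite pow_add.
  pose proof (pow_le_1 s (n - m) Hs).
  apply Rmult_le_compat_l; auto; nra.
Qed.

Lemma vanishes_to_Csum m n (F : nat -> R -> C) :
  (forall i, (i < n)%nat -> vanishes_to m (F i)) ->
  vanishes_to m (fun s => Csum n (fun i => F i s)).
Proof.
induction n as [|n IH]; intros H; simpl.
- exists 0%R; intros s _; rewrite Cmod_0; lra.
- apply (vanishes_to_plus m (fun s => Csum n (fun i => F i s))); auto.
Qed.

Lemma vanishes_to_const m n (c : C) : (n < m)%nat ->
  vanishes_to m (fun s => c * s ^ n) -> c = 0.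
Proof.
intros Hn [B HB].
apply Cmod_eq_0; apply Rle_antisym; [|apply Cmod_ge_0].
apply le_epsilon; intros e He; rewrite Rplus_0_l.
(* Small enough for B s <= e, and positive even if B is 0. *)
set (s := Rmin 1 (e / (Rabs B + 1))).
pose proof (Rabs_pos B).
assert (Hs : (0 < s <= 1)%R).
{ unfold s; split; [apply Rmin_pos; [lra|apply Rdiv_lt_0_compat; lra]|apply Rmin_l]. }
specialize (HB s Hs).
rewrite Cmod_mult, Cmod_pow, Cmod_R, Rabs_pos_eq in HB by lra.
replace m with (n + S (m - n - 1))%nat in HB by lia; rewrite pow_add in HB; simpl in HB.
pose proof (pow_le_1 s n Hs) as H1; pose proof (pow_le_1 s (m - n - 1) Hs) as H2.
assert (H3 : (Cmod c <= B * (s * s ^ (m - n - 1)))%R).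
{ apply Rmult_le_reg_r with (s ^ n)%R; [lra|].
  eapply Rle_trans; [exact HB|]; right; ring. }
eapply Rle_trans; [exact H3|].
assert (H4 : (s <= e / (Rabs B + 1))%R) by apply Rmin_r.
apply Rle_trans with (Rabs B * s)%R.
- pose proof (Rle_abs B).
  apply Rle_trans with (Rabs B * (s * s ^ (m - n - 1)))%R; [apply Rmult_le_compat_r; nra|].
  apply Rmult_le_compat_l; nra.
- apply Rle_trans with ((Rabs B + 1) * (e / (Rabs B + 1)))%R; [|right; field; lra].
  apply Rmult_le_compat; lra.
Qed.

(** For fixed s0, the function F(s0 s) has leading term c s0^n s^n, and it equals
    s0^z F(s), with leading term c s0^z s^n.  Hence s0^z = s0^n. *)
Lemma Rcpow_leading_exponent (z c : C) n (F : R -> C) : c <> 0 ->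
  vanishes_to (S n) (fun s => F s - c * s ^ n) ->
  (forall s, (0 < s <= 1)%R -> F s = c * Rcpow s z) -> z = INR n.
Proof.
intros Hc HF HR; apply Rcpow_eq_pow; intros s0 Hs0.
apply Cmult_cancel_l with c; auto.
enough (E0 : - (c * s0 ^ n) + c * Rcpow s0 z = 0).
{ transitivity (- (c * s0 ^ n) + c * Rcpow s0 z + c * s0 ^ n); [ring|].
  rewrite E0; ring. }
apply (vanishes_to_const (S n) n); [lia|].
destruct HF as [B HB]; exists (Rabs B + Cmod (Rcpow s0 z) * B)%R; intros s Hs.
assert (Hss : (0 < s0 * s <= 1)%R) by (split; nra).
assert (E : (- (c * s0 ^ n) + c * Rcpow s0 z) * s ^ n =
  (F (s0 * s)%R - c * (s0 * s)%R ^ n) + - (Rcpow s0 z * (F s - c * s ^ n))).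
{ rewrite !HR, Rcpow_mult by (auto; lra).
  rewrite RtoC_mult, Cpow_mult_l; ring. }
rewrite E; eapply Rle_trans; [apply Cmod_triangle|].
rewrite Cmod_opp, Cmod_mult, Rmult_plus_distr_r.
apply Rplus_le_compat.
- eapply Rle_trans; [apply HB; auto|].
  pose proof (pow_le_1 (s0 * s) (S n) Hss); pose proof (Rle_abs B).
  apply Rle_trans with (Rabs B * (s0 * s) ^ S n)%R; [apply Rmult_le_compat_r; lra|].
  apply Rmult_le_compat_l; [apply Rabs_pos|].
  apply pow_incr; split; nra.
- rewrite Rmult_assoc; apply Rmult_le_compat_l; [apply Cmod_ge_0|now apply HB].
Qed.

(** Only the terms with i >= k and j >= l are non-zero, so the lowest power of s on
    the left is s^(2(k+l)), and its coefficient is p k l. *)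
Lemma leading_exponent N al be (p : nat -> nat -> C) k l z :
  (forall i j, (N <= i)%nat \/ (N <= j)%nat -> p i j = 0) -> p k l <> 0 ->
  (forall s, (0 < s <= 1)%R ->
     Csum2 N (fun i j => p i j * inv_coeff al i k * inv_coeff be j l *
       (s ^ (i + k) * s ^ (j + l))) = p k l * Rcpow s (2 * z)) ->
  z = INR (k + l).
Proof.
intros HN Hp H.
assert (Hkl : (k < N)%nat /\ (l < N)%nat).
{ split; apply Nat.nle_gt; intros ?; apply Hp, HN; auto. }
assert (E : 2 * z = INR (2 * (k + l))).
{ apply (Rcpow_leading_exponent (2 * z) (p k l) (2 * (k + l)) _ Hp) with (2 := H).
  set (T := fun i j (s : R) => (if (Nat.eqb i k && Nat.eqb j l)%bool then 0 else
      p i j * inv_coeff al i k * inv_coeff be j l) * s ^ (i + k + (j + l))).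
  assert (HT : vanishes_to (S (2 * (k + l)))
                 (fun s => Csum N (fun i => Csum N (fun j => T i j s)))).
  { apply (vanishes_to_Csum _ N (fun i s => Csum N (fun j => T i j s))); intros i _.
    apply (vanishes_to_Csum _ N (T i)); intros j _.
    apply vanishes_to_monomial.
    destruct (Nat.eqb_spec i k) as [Hi|Hi], (Nat.eqb_spec j l) as [Hj|Hj];
      simpl andb; cbv iota; auto;
    (destruct (Nat.lt_ge_cases i k); [left; rewrite (inv_coeff_gt al) by auto; ring|];
     destruct (Nat.lt_ge_cases j l); [left; rewrite (inv_coeff_gt be) by auto; ring|];
     right; lia). }
  destruct HT as [B HB]; exists B; intros s Hs.
  eapply Rle_trans; [right|exact (HB s Hs)]; f_equal.
  transitivity (Csum2 N (fun i j => T i j s +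
     (if (Nat.eqb i k && Nat.eqb j l)%bool then p k l * s ^ (2 * (k + l)) else 0))
     - p k l * s ^ (2 * (k + l))).
  - f_equal; apply Csum2_ext; intros i j _ _; unfold T.
    destruct (Nat.eqb_spec i k) as [->|Hi]; [destruct (Nat.eqb_spec j l) as [->|Hj]|];
    simpl andb; cbv iota.
    + rewrite !inv_coeff_diag.
      replace (2 * (k + l))%nat with (k + k + (l + l))%nat by lia.
      rewrite !Cpow_add_r; ring.
    + rewrite !Cpow_add_r; ring.
    + rewrite !Cpow_add_r; ring.
  - rewrite Csum2_plus.
    rewrite (Csum2_single N k l (fun i j =>
      if (Nat.eqb i k && Nat.eqb j l)%bool then p k l * s ^ (2 * (k + l)) else 0));
      [|apply Hkl|apply Hkl|].
    2: { intros i j Hij.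
      destruct (Nat.eqb_spec i k) as [->|Hi]; [destruct (Nat.eqb_spec j l) as [->|Hj]|];
      [now elim Hij|reflexivity|reflexivity]. }
    rewrite !Nat.eqb_refl; simpl andb; cbv iota; unfold Csum2; ring. }
rewrite mult_INR, RtoC_mult in E.
apply (Cmult_cancel_l 2 _ _ C2_neq_0); rewrite E.
now replace (INR 2) with 2%R by (simpl; ring).
Qed.

(** * The functional identity *)

(** The function |z|^(-2 lam) z / zb, which is r^(-2 lam) e^(2 i theta) in polar
    coordinates. *)
Definition weight_pos (lam : C) (x y : R) : C :=
  norm_pow lam x y * ((x, y) * zbinv x y).
Definition weight_neg (lam : C) (x y : R) : C :=
  norm_pow lam x y * ((x, (- y)%R) * zinv x y).

Lemma mult_zinv x y : punctured x y -> (x, y) * zinv x y = 1.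
Proof.
intros H; apply punctured_norm_pos in H; unfold zinv, Cmult, RtoC; simpl.
f_equal; field; nra.
Qed.

Lemma mult_zbinv x y : punctured x y -> (x, (- y)%R) * zbinv x y = 1.
Proof.
intros H; apply punctured_norm_pos in H; unfold zbinv, Cmult, RtoC; simpl.
f_equal; field; nra.
Qed.

Lemma has_weights_pos lam : has_weights (1 - lam) (- (1) - lam) (weight_pos lam).
Proof.
split.
- apply elementary_smooth_on; [exact open_punctured|].
  apply elementary_mult; [apply elementary_norm_pow; auto|].
  apply (elementary_mult punctured (fun x y => (x, y)) zbinv);
  [apply elementary_z|apply elementary_zbinv; auto].
- intros x y H.
  pose proof (is_wirtinger_mult _ _ _ _ _ _ _ _ (is_wirtinger_norm_pow lam x y H)
    (is_wirtinger_mult _ _ _ _ _ _ _ _ (is_wirtinger_z x y)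
       (is_wirtinger_zbinv x y H))) as K; cbv beta in K.
  pose proof (mult_zinv x y H) as E; unfold weight_pos.
  revert K E; generalize (zinv x y) (zbinv x y) (norm_pow lam x y) (x, y).
  intros w wb r z K E.
  refine (eq_rect _ (fun c => is_wirtinger _ x y c _) _ _ _).
  + refine (eq_rect _ (is_wirtinger _ x y _) K _ _); ring.
  + transitivity (- lam * w * (r * (z * wb)) + (z * w) * (r * wb)); [|ring].
    rewrite E; ring.
Qed.

Lemma has_weights_neg lam : has_weights (- (1) - lam) (1 - lam) (weight_neg lam).
Proof.
split.
- apply elementary_smooth_on; [exact open_punctured|].
  apply elementary_mult; [apply elementary_norm_pow; auto|].
  apply (elementary_mult punctured (fun x y => (x, (- y)%R)) zinv);
  [apply elementary_zb|apply elementary_zinv; auto].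
- intros x y H.
  pose proof (is_wirtinger_mult _ _ _ _ _ _ _ _ (is_wirtinger_norm_pow lam x y H)
    (is_wirtinger_mult _ _ _ _ _ _ _ _ (is_wirtinger_zb x y)
       (is_wirtinger_zinv x y H))) as K; cbv beta in K.
  pose proof (mult_zbinv x y H) as E; unfold weight_neg.
  revert K E; generalize (zinv x y) (zbinv x y) (norm_pow lam x y) (x, (- y)%R).
  intros w wb r z K E.
  refine (eq_rect _ (fun c => is_wirtinger _ x y c _) _ _ _).
  + refine (eq_rect _ (is_wirtinger _ x y _) K _ _).
    transitivity (- lam * wb * (r * (z * w)) + (z * wb) * (r * w)); [|ring].
    rewrite E; ring.
  + ring.
Qed.

Lemma cos_sin_polar_angle x y : punctured x y ->
  cos (polar_angle x y) = (x / sqrt (x ^ 2 + y ^ 2))%R /\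
  sin (polar_angle x y) = (y / sqrt (x ^ 2 + y ^ 2))%R.
Proof.
intros H; apply punctured_norm_pos in H.
set (r := sqrt (x ^ 2 + y ^ 2)).
assert (Hr : (0 < r)%R) by now apply sqrt_lt_R0.
assert (Hrr : (r * r = x ^ 2 + y ^ 2)%R) by (apply sqrt_sqrt; lra).
assert (Hc : (-1 <= x / r <= 1)%R).
{ split; [apply Rmult_le_reg_r with r|apply Rmult_le_reg_r with r]; auto;
  unfold Rdiv; rewrite Rmult_assoc, Rinv_l by lra; nra. }
assert (Hs : sin (acos (x / r)) = (Rabs y / r)%R).
{ rewrite sin_acos by exact Hc.
  replace (1 - Rsqr (x / r))%R with (Rsqr (Rabs y / r)).
  - apply sqrt_Rsqr; apply Rle_mult_inv_pos; [apply Rabs_pos|exact Hr].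
  - rewrite !Rsqr_div', <- Rsqr_abs; unfold Rsqr at 2 4.
    rewrite Hrr; unfold Rsqr; field; lra. }
unfold polar_angle; fold r.
destruct (Rle_dec 0 y) as [Hy|Hy].
- split; [now apply cos_acos|]; rewrite Hs, Rabs_pos_eq; auto.
- rewrite cos_neg, sin_neg; split; [now apply cos_acos|].
  rewrite Hs, Rabs_left by lra; field; lra.
Qed.

Lemma Rcpow_sqr s z : (0 < s)%R -> Rcpow (s * s) z = Rcpow s (2 * z).
Proof.
intros Hs; rewrite Rcpow_mult, <- Rcpow_plus by auto; f_equal; ring.
Qed.

Lemma twisted_inversion_cartesian lam F x y : punctured x y ->
  let c := RtoC ((x ^ 2 - y ^ 2) / (x ^ 2 + y ^ 2)) in
  let s := RtoC (2 * x * y / (x ^ 2 + y ^ 2)) in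
  let P := F (inv_x x y) (inv_y x y) in
  twisted_inversion lam F x y =
  (norm_pow lam x y * (c * fst P - s * snd P),
   norm_pow lam x y * (s * fst P + c * snd P)).
Proof.
intros H; cbv zeta.
destruct (cos_sin_polar_angle x y H) as [Hc Hs].
apply punctured_norm_pos in H.
unfold twisted_inversion, twisted_inversion_polar.
rewrite cos_2a, sin_2a, Hc, Hs.
set (r := sqrt (x ^ 2 + y ^ 2)).
assert (Hr : (0 < r)%R) by now apply sqrt_lt_R0.
assert (Hrr : (x ^ 2 + y ^ 2 = r * r)%R) by (symmetry; apply sqrt_sqrt; lra).
unfold norm_pow, inv_x, inv_y; rewrite Hrr, Rcpow_sqr by auto.
replace (- (x / r) / r)%R with (- x / (r * r))%R by (field; lra).
replace (y / r / r)%R with (y / (r * r))%R by (field; lra).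
replace (x / r * (x / r) - y / r * (y / r))%R
  with ((x ^ 2 - y ^ 2) / (r * r))%R by (field; lra).
replace (2 * (y / r) * (x / r))%R with (2 * x * y / (r * r))%R by (field; lra).
replace (2 * - lam) with (- (2 * lam)) by ring.
reflexivity.
Qed.

Definition plus_comp (F : R -> R -> C * C) (x y : R) : C :=
  fst (F x y) + Ci * snd (F x y).
Definition minus_comp (F : R -> R -> C * C) (x y : R) : C :=
  fst (F x y) - Ci * snd (F x y).

(** The rotation by 2 theta multiplies f + i g by e^(2 i theta) and f - i g by
    e^(-2 i theta), so in these components the twisted inversion is diagonal. *)
Lemma twisted_inversion_comp lam F x y : punctured x y ->
  plus_comp (twisted_inversion lam F) x y =
    weight_pos lam x y * pull (plus_comp F) x y /\
  minus_comp (twisted_inversion lam F) x y =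
    weight_neg lam x y * pull (minus_comp F) x y.
Proof.
intros H; unfold plus_comp, minus_comp.
rewrite (twisted_inversion_cartesian lam F x y H); cbn [fst snd].
apply punctured_norm_pos in H.
unfold pull, weight_pos, weight_neg.
set (P := F (inv_x x y) (inv_y x y)).
assert (E1 : (x, y) * zbinv x y = RtoC ((x ^ 2 - y ^ 2) / (x ^ 2 + y ^ 2)) +
               Ci * RtoC (2 * x * y / (x ^ 2 + y ^ 2))).
{ unfold zbinv, Ci, Cmult, Cplus, RtoC; simpl; f_equal; field; nra. }
assert (E2 : (x, (- y)%R) * zinv x y = RtoC ((x ^ 2 - y ^ 2) / (x ^ 2 + y ^ 2)) -
               Ci * RtoC (2 * x * y / (x ^ 2 + y ^ 2))).
{ unfold zinv, Ci, Cmult, Cminus, Copp, Cplus, RtoC; simpl; f_equal; field; nra. }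
rewrite E1, E2.
generalize (RtoC ((x ^ 2 - y ^ 2) / (x ^ 2 + y ^ 2)))
  (RtoC (2 * x * y / (x ^ 2 + y ^ 2))) (norm_pow lam x y) (fst P) (snd P).
intros c s r f g; split.
- transitivity (r * (c * f + s * (- (1)) * g + Ci * (s * f + c * g))); [ring|].
  rewrite <- Ci_sqr; ring.
- transitivity (r * (c * f + s * (- (1)) * g - Ci * (s * f + c * g))); [ring|].
  rewrite <- Ci_sqr; ring.
Qed.

(** E1 f + E2 g is the sum of (E1 - i E2)/2 applied to f + i g and of
    (E1 + i E2)/2 applied to f - i g; eps = 1 and eps = -1 give these two
    operators. *)
Definition chiral_part (eps : C) (E1 E2 : operator) : operator :=
  op_scal (/ 2) (op_add E1 (op_scal (- (eps * Ci)) E2)).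

Notation plus_part := (chiral_part 1).
Notation minus_part := (chiral_part (- (1))).

Lemma cc_chiral_part eps E1 E2 : const_coeff_op E1 -> const_coeff_op E2 ->
  const_coeff_op (chiral_part eps E1 E2).
Proof. intros H1 H2; now apply cc_scal, cc_add, cc_scal. Qed.

Lemma linear_on_comb U D a b f g : open_2d U -> linear_on U D -> smooth_on U f ->
  smooth_on U g ->
  eq_on U (D (fun x y => a * f x y + b * g x y))
    (fun x y => a * D f x y + b * D g x y).
Proof.
intros HU HD Hf Hg x y Hxy.
rewrite (linear_on_plus _ _ HD (fun x y => a * f x y) (fun x y => b * g x y))
  by auto using smooth_on_scal.
now rewrite (linear_on_scal _ _ HD a f), (linear_on_scal _ _ HD b g).
Qed.

Lemma plus_comp_smooth U F : open_2d U ->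
  smooth_on U (fun x y => fst (F x y)) -> smooth_on U (fun x y => snd (F x y)) ->
  smooth_on U (plus_comp F) /\ smooth_on U (minus_comp F).
Proof.
intros HU Hf Hg; split.
- apply (smooth_on_plus U (fun x y => fst (F x y)) (fun x y => Ci * snd (F x y)));
  auto using smooth_on_scal.
- apply (smooth_on_ext U (fun x y => fst (F x y) + (- Ci) * snd (F x y))); auto.
  + intros x y _; unfold minus_comp; ring.
  + apply smooth_on_plus; auto; apply (smooth_on_scal U (- Ci)); auto.
Qed.

Lemma Rest_parts U E1 E2 F x : open_2d U -> const_coeff_op E1 -> const_coeff_op E2 ->
  smooth_on U (fun x y => fst (F x y)) -> smooth_on U (fun x y => snd (F x y)) ->
  U x 0%R ->
  Rest E1 E2 F x =
  plus_part E1 E2 (plus_comp F) x 0 + minus_part E1 E2 (minus_comp F) x 0.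
Proof.
intros HU H1 H2 Hf Hg Hx.
apply (cc_linear_on U) in H1, H2; auto.
set (f := fun x y => fst (F x y)) in *; set (g := fun x y => snd (F x y)) in *.
assert (K : forall D, linear_on U D ->
  D (plus_comp F) x 0%R = D f x 0%R + Ci * D g x 0%R /\
  D (minus_comp F) x 0%R = D f x 0%R - Ci * D g x 0%R).
{ intros D HD; split.
  - rewrite (linear_on_ext_r U D _ (fun x y => 1 * f x y + Ci * g x y)); auto.
    + rewrite (linear_on_comb U D) by auto; ring.
    + apply smooth_on_plus; auto using smooth_on_scal.
    + intros u v _; unfold plus_comp, f, g; ring.
  - rewrite (linear_on_ext_r U D _ (fun x y => 1 * f x y + (- Ci) * g x y)); auto.
    + rewrite (linear_on_comb U D) by auto; ring.
    + apply smooth_on_plus; auto using smooth_on_scal.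
    + intros u v _; unfold minus_comp, f, g; ring. }
unfold Rest, chiral_part, op_scal, op_add; fold f g.
destruct (K E1 H1) as [-> ->], (K E2 H2) as [-> ->].
transitivity (E1 f x 0%R + - (Ci * Ci) * E2 g x 0%R); [rewrite Ci_sqr; ring|].
field; exact C2_neq_0.
Qed.

(** The coefficient, up to the factor |x|^(-2 lam), of (dz^k dzb^l u)(-1/x) in the
    operator with coefficients p applied at x to M u(-1/z), where s = 1/x. *)
Definition inv_sum (N : nat) (al be : C) (p : nat -> nat -> C) (k l : nat) (s : R) : C :=
  Csum2 N (fun i j => p i j * inv_coeff al i k * inv_coeff be j l *
                      (s ^ (i + k) * s ^ (j + l))).

Lemma axis_values lam x : x <> 0%R ->
  zinv x 0 = (/ x)%R /\ zbinv x 0 = (/ x)%R /\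
  weight_pos lam x 0 = Rcpow (Rabs x) (- (2 * lam)) /\
  weight_neg lam x 0 = Rcpow (Rabs x) (- (2 * lam)) /\
  inv_x x 0 = (- (1 / x))%R /\ inv_y x 0 = 0%R.
Proof.
intros Hx.
assert (E : zinv x 0 = (/ x)%R /\ zbinv x 0 = (/ x)%R).
{ unfold zinv, zbinv, RtoC; split; f_equal; field; auto. }
assert (N : norm_pow lam x 0 = Rcpow (Rabs x) (- (2 * lam))).
{ unfold norm_pow; replace (x ^ 2 + 0 ^ 2)%R with (Rabs x * Rabs x)%R.
  - rewrite Rcpow_sqr by (now apply Rabs_pos_lt); f_equal; ring.
  - rewrite <- Rabs_mult, Rabs_pos_eq by nra; ring. }
destruct E as [E1 E2]; repeat split; auto.
- unfold weight_pos; rewrite N, E2; change (x, 0%R) with (RtoC x).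
  rewrite <- RtoC_mult, Rinv_r by auto; ring.
- unfold weight_neg; rewrite N, E1.
  replace (x, (- 0)%R) with (RtoC x) by (unfold RtoC; f_equal; ring).
  rewrite <- RtoC_mult, Rinv_r by auto; ring.
- unfold inv_x; field; auto.
- unfold inv_y; field; auto.
Qed.

Lemma smooth_weight_pull al be M u : has_weights al be M -> smooth u ->
  smooth_on punctured (fun x y => M x y * pull u x y).
Proof.
intros HM Hu; apply elementary_smooth_on; [exact open_punctured|].
apply elementary_mult; [apply elementary_smooth, HM|apply elementary_pull; auto].
Qed.

Lemma smooth_comp F : smooth_pair F -> smooth (plus_comp F) /\ smooth (minus_comp F).
Proof.
intros [Hf Hg]; apply smooth_on_plane in Hf, Hg.
destruct (plus_comp_smooth plane F open_plane Hf Hg) as [Hu Hv].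
now split; apply smooth_on_plane.
Qed.

Lemma smooth_twisted_inversion lam F : smooth_pair F ->
  smooth_on punctured (fun x y => fst (twisted_inversion lam F x y)) /\
  smooth_on punctured (fun x y => snd (twisted_inversion lam F x y)).
Proof.
intros HF; destruct (smooth_comp F HF) as [Hu Hv].
pose proof open_punctured as HO.
set (U := fun x y => weight_pos lam x y * pull (plus_comp F) x y).
set (V := fun x y => weight_neg lam x y * pull (minus_comp F) x y).
assert (SU : smooth_on punctured U)
  by (eapply smooth_weight_pull; eauto using has_weights_pos).
assert (SV : smooth_on punctured V)
  by (eapply smooth_weight_pull; eauto using has_weights_neg).
split.
- apply (smooth_on_ext punctured (fun x y => / 2 * U x y + / 2 * V x y)); auto.
  + intros u v H; destruct (twisted_inversion_comp lam F u v H) as [EU EV].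
    unfold U, V; rewrite <- EU, <- EV.
    unfold plus_comp, minus_comp; field; exact C2_neq_0.
  + apply smooth_on_plus; auto using smooth_on_scal.
- apply (smooth_on_ext punctured (fun x y => (- Ci / 2) * U x y + (Ci / 2) * V x y)); auto.
  + intros u v H; destruct (twisted_inversion_comp lam F u v H) as [EU EV].
    unfold U, V; rewrite <- EU, <- EV; unfold plus_comp, minus_comp.
    transitivity (- (Ci * Ci) * snd (twisted_inversion lam F u v));
      [field; exact C2_neq_0|].
    rewrite Ci_sqr; ring.
  + apply smooth_on_plus; auto using smooth_on_scal.
Qed.

Lemma Rest_twisted_inversion lam E1 E2 N p q F x :
  const_coeff_op E1 -> const_coeff_op E2 ->
  expands (plus_part E1 E2) N p -> expands (minus_part E1 E2) N q ->
  smooth_pair F -> x <> 0%R ->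
  Rest E1 E2 (twisted_inversion lam F) x =
  Rcpow (Rabs x) (- (2 * lam)) *
   (Csum2 N (fun k l => inv_sum N (1 - lam) (- (1) - lam) p k l (/ x) *
                        dzz k l (plus_comp F) (- (1 / x))%R 0) +
    Csum2 N (fun k l => inv_sum N (- (1) - lam) (1 - lam) q k l (/ x) *
                        dzz k l (minus_comp F) (- (1 / x))%R 0)).
Proof.
intros H1 H2 HP HQ HF Hx.
destruct (smooth_comp F HF) as [Hu Hv].
destruct (smooth_twisted_inversion lam F HF) as [Sf Sg].
pose proof (has_weights_pos lam) as Wp; pose proof (has_weights_neg lam) as Wn.
pose proof open_punctured as HO.
assert (Hp : punctured x 0) by now left.
rewrite (Rest_parts punctured) by auto.
rewrite (linear_on_ext_r punctured _ _ _
  (cc_linear_on _ _ HO (cc_chiral_part 1 _ _ H1 H2)) (smooth_weight_pull _ _ _ _ Wp Hu)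
  (fun u v H => proj1 (twisted_inversion_comp lam F u v H)) x _ Hp).
rewrite (linear_on_ext_r punctured _ _ _
  (cc_linear_on _ _ HO (cc_chiral_part (- (1)) _ _ H1 H2)) (smooth_weight_pull _ _ _ _ Wn Hv)
  (fun u v H => proj2 (twisted_inversion_comp lam F u v H)) x _ Hp).
rewrite (expands_weight_pull _ _ _ _ _ _ _ HP Wp Hu x _ Hp).
rewrite (expands_weight_pull _ _ _ _ _ _ _ HQ Wn Hv x _ Hp).
destruct (axis_values lam x Hx) as (-> & -> & -> & -> & X1 & X2).
unfold pull, inv_sum; rewrite X1, X2; ring.
Qed.

Lemma Rest_expand E1 E2 N p q F x :
  const_coeff_op E1 -> const_coeff_op E2 ->
  expands (plus_part E1 E2) N p -> expands (minus_part E1 E2) N q ->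
  smooth_pair F ->
  Rest E1 E2 F x =
  Csum2 N (fun k l => p k l * dzz k l (plus_comp F) x 0) +
  Csum2 N (fun k l => q k l * dzz k l (minus_comp F) x 0).
Proof.
intros H1 H2 [_ HP] [_ HQ] [Hf Hg].
apply smooth_on_plane in Hf, Hg.
destruct (plus_comp_smooth plane F open_plane Hf Hg) as [Hu Hv].
rewrite (Rest_parts plane); auto using open_plane; [|exact I].
rewrite (HP plane _ open_plane Hu x 0%R I), (HQ plane _ open_plane Hv x 0%R I).
reflexivity.
Qed.

(** For p homogeneous of degree a the power of s is constant, equal to a + k + l. *)
Lemma inv_sum_homogeneous N a al be p k l s :
  (forall i j, (N <= i)%nat \/ (N <= j)%nat -> p i j = RtoC 0) ->
  homogeneous a p -> (forall i j, (S (i + j) = a)%nat -> bessel al be p i j = 0) ->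
  inv_sum N al be p k l s = p k l * s ^ (2 * a).
Proof.
intros HN Ha Hs.
transitivity (s ^ (a + k + l) *
  Csum2 N (fun i j => p i j * inv_coeff al i k * inv_coeff be j l)).
- rewrite <- Csum2_scal; apply Csum2_ext; intros i j _ _.
  destruct (Nat.eq_dec (i + j) a) as [<-|H]; [|rewrite Ha by auto; ring].
  rewrite !Cpow_add_r; ring.
- rewrite (inv_sum_of_bessel N a) by auto.
  destruct (Nat.eq_dec (k + l) a) as [<-|H]; [|rewrite Ha by auto; ring].
  replace (2 * (k + l))%nat with (k + l + k + l)%nat by lia; ring.
Qed.

(** By [inv_sum_homogeneous] the two sides have the same coefficient in front of
    each derivative of f + i g and of f - i g at -1/x. *)
Theorem functional_identity_of_bessel lam nu a E1 E2 N p q :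
  nu - lam = INR a ->
  const_coeff_op E1 -> const_coeff_op E2 ->
  expands (plus_part E1 E2) N p -> expands (minus_part E1 E2) N q ->
  homogeneous a p -> homogeneous a q ->
  (forall i j, (S (i + j) = a)%nat -> bessel (1 - lam) (- (1) - lam) p i j = 0) ->
  (forall i j, (S (i + j) = a)%nat -> bessel (- (1) - lam) (1 - lam) q i j = 0) ->
  functional_identity lam nu (Rest E1 E2).
Proof.
intros Ha H1 H2 HP HQ Hp Hq Sp Sq F HF x Hx.
rewrite (Rest_twisted_inversion lam E1 E2 N p q) by auto.
rewrite (Rest_expand E1 E2 N p q) by auto.
assert (E : Rcpow (Rabs x) (- (2 * nu)) =
            Rcpow (Rabs x) (- (2 * lam)) * (/ x)%R ^ (2 * a)).
{ replace (- (2 * nu)) with (- (2 * lam) + - INR (2 * a)).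
  2: { rewrite mult_INR, RtoC_mult, <- Ha.
       replace (INR 2) with 2%R by (simpl; ring); ring. }
  rewrite Rcpow_plus; f_equal.
  rewrite <- Rcpow_inv, Rcpow_INR by
    (try apply Rinv_0_lt_compat; now apply Rabs_pos_lt).
  rewrite !Cpow_mult_r, <- !RtoC_pow; f_equal; f_equal.
  rewrite <- Rabs_inv, pow2_abs.
  reflexivity. }
rewrite E, <- Cmult_assoc; f_equal.
rewrite Cmult_plus_distr_l, <- !Csum2_scal.
f_equal; apply Csum2_ext; intros k l _ _.
- rewrite (inv_sum_homogeneous N a) by (auto; apply HP); ring.
- rewrite (inv_sum_homogeneous N a) by (auto; apply HQ); ring.
Qed.

Lemma inv_sum_out N al be p k l s : (N <= k)%nat \/ (N <= l)%nat ->
  inv_sum N al be p k l s = 0.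
Proof.
intros H; apply Csum2_0; intros i j Hi Hj; destruct H.
- rewrite (inv_coeff_gt al) by lia; ring.
- rewrite (inv_coeff_gt be) by lia; ring.
Qed.

Lemma Csum2_dzz_0 N (A : nat -> nat -> C) x y :
  Csum2 N (fun i j => A i j * dzz i j (fun _ _ => 0) x y) = 0.
Proof.
apply Csum2_0; intros i j _ _.
rewrite (linear_on_0 plane (dzz i j) open_plane (linear_on_dzz _ i j open_plane) x y I).
ring.
Qed.

Lemma dzz_eq i j f g x y : smooth g -> (forall u v, f u v = g u v) ->
  dzz i j f x y = dzz i j g x y.
Proof.
intros Hg E; apply (linear_on_ext_r plane (dzz i j)); auto.
- apply linear_on_dzz, open_plane.
- now apply smooth_on_plane.
- now intros u v _.
- exact I.
Qed.

Lemma pair_of_comp (u v : R -> R -> C) : smooth u -> smooth v ->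
  exists F, smooth_pair F /\ (forall x y, plus_comp F x y = u x y) /\
    (forall x y, minus_comp F x y = v x y).
Proof.
intros Hu Hv; apply smooth_on_plane in Hu, Hv.
exists (fun x y => (/ 2 * u x y + / 2 * v x y, (- Ci / 2) * u x y + (Ci / 2) * v x y)).
pose proof open_plane as HO.
split; [|split].
- split; apply smooth_on_plane; cbn [fst snd];
  apply smooth_on_plus; auto using smooth_on_scal.
- intros x y; unfold plus_comp; cbn [fst snd].
  transitivity (/ 2 * u x y + / 2 * v x y - (Ci * Ci) / 2 * u x y + (Ci * Ci) / 2 * v x y);
    [field; exact C2_neq_0|].
  rewrite Ci_sqr; field; exact C2_neq_0.
- intros x y; unfold minus_comp; cbn [fst snd].
  transitivity (/ 2 * u x y + / 2 * v x y + (Ci * Ci) / 2 * u x y - (Ci * Ci) / 2 * v x y);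
    [field; exact C2_neq_0|].
  rewrite Ci_sqr; field; exact C2_neq_0.
Qed.

Lemma Rcpow_cancel lam nu s (X Y : C) : (0 < s)%R ->
  Rcpow (/ s) (- (2 * lam)) * X = Rcpow (/ s) (- (2 * nu)) * Y ->
  X = Y * Rcpow s (2 * (nu - lam)).
Proof.
intros Hs H; rewrite !Rcpow_inv in H by auto.
replace (- - (2 * lam)) with (2 * lam) in H by ring.
replace (- - (2 * nu)) with (2 * lam + 2 * (nu - lam)) in H by ring.
rewrite Rcpow_plus in H.
apply (Cmult_cancel_l (Rcpow s (2 * lam))); [apply Rcpow_neq_0|].
rewrite H; ring.
Qed.

(** Test functions with f - i g = 0 and f + i g = (z - t)^k (zb - t)^l, where
    t = -1/x, or the other way round, isolate a single coefficient. *)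
Theorem inv_sum_of_functional_identity lam nu E1 E2 N p q :
  const_coeff_op E1 -> const_coeff_op E2 ->
  expands (plus_part E1 E2) N p -> expands (minus_part E1 E2) N q ->
  functional_identity lam nu (Rest E1 E2) ->
  forall k l s, (0 < s)%R ->
    inv_sum N (1 - lam) (- (1) - lam) p k l s = p k l * Rcpow s (2 * (nu - lam)) /\
    inv_sum N (- (1) - lam) (1 - lam) q k l s = q k l * Rcpow s (2 * (nu - lam)).
Proof.
intros H1 H2 HP HQ HI k l s Hs.
destruct (Nat.lt_ge_cases k N) as [Hk|Hk].
2: { rewrite !inv_sum_out by auto.
     rewrite (proj1 HP), (proj1 HQ) by auto; split; ring. }
destruct (Nat.lt_ge_cases l N) as [Hl|Hl].
2: { rewrite !inv_sum_out by auto.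
     rewrite (proj1 HP), (proj1 HQ) by auto; split; ring. }
set (x := (/ s)%R).
assert (Hx : (0 < x)%R) by now apply Rinv_0_lt_compat.
assert (Hxs : (/ x)%R = s) by (unfold x; apply Rinv_inv).
set (t := (- (1 / x))%R).
assert (Hm : smooth (zmon t k l)) by (apply smooth_on_plane, smooth_on_zmon, open_plane).
assert (Hz : smooth (fun _ _ => RtoC 0)) by (apply smooth_on_plane, smooth_on_const, open_plane).
assert (Hf : INR (fact k) * INR (fact l) <> 0)
  by (apply Cmult_neq_0; apply INR_fact_C_neq_0).
assert (K : forall (u v : R -> R -> C), smooth u -> smooth v ->
  Csum2 N (fun i j => inv_sum N (1 - lam) (- (1) - lam) p i j s * dzz i j u t 0) +
  Csum2 N (fun i j => inv_sum N (- (1) - lam) (1 - lam) q i j s * dzz i j v t 0) =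
  (Csum2 N (fun i j => p i j * dzz i j u t 0) +
   Csum2 N (fun i j => q i j * dzz i j v t 0)) * Rcpow s (2 * (nu - lam))).
{ intros u v Hu Hv; destruct (pair_of_comp u v Hu Hv) as (F & HF & Fu & Fv).
  apply Rcpow_cancel; auto; fold x.
  assert (Hx0 : x <> 0%R) by lra.
  pose proof (HI F HF x Hx0) as E.
  rewrite (Rest_twisted_inversion lam E1 E2 N p q) in E by auto.
  rewrite (Rest_expand E1 E2 N p q) in E by auto.
  rewrite Rabs_pos_eq, Hxs in E by lra; fold t in E.
  assert (Xu : forall i j, dzz i j (plus_comp F) t 0 = dzz i j u t 0)
    by (intros; now apply dzz_eq).
  assert (Xv : forall i j, dzz i j (minus_comp F) t 0 = dzz i j v t 0)
    by (intros; now apply dzz_eq).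
  assert (EA : forall A B : nat -> nat -> C,
    Csum2 N (fun i j => A i j * dzz i j (plus_comp F) t 0) +
    Csum2 N (fun i j => B i j * dzz i j (minus_comp F) t 0) =
    Csum2 N (fun i j => A i j * dzz i j u t 0) +
    Csum2 N (fun i j => B i j * dzz i j v t 0)).
  { intros A B; f_equal; apply Csum2_ext; intros; [now rewrite Xu|now rewrite Xv]. }
  rewrite !EA in E; exact E. }
split; apply (Cmult_cancel_l _ _ _ Hf).
- specialize (K _ _ Hm Hz); rewrite !Csum2_dzz_0, !Csum2_dzz_zmon in K by auto.
  rewrite !Cplus_0_r in K; rewrite Cmult_comm, K; ring.
- specialize (K _ _ Hz Hm); rewrite !Csum2_dzz_0, !Csum2_dzz_zmon in K by auto.
  rewrite !Cplus_0_l in K; rewrite Cmult_comm, K; ring.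
Qed.

(** The functional identity equates a polynomial in s = 1/x with a multiple of
    s^(2(nu - lam)); compare the behaviours as s tends to 0. *)
Theorem exponent_of_functional_identity lam nu E1 E2 N p q :
  const_coeff_op E1 -> const_coeff_op E2 ->
  expands (plus_part E1 E2) N p -> expands (minus_part E1 E2) N q ->
  functional_identity lam nu (Rest E1 E2) ->
  forall k l, p k l <> 0 \/ q k l <> 0 -> nu - lam = INR (k + l).
Proof.
intros H1 H2 HP HQ HI k l [H|H].
- apply (leading_exponent N (1 - lam) (- (1) - lam) p); [apply HP|exact H|].
  intros s Hs; now apply (inv_sum_of_functional_identity lam nu E1 E2 N p q).
- apply (leading_exponent N (- (1) - lam) (1 - lam) q); [apply HQ|exact H|].
  intros s Hs; now apply (inv_sum_of_functional_identity lam nu E1 E2 N p q).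
Qed.

(** By the preceding theorem p and q live in degree a only, so the coefficients of
    the derivatives of order a - 1 on the inverted side have to vanish. *)
Theorem bessel_of_functional_identity lam nu a E1 E2 N p q :
  nu - lam = INR a ->
  const_coeff_op E1 -> const_coeff_op E2 ->
  expands (plus_part E1 E2) N p -> expands (minus_part E1 E2) N q ->
  functional_identity lam nu (Rest E1 E2) ->
  (homogeneous a p /\
   forall i j, (S (i + j) = a)%nat -> bessel (1 - lam) (- (1) - lam) p i j = 0) /\
  (homogeneous a q /\
   forall i j, (S (i + j) = a)%nat -> bessel (- (1) - lam) (1 - lam) q i j = 0).
Proof.
intros Ha H1 H2 HP HQ HI.
assert (Hpq : homogeneous a p /\ homogeneous a q).
{ pose proof (exponent_of_functional_identity lam nu E1 E2 N p q H1 H2 HP HQ HI) as K.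
  assert (Hn : forall i j, nu - lam = INR (i + j) -> (i + j)%nat = a).
  { intros i j E; rewrite Ha in E; apply RtoC_inj, INR_eq in E; auto. }
  split; intros i j Hij.
  - destruct (Ceq_dec (p i j) 0) as [|Hne]; auto; elim Hij; auto.
  - destruct (Ceq_dec (q i j) 0) as [|Hne]; auto; elim Hij; auto. }
assert (Hsum : forall k l,
  inv_sum N (1 - lam) (- (1) - lam) p k l 1 = p k l /\
  inv_sum N (- (1) - lam) (1 - lam) q k l 1 = q k l).
{ intros k l.
  destruct (inv_sum_of_functional_identity lam nu E1 E2 N p q H1 H2 HP HQ HI k l 1)
    as [-> ->]; [lra|].
  replace (Rcpow 1 (2 * (nu - lam))) with (RtoC 1); [split; ring|].
  unfold Rcpow; rewrite ln_1, !Rmult_0_r, exp_0, cos_0, sin_0.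
  unfold RtoC; f_equal; ring. }
assert (Hone : forall al be (r : nat -> nat -> C) k l,
  inv_sum N al be r k l 1 =
  Csum2 N (fun i j => r i j * inv_coeff al i k * inv_coeff be j l)).
{ intros al be r k l; apply Csum2_ext; intros i j _ _; rewrite !Cpow_1_l; ring. }
split; (split; [apply Hpq|]); intros i j Hij.
- apply (bessel_of_inv_sum N a); auto; [apply HP|apply Hpq|].
  rewrite <- Hone, (proj1 (Hsum i j)); apply (proj1 Hpq); lia.
- apply (bessel_of_inv_sum N a); auto; [apply HQ|apply Hpq|].
  rewrite <- Hone, (proj2 (Hsum i j)); apply (proj2 Hpq); lia.
Qed.

(** * Symbols of the Gegenbauer operators *)

Definition mon (i j : nat) (x y : R) : C := RtoC x ^ i * RtoC y ^ j.

Lemma is_wirtinger_mon i j x y :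
  is_wirtinger (mon i j) x y
    (/ 2 * (INR i * mon (i - 1) j x y) + (- Ci / 2) * (INR j * mon i (j - 1) x y))
    (/ 2 * (INR i * mon (i - 1) j x y) + (Ci / 2) * (INR j * mon i (j - 1) x y)).
Proof.
assert (HX : is_wirtinger (fun u v => RtoC u) x y (/ 2) (/ 2)).
{ unfold is_wirtinger.
  replace (/ 2 + / 2) with (RtoC 1) by (field; exact C2_neq_0).
  replace (Ci * (/ 2 - / 2)) with (RtoC 0) by ring.
  split; split; unfold Re, Im; simpl; auto_derive; auto; ring. }
assert (HY : is_wirtinger (fun u v => RtoC v) x y (- Ci / 2) (Ci / 2)).
{ unfold is_wirtinger.
  replace (- Ci / 2 + Ci / 2) with (RtoC 0) by (field; exact C2_neq_0).
  replace (Ci * (- Ci / 2 - Ci / 2)) with (- (Ci * Ci)) by (field; exact C2_neq_0).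
  rewrite Ci_sqr.
  split; split; unfold Re, Im; simpl; auto_derive; auto; ring. }
pose proof (is_wirtinger_mult _ _ _ _ _ _ _ _ (is_wirtinger_pow _ _ _ _ _ i HX)
  (is_wirtinger_pow _ _ _ _ _ j HY)) as H; cbv beta in H.
unfold mon.
refine (eq_rect _ (fun c => is_wirtinger _ x y c _) _ _ _).
- refine (eq_rect _ (is_wirtinger _ x y _) H _ _); field; exact C2_neq_0.
- field; exact C2_neq_0.
Qed.

Lemma dx_mon i j x y : dx (mon i j) x y = INR i * mon (i - 1) j x y.
Proof.
rewrite (is_wirtinger_dx _ _ _ _ _ (is_wirtinger_mon i j x y)).
field; exact C2_neq_0.
Qed.

Lemma dy_mon i j x y : dy (mon i j) x y = INR j * mon i (j - 1) x y.
Proof.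
rewrite (is_wirtinger_dy _ _ _ _ _ (is_wirtinger_mon i j x y)).
transitivity (- (Ci * Ci) * (INR j * mon i (j - 1) x y));
  [field; exact C2_neq_0|rewrite Ci_sqr; ring].
Qed.

Lemma smooth_on_mon i j : smooth_on plane (mon i j).
Proof.
apply elementary_smooth_on; [exact open_plane|].
assert (HX : elementary plane (fun x y => RtoC x)).
{ apply elementary_smooth, (smooth_on_ext plane
    (fun x y => / 2 * (x, y) + / 2 * (x, (- y)%R))); [exact open_plane| |].
  - intros x y _; unfold RtoC, Cinv, Cmult, Cplus; simpl; f_equal; field.
  - apply elementary_smooth_on; [exact open_plane|].
    apply (elementary_lin plane (/ 2) (/ 2) (fun x y => (x, y)) (fun x y => (x, (- y)%R)));
    [apply elementary_z|apply elementary_zb]. }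
assert (HY : elementary plane (fun x y => RtoC y)).
{ apply elementary_smooth, (smooth_on_ext plane
    (fun x y => - Ci / 2 * (x, y) + Ci / 2 * (x, (- y)%R))); [exact open_plane| |].
  - intros x y _; unfold RtoC, Ci, Cdiv, Copp, Cinv, Cmult, Cplus; simpl; f_equal; field.
  - apply elementary_smooth_on; [exact open_plane|].
    apply (elementary_lin plane (- Ci / 2) (Ci / 2) (fun x y => (x, y))
      (fun x y => (x, (- y)%R))); [apply elementary_z|apply elementary_zb]. }
apply (elementary_mult plane (fun x y => RtoC x ^ i) (fun x y => RtoC y ^ j)).
- now apply (elementary_pow plane (fun x y => RtoC x)).
- now apply (elementary_pow plane (fun x y => RtoC y)).
Qed.

Lemma mon_origin i j : (i, j) <> (O, O) -> mon i j 0 0 = 0.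
Proof.
intros H; unfold mon.
destruct i; [destruct j; [now elim H|]|]; rewrite Cpow_S; ring.
Qed.

(** The coefficient of dx^i dy^j in D. *)
Definition symbol (D : operator) (i j : nat) : C :=
  D (mon i j) 0%R 0%R / (INR (fact i) * INR (fact j)).

Lemma fact_C_neq_0 i j : INR (fact i) * INR (fact j) <> RtoC 0.
Proof. apply Cmult_neq_0; apply INR_fact_C_neq_0. Qed.

Lemma symbol_eq D i j : D (mon i j) 0%R 0%R = symbol D i j * (INR (fact i) * INR (fact j)).
Proof. unfold symbol; field; split; apply INR_fact_C_neq_0. Qed.

Lemma INR_fact_S i : RtoC (INR (fact (S i))) = (INR i + 1) * INR (fact i).
Proof. rewrite fact_simpl, mult_INR, RtoC_mult, INR_S; reflexivity. Qed.

Lemma symbol_add A B i j : symbol (op_add A B) i j = symbol A i j + symbol B i j.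
Proof. unfold symbol, op_add; field; split; apply INR_fact_C_neq_0. Qed.

Lemma symbol_scal c A i j : symbol (op_scal c A) i j = c * symbol A i j.
Proof. unfold symbol, op_scal; field; split; apply INR_fact_C_neq_0. Qed.

Lemma INR_S_neq_0 i : INR i + 1 <> RtoC 0.
Proof. rewrite <- INR_S; intros H; apply RtoC_inj in H; revert H; apply not_0_INR; lia. Qed.

Lemma symbol_dx D i j : const_coeff_op D ->
  symbol (op_comp dx D) i j = match i with O => 0 | S i' => symbol D i' j end.
Proof.
intros HD; unfold symbol at 1, op_comp.
rewrite (dx_commute_on plane D open_plane HD _ (smooth_on_mon i j) 0%R 0%R I).
pose proof (cc_linear_on plane D open_plane HD) as HL.
rewrite (linear_on_ext_r plane D _ (fun x y => INR i * mon (i - 1) j x y) HL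
  (smooth_on_scal plane _ _ open_plane (smooth_on_mon (i - 1) j))
  (fun u v _ => dx_mon i j u v) 0%R 0%R I).
rewrite (linear_on_scal _ _ HL _ _ (smooth_on_mon (i - 1) j) 0%R 0%R I).
destruct i as [|i].
- rewrite INR_0; field; split; apply INR_fact_C_neq_0.
- replace (S i - 1)%nat with i by lia; unfold symbol.
  rewrite INR_fact_S, INR_S; field.
  repeat split; try apply INR_fact_C_neq_0; apply INR_S_neq_0.
Qed.

Lemma symbol_dy D i j : const_coeff_op D ->
  symbol (op_comp dy D) i j = match j with O => 0 | S j' => symbol D i j' end.
Proof.
intros HD; unfold symbol at 1, op_comp.
rewrite (dy_commute_on plane D open_plane HD _ (smooth_on_mon i j) 0%R 0%R I).
pose proof (cc_linear_on plane D open_plane HD) as HL.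
rewrite (linear_on_ext_r plane D _ (fun x y => INR j * mon i (j - 1) x y) HL
  (smooth_on_scal plane _ _ open_plane (smooth_on_mon i (j - 1)))
  (fun u v _ => dy_mon i j u v) 0%R 0%R I).
rewrite (linear_on_scal _ _ HL _ _ (smooth_on_mon i (j - 1)) 0%R 0%R I).
destruct j as [|j].
- rewrite INR_0; field; split; apply INR_fact_C_neq_0.
- replace (S j - 1)%nat with j by lia; unfold symbol.
  rewrite INR_fact_S, INR_S; field.
  repeat split; try apply INR_fact_C_neq_0; apply INR_S_neq_0.
Qed.

Lemma symbol_id i j :
  symbol op_id i j = if (Nat.eqb i 0 && Nat.eqb j 0)%bool then 1 else 0.
Proof.
unfold symbol, op_id.
destruct i as [|i]; [destruct j as [|j]|].
- unfold mon; simpl; field; apply C1_nz.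
- rewrite mon_origin by discriminate; simpl andb; cbv iota.
  field; split; apply INR_fact_C_neq_0.
- rewrite mon_origin by discriminate; simpl andb; cbv iota.
  field; split; apply INR_fact_C_neq_0.
Qed.

Lemma symbol_sum A n i j :
  symbol (op_sum A n) i j = Csum (S n) (fun k => symbol (A k) i j).
Proof.
unfold symbol, op_sum; rewrite sum_n_Csum.
unfold Cdiv; rewrite Cmult_comm, <- Csum_scal; apply Csum_ext; intros; ring.
Qed.

Lemma symbol_zero i j : symbol op_zero i j = 0.
Proof. unfold symbol, op_zero; field; split; apply INR_fact_C_neq_0. Qed.

Lemma symbol_opp A i j : symbol (op_opp A) i j = - symbol A i j.
Proof. unfold symbol, op_opp; field; split; apply INR_fact_C_neq_0. Qed.

Lemma symbol_two_dy_pow m i j :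
  symbol (op_pow (op_scal 2 dy) m) i j =
  if (Nat.eqb i 0 && Nat.eqb j m)%bool then 2 ^ m else 0.
Proof.
revert j; induction m as [|m IH]; intros j.
- exact (symbol_id i j).
- change (op_pow (op_scal 2 dy) (S m))
    with (op_scal 2 (op_comp dy (op_pow (op_scal 2 dy) m))).
  rewrite symbol_scal, symbol_dy by (apply cc_pow, cc_scal, cc_dy).
  destruct j as [|j]; [rewrite Bool.andb_false_r; ring|].
  rewrite IH; simpl Nat.eqb.
  destruct (Nat.eqb i 0 && Nat.eqb j m)%bool; [rewrite Cpow_S|]; ring.
Qed.

Lemma symbol_dxx_pow k B i j : const_coeff_op B ->
  symbol (op_comp (op_pow (op_opp (op_comp dx dx)) k) B) i j =
  if Nat.leb (2 * k) i then (- (1)) ^ k * symbol B (i - 2 * k) j else 0.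
Proof.
intros HB; revert i; induction k as [|k IH]; intros i.
- rewrite Nat.mul_0_r, Nat.sub_0_r.
  change (symbol B i j = 1 * symbol B i j); ring.
- set (E := op_comp (op_pow (op_opp (op_comp dx dx)) k) B).
  assert (HE : const_coeff_op E).
  { apply cc_comp; auto; apply cc_pow, cc_opp, cc_comp; apply cc_dx. }
  change (op_comp (op_pow (op_opp (op_comp dx dx)) (S k)) B)
    with (op_opp (op_comp dx (op_comp dx E))).
  rewrite symbol_opp, symbol_dx by (apply cc_comp; [apply cc_dx|exact HE]).
  destruct i as [|[|i]].
  + destruct (Nat.leb_spec (2 * S k) 0); [lia|ring].
  + rewrite symbol_dx by exact HE.
    destruct (Nat.leb_spec (2 * S k) 1); [lia|ring].
  + rewrite symbol_dx by exact HE; unfold E; rewrite IH.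
    destruct (Nat.leb_spec (2 * k) i), (Nat.leb_spec (2 * S k) (S (S i))); try lia.
    * replace (S (S i) - 2 * S k)%nat with (i - 2 * k)%nat by lia.
      rewrite Cpow_S; ring.
    * ring.
Qed.

(** The coefficient of dx^(2k) dy^(n-2k) in [gegenbauer_op mu n].  With the value 0
    for 2k > n the recurrences below hold without side conditions. *)
Definition gegenbauer_symbol (mu : C) (n k : nat) : C :=
  if Nat.leb (2 * k) n
  then rising mu (n - k) * 2 ^ (n - 2 * k) / (INR (fact (n - 2 * k)) * INR (fact k))
  else 0.

Lemma cc_gegenbauer mu n : const_coeff_op (gegenbauer_op mu n).
Proof.
unfold gegenbauer_op; destruct (n <? 0)%Z; [apply cc_zero|].
apply cc_sum; intros k; apply cc_scal, cc_comp; apply cc_pow.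
- apply cc_opp, cc_comp; apply cc_dx.
- apply cc_scal, cc_dy.
Qed.

(** The sign (-1)^k of the Gegenbauer coefficient cancels that of (- dx^2)^k. *)
Lemma symbol_gegenbauer_sum mu n i j :
  symbol (gegenbauer_op mu (Z.of_nat n)) i j =
  Csum (S (n / 2)) (fun k =>
    if (Nat.eqb i (2 * k) && Nat.eqb j (n - 2 * k))%bool then gegenbauer_symbol mu n k else 0).
Proof.
unfold gegenbauer_op.
destruct (Z.ltb_spec (Z.of_nat n) 0) as [H|_]; [lia|].
cbv zeta; rewrite Nat2Z.id, symbol_sum; apply Csum_ext; intros k Hk.
assert (Hkn : (2 * k <= n)%nat).
{ pose proof (Nat.Div0.mul_div_le n 2); lia. }
rewrite symbol_scal, symbol_dxx_pow by (apply cc_pow, cc_scal, cc_dy).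
destruct (Nat.eqb_spec i (2 * k)) as [->|Hi].
- rewrite Nat.leb_refl, symbol_two_dy_pow, Nat.sub_diag; cbn [Nat.eqb andb].
  destruct (Nat.eqb j (n - 2 * k)); [|ring].
  unfold gegenbauer_coeff, gegenbauer_symbol.
  destruct (Nat.leb_spec (2 * k) n); [|lia].
  transitivity ((- (1) * - (1)) ^ k * (rising mu (n - k) * 2 ^ (n - 2 * k) /
    (INR (fact (n - 2 * k)) * INR (fact k)))).
  + rewrite Cpow_mult_l; field; split; apply INR_fact_C_neq_0.
  + replace (- (1) * - (1)) with (RtoC 1) by ring; rewrite Cpow_1_l; ring.
- destruct (Nat.leb_spec (2 * k) i); [|simpl andb; cbv iota; ring].
  rewrite symbol_two_dy_pow.
  destruct (Nat.eqb_spec (i - 2 * k) 0); [lia|]; simpl andb; cbv iota; ring.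
Qed.

Lemma symbol_gegenbauer mu n k j : (2 * k + j = n)%nat ->
  symbol (gegenbauer_op mu (Z.of_nat n)) (2 * k) j = gegenbauer_symbol mu n k.
Proof.
intros H; rewrite symbol_gegenbauer_sum, (Csum_single _ k).
- rewrite Nat.eqb_refl; destruct (Nat.eqb_spec j (n - 2 * k)); [reflexivity|lia].
- apply Nat.lt_succ_r, Nat.div_le_lower_bound; lia.
- intros i Hi; destruct (Nat.eqb_spec (2 * k) (2 * i)); [lia|reflexivity].
Qed.

Lemma symbol_gegenbauer_0 mu n i j :
  (i + j <> n)%nat \/ Nat.Odd i -> symbol (gegenbauer_op mu (Z.of_nat n)) i j = 0.
Proof.
intros H; rewrite symbol_gegenbauer_sum; apply Csum_0; intros k Hk.
pose proof (Nat.Div0.mul_div_le n 2).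
destruct (Nat.eqb_spec i (2 * k)); [|reflexivity].
destruct (Nat.eqb_spec j (n - 2 * k)); [|reflexivity].
destruct H as [H|[m H]]; lia.
Qed.

Lemma rising_S_l mu n : rising mu (S n) = mu * rising (mu + 1) n.
Proof.
induction n as [|n IH].
- cbn [rising]; rewrite INR_0; ring.
- change (rising mu (S (S n))) with (rising mu (S n) * (mu + INR (S n))).
  rewrite IH; cbn [rising]; rewrite INR_S; ring.
Qed.

Lemma gegenbauer_symbol_rec mu n k :
  4 * (INR k + 1) * (mu + INR n - INR k - 1) * gegenbauer_symbol mu n (S k) =
  (INR n - 2 * INR k) * (INR n - 2 * INR k - 1) * gegenbauer_symbol mu n k.
Proof.
unfold gegenbauer_symbol.
destruct (Nat.leb_spec (2 * S k) n) as [H|H].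
- destruct (Nat.leb_spec (2 * k) n) as [_|?]; [|lia].
  assert (E : exists m, n = (2 + 2 * k + m)%nat) by (exists (n - 2 - 2 * k)%nat; lia).
  destruct E as [m ->].
  replace (2 + 2 * k + m - S k)%nat with (S (k + m)) by lia.
  replace (2 + 2 * k + m - k)%nat with (S (S (k + m))) by lia.
  replace (2 + 2 * k + m - 2 * S k)%nat with m by lia.
  replace (2 + 2 * k + m - 2 * k)%nat with (S (S m)) by lia.
  change (rising mu (S (S (k + m)))) with (rising mu (S (k + m)) * (mu + INR (S (k + m)))).
  assert (EN : RtoC (INR (2 + 2 * k + m)) = 2 + 2 * INR k + INR m).
  { rewrite !plus_INR, mult_INR, !RtoC_plus, RtoC_mult.
    replace (INR 2) with 2%R by (simpl; ring); reflexivity. }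
  rewrite EN, !INR_fact_S, !INR_S, plus_INR, RtoC_plus, !Cpow_S.
  field; repeat split; try apply INR_fact_C_neq_0; try apply INR_S_neq_0.
  rewrite <- INR_S; apply INR_S_neq_0.
- destruct (Nat.leb_spec (2 * k) n) as [H1|H1]; [|ring].
  assert (E : n = (2 * k)%nat \/ n = S (2 * k)) by lia.
  destruct E as [-> | ->]; rewrite ?INR_S, mult_INR, RtoC_mult;
  (replace (INR 2) with 2%R by (simpl; ring)); ring.
Qed.

(** Removes the parameter lam + 3/2 in favour of lam + 1/2. *)
Lemma gegenbauer_symbol_shift mu n k :
  2 * mu * gegenbauer_symbol (mu + 1) n k = (INR (S n) - 2 * INR k) * gegenbauer_symbol mu (S n) k.
Proof.
unfold gegenbauer_symbol.
destruct (Nat.leb_spec (2 * k) n) as [H|H].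
- destruct (Nat.leb_spec (2 * k) (S n)) as [_|?]; [|lia].
  assert (E : exists m, n = (2 * k + m)%nat) by (exists (n - 2 * k)%nat; lia).
  destruct E as [m ->].
  replace (S (2 * k + m) - k)%nat with (S (k + m)) by lia.
  replace (2 * k + m - k)%nat with (k + m)%nat by lia.
  replace (2 * k + m - 2 * k)%nat with m by lia.
  replace (S (2 * k + m) - 2 * k)%nat with (S m) by lia.
  rewrite rising_S_l, INR_S, plus_INR, mult_INR, RtoC_plus, RtoC_mult, INR_fact_S, Cpow_S.
  replace (INR 2) with 2%R by (simpl; ring).
  field; repeat split; try apply INR_fact_C_neq_0; apply INR_S_neq_0.
- destruct (Nat.leb_spec (2 * k) (S n)) as [H1|H1]; [|ring].
  replace (S n) with (2 * k)%nat by lia.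
  rewrite mult_INR, RtoC_mult; replace (INR 2) with 2%R by (simpl; ring); ring.
Qed.

Lemma gegenbauer_symbol_out mu n k : (n < 2 * k)%nat -> gegenbauer_symbol mu n k = 0.
Proof. intros H; unfold gegenbauer_symbol; destruct (Nat.leb_spec (2 * k) n); [lia|reflexivity]. Qed.

(** * The Bessel equation in real coordinates *)

(** The relation psi = V phi for phi homogeneous of degree n, where
      V = - 2 lam x + 2 eps i y - (x^2 - y^2) d_x - 2 x y d_y,
    which in complex coordinates is
      (eps - lam) z + (- eps - lam) zb - z^2 d_z - zb^2 d_zb.
    It is generated by the monomials in x and y, so a linear functional is
    controlled by its values there. *)
Inductive special_conformal (lam eps : C) : nat -> (R -> R -> C) -> (R -> R -> C) -> Prop :=
| special_conformal_mon i j : special_conformal lam eps (i + j) (mon i j)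
    (fun x y => - (2 * lam + INR i + 2 * INR j) * mon (S i) j x y +
                2 * eps * Ci * mon i (S j) x y +
                INR i * mon (i - 1) (S (S j)) x y)
| special_conformal_lin n a b f g f' g' :
    special_conformal lam eps n f f' -> special_conformal lam eps n g g' ->
    special_conformal lam eps n (fun x y => a * f x y + b * g x y)
                     (fun x y => a * f' x y + b * g' x y)
| special_conformal_ext n f g f' g' : special_conformal lam eps n f f' ->
    (forall x y, f x y = g x y) -> (forall x y, f' x y = g' x y) ->
    special_conformal lam eps n g g'.

Lemma mon_mult_x i j x y : mon (S i) j x y = x * mon i j x y.
Proof. unfold mon; rewrite Cpow_S; ring. Qed.

Lemma mon_mult_y i j x y : mon i (S j) x y = y * mon i j x y.
Proof. unfold mon; rewrite Cpow_S; ring. Qed.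

Lemma special_conformal_mult_x lam eps n f f' : special_conformal lam eps n f f' ->
  special_conformal lam eps (S n) (fun x y => x * f x y)
    (fun x y => x * f' x y - (x ^ 2 - y ^ 2) * f x y).
Proof.
induction 1 as [i j|n a b f g f' g' _ IF _ IG|n f g f' g' _ IF E E'].
- eapply special_conformal_ext; [exact (special_conformal_mon lam eps (S i) j)| |].
  + intros x y; apply mon_mult_x.
  + intros x y; rewrite !mon_mult_x, !mon_mult_y, INR_S.
    destruct i as [|i].
    * rewrite INR_0; simpl Nat.sub; ring.
    * replace (S (S i) - 1)%nat with (S i) by lia.
      replace (S i - 1)%nat with i by lia; rewrite !mon_mult_x, INR_S; ring.
- eapply special_conformal_ext; [exact (special_conformal_lin lam eps _ a b _ _ _ _ IF IG)| |];
  intros x y; cbv beta; ring.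
- eapply special_conformal_ext; [exact IF| |]; intros x y; cbv beta; now rewrite ?E, ?E'.
Qed.

Lemma special_conformal_mult_y lam eps n f f' : special_conformal lam eps n f f' ->
  special_conformal lam eps (S n) (fun x y => y * f x y)
    (fun x y => y * f' x y - (2 * x * y) * f x y).
Proof.
induction 1 as [i j|n a b f g f' g' _ IF _ IG|n f g f' g' _ IF E E'].
- eapply special_conformal_ext.
  + rewrite <- Nat.add_succ_r; exact (special_conformal_mon lam eps i (S j)).
  + intros x y; apply mon_mult_y.
  + intros x y; rewrite !mon_mult_x, !mon_mult_y, INR_S; ring.
- eapply special_conformal_ext; [exact (special_conformal_lin lam eps _ a b _ _ _ _ IF IG)| |];
  intros x y; cbv beta; ring.
- eapply special_conformal_ext; [exact IF| |]; intros x y; cbv beta; now rewrite ?E, ?E'.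
Qed.

Lemma pair_RtoC (x y : R) : (x, y) = x + Ci * y.
Proof. unfold RtoC, Ci, Cmult, Cplus; simpl; f_equal; ring. Qed.

Lemma zmon_S_l k l x y : zmon 0 (S k) l x y = (x + Ci * y) * zmon 0 k l x y.
Proof. unfold zmon; rewrite Cpow_S, !pair_RtoC; ring. Qed.

Lemma zmon_S_r k l x y : zmon 0 k (S l) x y = (x - Ci * y) * zmon 0 k l x y.
Proof. unfold zmon; rewrite Cpow_S, !pair_RtoC, RtoC_opp; ring. Qed.

(** V (s phi) = s V phi - s^2 phi for s = z and for s = zb, as V is a derivation up
    to a multiplication operator. *)
Lemma special_conformal_zmon lam eps k l :
  special_conformal lam eps (k + l) (zmon 0 k l)
    (fun x y => (eps - lam - INR k) * zmon 0 (S k) l x y +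
                (- eps - lam - INR l) * zmon 0 k (S l) x y).
Proof.
assert (step : forall (s : C) n f f', s * s = 1 -> special_conformal lam eps n f f' ->
  special_conformal lam eps (S n) (fun x y => (x + s * Ci * y) * f x y)
    (fun x y => (x + s * Ci * y) * f' x y -
                (x + s * Ci * y) * (x + s * Ci * y) * f x y)).
{ intros s n f f' Hs H.
  eapply special_conformal_ext.
  - exact (special_conformal_lin lam eps _ 1 (s * Ci) _ _ _ _ (special_conformal_mult_x _ _ _ _ _ H)
             (special_conformal_mult_y _ _ _ _ _ H)).
  - intros x y; cbv beta; ring.
  - intros x y; cbv beta.
    transitivity ((x + s * Ci * y) * f' x y -
      (x * x + 2 * s * Ci * x * y + - (1) * (y * y)) * f x y); [ring|].
    rewrite <- Ci_sqr.
    transitivity ((x + s * Ci * y) * f' x y -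
      (x * x + 2 * s * Ci * x * y + 1 * Ci * Ci * (y * y)) * f x y); [ring|].
    rewrite <- Hs; ring. }
induction k as [|k IHk].
- induction l as [|l IHl].
  + eapply special_conformal_ext; [exact (special_conformal_mon lam eps 0 0)| |].
    * intros x y; cbv beta; unfold mon, zmon; simpl; ring.
    * intros x y; cbv beta; rewrite zmon_S_l, zmon_S_r, INR_0, mon_mult_x, mon_mult_y.
      unfold mon, zmon; simpl; ring.
  + eapply special_conformal_ext; [exact (step (- (1)) _ _ _ ltac:(ring) IHl)| |].
    * intros x y; cbv beta; rewrite zmon_S_r; ring.
    * intros x y; cbv beta; rewrite !zmon_S_l, !zmon_S_r, !INR_S; ring.
- eapply special_conformal_ext; [exact (step 1 _ _ _ ltac:(ring) IHk)| |].
  + intros x y; cbv beta; rewrite zmon_S_l; ring.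
  + intros x y; cbv beta; rewrite !zmon_S_l, !zmon_S_r, !INR_S; ring.
Qed.

Lemma special_conformal_smooth lam eps n f f' : special_conformal lam eps n f f' ->
  smooth_on plane f /\ smooth_on plane f'.
Proof.
pose proof open_plane as HO.
induction 1 as [i j|n a b f g f' g' _ [F F'] _ [G G']|n f g f' g' _ [F F'] E E'].
- split; [apply smooth_on_mon|].
  apply (smooth_on_plus plane (fun x y => - (2 * lam + INR i + 2 * INR j) * mon (S i) j x y +
                2 * eps * Ci * mon i (S j) x y)
      (fun x y => INR i * mon (i - 1) (S (S j)) x y)); auto;
  [apply smooth_on_plus; auto|]; apply smooth_on_scal; auto using smooth_on_mon.
- split; apply smooth_on_plus; auto using smooth_on_scal.
- split; [apply (smooth_on_ext plane f)|apply (smooth_on_ext plane f')]; auto;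
  intros x y _; auto.
Qed.

(** Up to the factor i! j!, the value at 0 of the operator with coefficients d
    applied to V(x^i y^j). *)
Definition bessel_xy (lam eps : C) (d : nat -> nat -> C) (i j : nat) : C :=
  - (2 * lam + INR i + 2 * INR j) * (INR i + 1) * d (S i) j +
  2 * eps * Ci * (INR j + 1) * d i (S j) +
  match i with O => RtoC 0 | S i' => (INR j + 1) * (INR j + 2) * d i' (S (S j)) end.

Lemma bessel_xy_special_conformal lam eps a P n f f' : const_coeff_op P ->
  homogeneous a (symbol P) ->
  (forall i j, (S (i + j) = a)%nat -> bessel_xy lam eps (symbol P) i j = 0) ->
  special_conformal lam eps n f f' ->
  (n <> a -> P f 0%R 0%R = 0) /\ (S n = a -> P f' 0%R 0%R = 0).
Proof.
intros HP Ha Hs.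
pose proof open_plane as HO; pose proof (cc_linear_on plane P HO HP) as HL.
induction 1 as [i j|n c b f g f' g' Hf [F F'] Hg [G G']|n f g f' g' Hf [F F'] E E'].
- split; intros H.
  + rewrite symbol_eq, Ha by exact H; ring.
  + set (h := fun x y => - (2 * lam + INR i + 2 * INR j) * mon (S i) j x y +
                2 * eps * Ci * mon i (S j) x y).
    assert (Sh : smooth_on plane h).
    { apply smooth_on_plus; auto; apply smooth_on_scal; auto using smooth_on_mon. }
    change (P (fun x y => h x y + INR i * mon (i - 1) (S (S j)) x y) 0%R 0%R = 0).
    rewrite (linear_on_plus _ _ HL h (fun x y => INR i * mon (i - 1) (S (S j)) x y) Sh
      (smooth_on_scal plane _ _ HO (smooth_on_mon _ _)) 0%R 0%R I).
    rewrite (linear_on_scal _ _ HL _ _ (smooth_on_mon (i - 1) (S (S j))) 0%R 0%R I).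
    unfold h; rewrite (linear_on_comb plane P _ _ _ _ HO HL (smooth_on_mon (S i) j)
      (smooth_on_mon i (S j)) 0%R 0%R I).
    rewrite !symbol_eq.
    transitivity (bessel_xy lam eps (symbol P) i j * (INR (fact i) * INR (fact j)));
      [|rewrite Hs by exact H; ring].
    unfold bessel_xy; destruct i as [|i].
    * rewrite !INR_fact_S, INR_0, ?INR_S; ring.
    * replace (S i - 1)%nat with i by lia; rewrite !INR_fact_S, !INR_S; ring.
- destruct (special_conformal_smooth _ _ _ _ _ Hf), (special_conformal_smooth _ _ _ _ _ Hg).
  split; intros Hn; rewrite (linear_on_comb plane P) by (auto; exact I).
  + rewrite F, G by exact Hn; ring.
  + rewrite F', G' by exact Hn; ring.
- destruct (special_conformal_smooth _ _ _ _ _ Hf).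
  split; intros Hn.
  + rewrite <- (F Hn); apply (linear_on_ext_r plane P); auto; [|exact I].
    now intros x y _.
  + rewrite <- (F' Hn); apply (linear_on_ext_r plane P); auto; [|exact I].
    now intros x y _.
Qed.

(** The condition that P(V phi) vanishes at 0 for every homogeneous phi of degree
    a - 1 does not refer to coordinates.  On the monomials x^i y^j it is
    [bessel_xy], and on z^k zb^l it is [bessel]. *)
Theorem bessel_of_bessel_xy lam eps a P N p : const_coeff_op P -> expands P N p ->
  homogeneous a (symbol P) ->
  (forall i j, (S (i + j) = a)%nat -> bessel_xy lam eps (symbol P) i j = 0) ->
  homogeneous a p /\
  forall i j, (S (i + j) = a)%nat -> bessel (eps - lam) (- eps - lam) p i j = 0.
Proof.
intros HP Hp Ha Hs.
pose proof (fun k l => bessel_xy_special_conformal lam eps a P _ _ _ HP Ha Hs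
  (special_conformal_zmon lam eps k l)) as K.
split; intros k l Hkl; destruct (K k l) as [K1 K2].
- specialize (K1 Hkl); rewrite (expands_zmon P N p 0 k l Hp) in K1.
  apply (Cmult_cancel_l (INR (fact k) * INR (fact l))); [apply fact_C_neq_0|].
  rewrite Cmult_comm, K1; ring.
- specialize (K2 Hkl).
  rewrite (linear_on_comb plane P) in K2; auto using open_plane, smooth_on_zmon, cc_linear_on;
    [|exact I].
  rewrite !(expands_zmon P N p 0 _ _ Hp), !INR_fact_S in K2.
  apply (Cmult_cancel_l (INR (fact k) * INR (fact l))); [apply fact_C_neq_0|].
  rewrite Cmult_0_r, <- K2; unfold bessel; rewrite !INR_S; ring.
Qed.

Lemma cc_laplacian : const_coeff_op laplacian.
Proof. apply cc_add; apply cc_comp; (apply cc_dx || apply cc_dy). Qed.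

Lemma cc_D1 lam a : const_coeff_op (D1 lam a).
Proof.
unfold D1; destruct (a =? 0)%nat; [apply cc_id|].
apply cc_scal, cc_comp; [apply cc_dx|apply cc_gegenbauer].
Qed.

Lemma cc_D2 lam a : const_coeff_op (D2 lam a).
Proof.
unfold D2; destruct (a =? 0)%nat; [apply cc_zero|].
apply cc_add; apply cc_scal, cc_comp; auto using cc_dy, cc_gegenbauer, cc_laplacian.
Qed.

Lemma symbol_D1 lam n i j :
  symbol (D1 lam (S n)) i j = INR (S n) * (2 * lam + INR n) *
    match i with O => 0 | S i' => symbol (gegenbauer_op (lam + 1 / 2) (Z.of_nat n)) i' j end.
Proof.
unfold D1; simpl Nat.eqb; cbv iota.
replace (Z.of_nat (S n) - 1)%Z with (Z.of_nat n) by lia.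
rewrite symbol_scal, symbol_dx by apply cc_gegenbauer.
rewrite INR_S; f_equal; ring.
Qed.

Lemma symbol_laplacian D i j : const_coeff_op D ->
  symbol (op_comp laplacian D) i j =
  match i with S (S i') => symbol D i' j | _ => RtoC 0 end +
  match j with S (S j') => symbol D i j' | _ => RtoC 0 end.
Proof.
intros HD.
change (op_comp laplacian D)
  with (op_add (op_comp dx (op_comp dx D)) (op_comp dy (op_comp dy D))).
rewrite symbol_add, symbol_dx, symbol_dy by (apply cc_comp; auto using cc_dx, cc_dy).
f_equal.
- destruct i as [|i]; auto; now rewrite symbol_dx.
- destruct j as [|j]; auto; now rewrite symbol_dy.
Qed.

Lemma symbol_D1_0 lam n i j : (i + j <> S n)%nat \/ Nat.Even i ->
  symbol (D1 lam (S n)) i j = 0.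
Proof.
intros H; rewrite symbol_D1; destruct i as [|i]; [ring|].
rewrite symbol_gegenbauer_0; [ring|].
destruct H as [H|H]; [left; lia|right; now apply Nat.Even_succ].
Qed.

Lemma symbol_D1_odd lam n k j : (2 * k + j = n)%nat ->
  symbol (D1 lam (S n)) (S (2 * k)) j =
  (INR n + 1) * (2 * lam + INR n) * gegenbauer_symbol (lam + 1 / 2) n k.
Proof. intros H; rewrite symbol_D1, symbol_gegenbauer, INR_S; auto. Qed.

Lemma symbol_D2 lam n i j :
  symbol (D2 lam (S n)) i j =
  (2 * lam ^ 2 + 2 * INR n * lam + (INR n + 1) * INR n) *
    match j with O => 0 | S j' => symbol (gegenbauer_op (lam + 1 / 2) (Z.of_nat n)) i j' end +
  (lam - 1) * (2 * lam + 1) *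
    (match i with S (S i') =>
       symbol (gegenbauer_op (lam + 3 / 2) (Z.of_nat n - 1)) i' j | _ => RtoC 0 end +
     match j with S (S j') =>
       symbol (gegenbauer_op (lam + 3 / 2) (Z.of_nat n - 1)) i j' | _ => RtoC 0 end).
Proof.
unfold D2; simpl Nat.eqb; cbv iota.
replace (Z.of_nat (S n) - 1)%Z with (Z.of_nat n) by lia.
replace (Z.of_nat (S n) - 2)%Z with (Z.of_nat n - 1)%Z by lia.
rewrite symbol_add, !symbol_scal, symbol_dy, symbol_laplacian by apply cc_gegenbauer.
rewrite INR_S; f_equal; f_equal; ring.
Qed.

Lemma symbol_gegenbauer_pred_0 mu n i j :
  (i + j <> n - 1)%nat \/ Nat.Odd i \/ n = O ->
  symbol (gegenbauer_op mu (Z.of_nat n - 1)) i j = 0.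
Proof.
intros H; destruct n as [|n].
- apply symbol_zero.
- replace (Z.of_nat (S n) - 1)%Z with (Z.of_nat n) by lia.
  apply symbol_gegenbauer_0; destruct H as [H|[H|H]]; [left; lia|now right|lia].
Qed.

Lemma symbol_D2_0 lam n i j : (i + j <> S n)%nat \/ Nat.Odd i ->
  symbol (D2 lam (S n)) i j = 0.
Proof.
intros H; rewrite symbol_D2.
assert (E1 : match j with O => RtoC 0 | S j' =>
  symbol (gegenbauer_op (lam + 1 / 2) (Z.of_nat n)) i j' end = 0).
{ destruct j as [|j]; auto; apply symbol_gegenbauer_0.
  destruct H as [H|H]; [left; lia|now right]. }
assert (E2 : match i with S (S i') =>
  symbol (gegenbauer_op (lam + 3 / 2) (Z.of_nat n - 1)) i' j | _ => RtoC 0 end = 0).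
{ destruct i as [|[|i]]; auto; apply symbol_gegenbauer_pred_0.
  destruct H as [H|H]; [|right; left; destruct H as [m H]; exists (m - 1)%nat; lia].
  destruct n; [right; now right|left; lia]. }
assert (E3 : match j with S (S j') =>
  symbol (gegenbauer_op (lam + 3 / 2) (Z.of_nat n - 1)) i j' | _ => RtoC 0 end = 0).
{ destruct j as [|[|j]]; auto; apply symbol_gegenbauer_pred_0.
  destruct H as [H|H]; [|right; now left].
  destruct n; [right; now right|left; lia]. }
rewrite E1, E2, E3; ring.
Qed.

Lemma symbol_gegenbauer_pred lam n k j : (2 * k + j = n - 1)%nat -> n <> O ->
  (2 * lam + 1) * symbol (gegenbauer_op (lam + 3 / 2) (Z.of_nat n - 1)) (2 * k) j =
  (INR n - 2 * INR k) * gegenbauer_symbol (lam + 1 / 2) n k.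
Proof.
intros H Hn; destruct n as [|n]; [now elim Hn|].
replace (Z.of_nat (S n) - 1)%Z with (Z.of_nat n) by lia.
rewrite symbol_gegenbauer by lia; rewrite <- gegenbauer_symbol_shift.
replace (lam + 1 / 2 + 1) with (lam + 3 / 2) by (field; exact C2_neq_0).
f_equal; field; exact C2_neq_0.
Qed.

(** This is (n - 2k + 2) times the coefficient of index k - 1, and 0 when there is
    none. *)
Definition gegenbauer_symbol_prev (mu : C) (n k : nat) : C :=
  match k with O => 0 | S k' => (INR n - 2 * INR k') * gegenbauer_symbol mu n k' end.

(** By [gegenbauer_symbol_shift], the factor 2 lam + 1 in D2 turns the coefficients
    with parameter lam + 3/2 into coefficients with parameter lam + 1/2. *)
Lemma symbol_D2_even lam n k j : (2 * k + j = S n)%nat ->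
  symbol (D2 lam (S n)) (2 * k) j =
  (2 * lam ^ 2 + 2 * INR n * lam + (INR n + 1) * INR n) * gegenbauer_symbol (lam + 1 / 2) n k +
  (lam - 1) * ((INR n - 2 * INR k) * gegenbauer_symbol (lam + 1 / 2) n k +
    gegenbauer_symbol_prev (lam + 1 / 2) n k).
Proof.
intros H; rewrite symbol_D2.
assert (E1 : match j with O => RtoC 0 | S j' =>
  symbol (gegenbauer_op (lam + 1 / 2) (Z.of_nat n)) (2 * k) j' end =
  gegenbauer_symbol (lam + 1 / 2) n k).
{ destruct j as [|j]; [symmetry; apply gegenbauer_symbol_out; lia|apply symbol_gegenbauer; lia]. }
assert (E2 : (2 * lam + 1) * match (2 * k)%nat with S (S i') =>
  symbol (gegenbauer_op (lam + 3 / 2) (Z.of_nat n - 1)) i' j | _ => RtoC 0 end =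
  gegenbauer_symbol_prev (lam + 1 / 2) n k).
{ unfold gegenbauer_symbol_prev; destruct k as [|k]; [simpl Nat.mul; cbv iota; ring|].
  replace (2 * S k)%nat with (S (S (2 * k))) by lia; cbv iota.
  apply symbol_gegenbauer_pred; lia. }
assert (E3 : (2 * lam + 1) * match j with S (S j') =>
  symbol (gegenbauer_op (lam + 3 / 2) (Z.of_nat n - 1)) (2 * k) j' | _ => RtoC 0 end =
  (INR n - 2 * INR k) * gegenbauer_symbol (lam + 1 / 2) n k).
{ destruct j as [|[|j]].
  - rewrite gegenbauer_symbol_out by lia; ring.
  - replace n with (2 * k)%nat by lia; rewrite mult_INR, RtoC_mult.
    replace (INR 2) with 2%R by (simpl; ring); ring.
  - apply symbol_gegenbauer_pred; lia. }
rewrite E1, <- E2, <- E3; ring.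
Qed.

(** * Existence and uniqueness *)

Lemma gegenbauer_symbol_prev_rec lam n k :
  (INR n - 2 * INR k + 1) * gegenbauer_symbol_prev (lam + 1 / 2) n k =
  2 * INR k * (2 * lam + 1 + 2 * INR n - 2 * INR k) * gegenbauer_symbol (lam + 1 / 2) n k.
Proof.
destruct k as [|k]; unfold gegenbauer_symbol_prev; [rewrite INR_0; ring|].
pose proof (gegenbauer_symbol_rec (lam + 1 / 2) n k) as H; rewrite INR_S.
transitivity ((INR n - 2 * INR k) * (INR n - 2 * INR k - 1) * gegenbauer_symbol (lam + 1 / 2) n k);
  [ring|].
rewrite <- H; field; exact C2_neq_0.
Qed.

(** D1 is odd and D2 is even in dx, so for each parity of i only one coefficient
    of each contributes per term.  The recurrences express the neighbouring
    Gegenbauer coefficients through the one of index k, and what remains is a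
    polynomial identity in lam, k and j. *)
Lemma bessel_xy_D lam eps n i j : eps * eps = 1 -> (i + j = n)%nat ->
  bessel_xy lam eps
    (fun i j => symbol (D1 lam (S n)) i j - eps * Ci * symbol (D2 lam (S n)) i j) i j = 0.
Proof.
intros He Hij; unfold bessel_xy.
destruct (Nat.Even_or_Odd i) as [[k ->]|[k Hk]].
- rewrite (symbol_D1_odd lam n k j) by lia.
  rewrite (symbol_D2_0 lam n (S (2 * k)) j) by (right; exists k; lia).
  rewrite (symbol_D1_0 lam n (2 * k) (S j)) by (right; exists k; lia).
  rewrite (symbol_D2_even lam n k (S j)) by lia.
  assert (E : match (2 * k)%nat with O => RtoC 0 | S i' => (INR j + 1) * (INR j + 2) *
    (symbol (D1 lam (S n)) i' (S (S j)) - eps * Ci * symbol (D2 lam (S n)) i' (S (S j))) end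
    = (INR j + 1) * (INR n + 1) * (2 * lam + INR n) * gegenbauer_symbol_prev (lam + 1 / 2) n k).
  { destruct k as [|k]; [simpl Nat.mul; cbv iota; unfold gegenbauer_symbol_prev; ring|].
    replace (2 * S k)%nat with (S (S (2 * k))) by lia; cbv iota.
    rewrite (symbol_D1_odd lam n k) by lia.
    rewrite (symbol_D2_0 lam n (S (2 * k))) by (right; exists k; lia).
    unfold gegenbauer_symbol_prev; replace (RtoC (INR n)) with (2 * INR k + 2 + INR j); [ring|].
    rewrite <- Hij, plus_INR, mult_INR, RtoC_plus, RtoC_mult.
    replace (INR 2) with 2%R by (simpl; ring); rewrite INR_S; ring. }
  rewrite E; clear E.
  assert (EN : RtoC (INR n) = 2 * INR k + INR j).
  { rewrite <- Hij, plus_INR, mult_INR, RtoC_plus, RtoC_mult.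
    now replace (INR 2) with 2%R by (simpl; ring). }
  pose proof (gegenbauer_symbol_prev_rec lam n k) as HR.
  rewrite mult_INR, RtoC_mult; replace (INR 2) with 2%R by (simpl; ring).
  revert HR; generalize (gegenbauer_symbol_prev (lam + 1 / 2) n k) (gegenbauer_symbol (lam + 1 / 2) n k).
  rewrite EN; generalize (RtoC (INR k)) (RtoC (INR j)); intros K J gp g HR.
  set (A := 2 * lam ^ 2 + 2 * (2 * K + J) * lam + (2 * K + J + 1) * (2 * K + J)).
  transitivity (- (2 * lam + 2 * K + 2 * J) * (2 * K + 1) *
      ((2 * K + J + 1) * (2 * lam + (2 * K + J)) * g) -
    2 * (eps * eps) * (Ci * Ci) * (J + 1) * (A * g + (lam - 1) * (J * g + gp)) +
    (J + 1) * (2 * K + J + 1) * (2 * lam + (2 * K + J)) * gp); [ring|].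
  rewrite He, Ci_sqr.
  transitivity (- (2 * lam + 2 * K + 2 * J) * (2 * K + 1) *
      ((2 * K + J + 1) * (2 * lam + (2 * K + J)) * g) +
    2 * (J + 1) * (A + (lam - 1) * J) * g +
    (2 * (lam - 1) + (2 * K + J + 1) * (2 * lam + (2 * K + J))) *
      ((2 * K + J - 2 * K + 1) * gp)); [ring|].
  rewrite HR; unfold A; ring.
- replace (2 * k + 1)%nat with (S (2 * k)) in Hk by lia; subst i.
  replace (symbol (D1 lam (S n)) (S (S (2 * k))) j) with (RtoC 0)
    by (symmetry; apply symbol_D1_0; right; exists (S k); lia).
  replace (symbol (D2 lam (S n)) (S (S (2 * k))) j)
    with (symbol (D2 lam (S n)) (2 * S k) j) by (f_equal; lia).
  rewrite (symbol_D2_even lam n (S k) j) by lia.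
  rewrite (symbol_D1_odd lam n k (S j)) by lia.
  rewrite (symbol_D2_0 lam n (S (2 * k)) (S j)) by (right; exists k; lia).
  rewrite (symbol_D1_0 lam n (2 * k) (S (S j))) by (right; exists k; lia).
  rewrite (symbol_D2_even lam n k (S (S j))) by lia.
  assert (EN : RtoC (INR n) = 2 * INR k + 1 + INR j).
  { rewrite <- Hij, plus_INR, RtoC_plus, INR_S, mult_INR, RtoC_mult.
    now replace (INR 2) with 2%R by (simpl; ring). }
  pose proof (gegenbauer_symbol_prev_rec lam n k) as HR.
  pose proof (gegenbauer_symbol_prev_rec lam n (S k)) as HR1; unfold gegenbauer_symbol_prev in HR1 at 1.
  replace (gegenbauer_symbol_prev (lam + 1 / 2) n (S k))
    with ((INR n - 2 * INR k) * gegenbauer_symbol (lam + 1 / 2) n k) by reflexivity.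
  rewrite !INR_S, mult_INR, RtoC_mult; replace (INR 2) with 2%R by (simpl; ring).
  rewrite !INR_S in HR1; revert HR HR1.
  generalize (gegenbauer_symbol_prev (lam + 1 / 2) n k) (gegenbauer_symbol (lam + 1 / 2) n k)
    (gegenbauer_symbol (lam + 1 / 2) n (S k)).
  rewrite EN; generalize (RtoC (INR k)) (RtoC (INR j)); intros K J gp g g1 HR HR1.
  set (N := 2 * K + 1 + J) in *.
  set (A := 2 * lam ^ 2 + 2 * N * lam + (N + 1) * N).
  transitivity (eps * Ci * (
    (A + (lam - 1) * (N - 2 * (K + 1))) *
       (2 * (K + 1) * (2 * lam + 1 + 2 * N - 2 * (K + 1)) * g1) +
    (2 * lam + 2 * K + 1 + 2 * J) * (2 * K + 2) * (lam - 1) * (N - 2 * K) * g +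
    2 * (J + 1) * (N + 1) * (2 * lam + N) * g -
    (J + 1) * (J + 2) * (A + (lam - 1) * (N - 2 * K)) * g -
    (J + 1) * (lam - 1) * ((N - 2 * K + 1) * gp))); [unfold N; ring|].
  rewrite HR, <- HR1; unfold A, N; ring.
Qed.

Lemma bessel_xy_symbol lam eps c P Q i j :
  (forall i j, symbol P i j = c * Q i j) ->
  bessel_xy lam eps Q i j = 0 -> bessel_xy lam eps (symbol P) i j = 0.
Proof.
intros H HQ; transitivity (c * bessel_xy lam eps Q i j); [|rewrite HQ; ring].
unfold bessel_xy; rewrite !H; destruct i as [|i]; [|rewrite H]; ring.
Qed.

Lemma symbol_chiral_part eps E1 E2 i j :
  symbol (chiral_part eps E1 E2) i j = / 2 * (symbol E1 i j - eps * Ci * symbol E2 i j).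
Proof. unfold chiral_part; rewrite symbol_scal, symbol_add, symbol_scal; ring. Qed.

Lemma cc_chiral_part_D eps lam a :
  const_coeff_op (chiral_part eps (D1 lam a) (D2 lam a)).
Proof. apply cc_chiral_part; [apply cc_D1|apply cc_D2]. Qed.

Lemma bessel_D lam eps a N p : eps * eps = 1 ->
  expands (chiral_part eps (D1 lam a) (D2 lam a)) N p ->
  homogeneous a p /\
  forall i j, (S (i + j) = a)%nat -> bessel (eps - lam) (- eps - lam) p i j = 0.
Proof.
intros He Hp.
apply (bessel_of_bessel_xy lam eps a (chiral_part eps (D1 lam a) (D2 lam a)) N);
  [apply cc_chiral_part_D|exact Hp| |].
- intros i j Hij; rewrite symbol_chiral_part; destruct a as [|n].
  + change (D1 lam 0) with op_id; change (D2 lam 0) with op_zero.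
    rewrite symbol_id, symbol_zero.
    destruct i as [|i], j as [|j]; [lia| | |]; simpl andb; cbv iota; ring.
  + rewrite symbol_D1_0, symbol_D2_0 by auto; ring.
- intros i j Hij; destruct a as [|n]; [lia|].
  apply (bessel_xy_symbol lam eps (/ 2) _ (fun i j =>
    symbol (D1 lam (S n)) i j - eps * Ci * symbol (D2 lam (S n)) i j)).
  + intros; apply symbol_chiral_part.
  + apply bessel_xy_D; auto; lia.
Qed.

Lemma rising_neq_0 mu n : (forall m, mu + INR m <> 0) -> rising mu n <> 0.
Proof.
intros H; induction n as [|n IH]; cbn [rising]; [apply C1_nz|].
apply Cmult_neq_0; auto.
Qed.

(** For a > 0 look at dx dy^(a-1), which does not occur in D2. *)
Lemma symbol_chiral_part_neq_0 lam eps a : (forall n : nat, 2 * lam <> - INR n) ->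
  exists i j, symbol (chiral_part eps (D1 lam a) (D2 lam a)) i j <> 0.
Proof.
intros Hl; destruct a as [|n].
- exists O, O; rewrite symbol_chiral_part.
  change (D1 lam 0) with op_id; change (D2 lam 0) with op_zero.
  rewrite symbol_id, symbol_zero; simpl andb; cbv iota.
  intros H; apply C1_nz; transitivity (2 * (/ 2 * (1 - eps * Ci * 0)));
    [field; exact C2_neq_0|rewrite H; ring].
- exists 1%nat, n; rewrite symbol_chiral_part, symbol_D2_0 by (right; exists O; lia).
  change 1%nat with (S (2 * 0)); rewrite symbol_D1_odd by lia.
  assert (H1 : INR n + 1 <> RtoC 0) by apply INR_S_neq_0.
  assert (H2 : 2 * lam + INR n <> 0).
  { intros E; apply (Hl n); replace (2 * lam) with (2 * lam + INR n - INR n) by ring.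
    rewrite E; ring. }
  assert (H3 : gegenbauer_symbol (lam + 1 / 2) n 0 <> 0).
  { unfold gegenbauer_symbol; simpl Nat.leb; cbv iota; rewrite !Nat.sub_0_r.
    apply Cmult_neq_0; [apply Cmult_neq_0|].
    - apply rising_neq_0; intros m E; apply (Hl (S (2 * m))).
      rewrite INR_S, mult_INR, RtoC_mult; replace (INR 2) with 2%R by (simpl; ring).
      transitivity (2 * (lam + 1 / 2 + INR m) - (2 * INR m + 1));
        [field; exact C2_neq_0|rewrite E; ring].
    - apply Cpow_nz, C2_neq_0.
    - intros E; apply C1_nz.
      rewrite <- (Cinv_r (INR (fact n) * INR (fact 0))) by apply fact_C_neq_0.
      rewrite E; ring. }
  intros E.
  apply (Cmult_neq_0 _ _ (Cmult_neq_0 _ _ H1 H2) H3).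
  rewrite Cmult_0_r in E; unfold Cminus in E.
  transitivity (2 * (/ 2 * ((INR n + 1) * (2 * lam + INR n) * gegenbauer_symbol (lam + 1 / 2) n 0 + - 0)));
    [field; exact C2_neq_0|rewrite E; ring].
Qed.

(** As be - j is not 0, the equation determines p i (j + 1) from p (i + 1) j. *)
Lemma bessel_zero al be a (p : nat -> nat -> C) :
  homogeneous a p -> (forall i j, (S (i + j) = a)%nat -> bessel al be p i j = 0) ->
  (forall l : nat, be <> INR l) -> p a O = 0 -> forall i j, p i j = 0.
Proof.
intros Ha Hs Hbe H0 i j; revert i; induction j as [|j IH]; intros i.
- destruct (Nat.eq_dec i a) as [->|Hi]; auto; apply Ha; lia.
- destruct (Nat.eq_dec (i + S j) a) as [Hi|Hi]; [|now apply Ha].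
  pose proof (Hs i j ltac:(lia)) as E; unfold bessel in E; rewrite IH in E.
  apply (Cmult_cancel_l (INR (S j) * (be - INR j))).
  + apply Cmult_neq_0; [rewrite INR_S; apply INR_S_neq_0|].
    intros E'; apply (Hbe j); replace be with (be - INR j + INR j) by ring.
    rewrite E'; ring.
  + rewrite Cmult_0_r, <- E; ring.
Qed.

(** The homogeneous solutions are determined by their coefficient at (a, 0). *)
Lemma bessel_proportional al be a (p p0 : nat -> nat -> C) :
  homogeneous a p -> (forall i j, (S (i + j) = a)%nat -> bessel al be p i j = 0) ->
  homogeneous a p0 -> (forall i j, (S (i + j) = a)%nat -> bessel al be p0 i j = 0) ->
  (forall l : nat, be <> INR l) -> (exists i j, p0 i j <> 0) ->
  exists c, forall i j, p i j = c * p0 i j.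
Proof.
intros Ha Hs Ha0 Hs0 Hbe (i0 & j0 & Hne).
assert (H0 : p0 a O <> 0) by (intros H; apply Hne, (bessel_zero al be a); auto).
exists (p a O / p0 a O).
assert (K : forall i j, p i j - p a O / p0 a O * p0 i j = 0).
{ apply (bessel_zero al be a (fun i j => p i j - p a O / p0 a O * p0 i j)); auto.
  - intros i j Hij; rewrite (Ha i j), (Ha0 i j) by auto; ring.
  - intros i j Hij.
    transitivity (bessel al be p i j - p a O / p0 a O * bessel al be p0 i j);
      [unfold bessel; ring|rewrite Hs, Hs0 by auto; ring].
  - field; exact H0. }
intros i j; specialize (K i j).
transitivity (p i j - p a O / p0 a O * p0 i j + p a O / p0 a O * p0 i j);
  [ring|rewrite K; ring].
Qed.

Lemma bessel_transpose al be p i j :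
  bessel al be p i j = bessel be al (fun i j => p j i) j i.
Proof. unfold bessel; ring. Qed.

(** The same with the recursion run in the other index, for use when it is al
    that avoids the natural numbers. *)
Lemma bessel_proportional_transpose al be a (p p0 : nat -> nat -> C) :
  homogeneous a p -> (forall i j, (S (i + j) = a)%nat -> bessel al be p i j = 0) ->
  homogeneous a p0 -> (forall i j, (S (i + j) = a)%nat -> bessel al be p0 i j = 0) ->
  (forall l : nat, al <> INR l) -> (exists i j, p0 i j <> 0) ->
  exists c, forall i j, p i j = c * p0 i j.
Proof.
intros Ha Hs Ha0 Hs0 Hal (i0 & j0 & Hne).
destruct (bessel_proportional be al a (fun i j => p j i) (fun i j => p0 j i)) as [c Hc];
  auto.
- intros i j Hij; apply Ha; lia.
- intros i j Hij; rewrite <- bessel_transpose; apply Hs; lia.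
- intros i j Hij; apply Ha0; lia.
- intros i j Hij; rewrite <- bessel_transpose; apply Hs0; lia.
- now exists j0, i0.
- exists c; intros i j; apply (Hc j i).
Qed.

Lemma expands_neq_0 D N p i j : expands D N p -> symbol D i j <> 0 ->
  exists k l, p k l <> 0.
Proof.
intros [_ HD] H; apply NNPP; intros Hn; apply H.
unfold symbol; rewrite (HD plane _ open_plane (smooth_on_mon i j) 0%R 0%R I).
rewrite Csum2_0; [field; split; apply INR_fact_C_neq_0|].
intros k l _ _; replace (p k l) with (RtoC 0); [ring|].
symmetry; apply NNPP; intros Hkl; apply Hn; now exists k, l.
Qed.

Definition locally_smooth (f : R -> R -> C) (x y : R) : Prop :=
  locally_2d (infinitely_diff_at f) x y.

Lemma const_coeff_cc D : const_coeff D -> exists D', const_coeff_op D' /\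
  forall f x y, locally_smooth f x y -> D f x y = D' f x y.
Proof.
intros (N & c & H); eexists; split; [|exact H].
apply cc_sum; intros i; apply cc_sum; intros j; apply cc_scal, cc_comp;
apply cc_pow; [apply cc_dx|apply cc_dy].
Qed.

Lemma smooth_on_locally U f x y : open_2d U -> smooth_on U f -> U x y ->
  locally_smooth f x y.
Proof.
intros HU Hf Hxy.
apply locally_2d_impl with (2 := HU x y Hxy), locally_2d_forall; apply Hf.
Qed.

(** [const_coeff] says nothing about functions that are not smooth, but a twisted
    inversion is smooth off the origin, hence near every point where the identity
    is tested. *)
Lemma solution_cc lam nu E1 E2 : solution lam nu E1 E2 ->
  exists E1' E2', const_coeff_op E1' /\ const_coeff_op E2' /\
    functional_identity lam nu (Rest E1' E2') /\
    forall F x, smooth_pair F -> Rest E1 E2 F x = Rest E1' E2' F x.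
Proof.
intros (H1 & H2 & HI).
destruct (const_coeff_cc E1 H1) as (E1' & C1 & A1).
destruct (const_coeff_cc E2 H2) as (E2' & C2 & A2).
assert (HR : forall F x, smooth_pair F -> Rest E1 E2 F x = Rest E1' E2' F x).
{ intros F x [Hf Hg]; apply smooth_on_plane in Hf, Hg; unfold Rest.
  rewrite A1, A2; [reflexivity| |];
  eapply (smooth_on_locally plane); eauto using open_plane; exact I. }
exists E1', E2'; repeat split; auto.
intros F HF x Hx; rewrite <- (HR F) by auto; rewrite <- (HI F HF x Hx).
destruct (smooth_twisted_inversion lam F HF) as [Sf Sg]; unfold Rest.
rewrite A1, A2; [reflexivity| |];
eapply (smooth_on_locally punctured); eauto using open_punctured; now left.
Qed.

Lemma chiral_parts_expand E1 E2 : const_coeff_op E1 -> const_coeff_op E2 ->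
  exists N p q, forall M, (N <= M)%nat ->
    expands (plus_part E1 E2) M p /\ expands (minus_part E1 E2) M q.
Proof.
intros H1 H2.
destruct (cc_expandable _ (cc_chiral_part 1 _ _ H1 H2)) as (N & p & HP).
destruct (cc_expandable _ (cc_chiral_part (- (1)) _ _ H1 H2)) as (N' & q & HQ).
exists (max N N'), p, q; intros M HM; split.
- apply (expands_weaken _ N); [lia|exact HP].
- apply (expands_weaken _ N'); [lia|exact HQ].
Qed.

Lemma bessel_scal al be c p i j :
  bessel al be (fun i j => c * p i j) i j = c * bessel al be p i j.
Proof. unfold bessel; ring. Qed.

(** Replacing (E1, E2) by (E2, - E1) amounts to composing with (f, g) -> (- g, f),
    which multiplies f + i g by i and f - i g by - i. *)
Lemma expands_dual eps E1 E2 N p : eps * eps = 1 ->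
  expands (chiral_part eps E1 E2) N p ->
  expands (chiral_part eps E2 (op_opp E1)) N (fun i j => eps * Ci * p i j).
Proof.
intros He [Hp HD]; split; [intros; rewrite Hp by auto; ring|].
intros U f HU Hf x y Hxy.
transitivity (eps * Ci * chiral_part eps E1 E2 f x y).
- unfold chiral_part, op_scal, op_add, op_opp.
  transitivity (/ 2 * (eps * Ci * E1 f x y - (eps * eps) * (Ci * Ci) * E2 f x y));
    [rewrite He, Ci_sqr|]; ring.
- rewrite (HD U f HU Hf x y Hxy), <- Csum2_scal; apply Csum2_ext; intros; ring.
Qed.

Lemma bessel_D_parts lam a N p q :
  expands (plus_part (D1 lam a) (D2 lam a)) N p ->
  expands (minus_part (D1 lam a) (D2 lam a)) N q ->
  (homogeneous a p /\
   forall i j, (S (i + j) = a)%nat -> bessel (1 - lam) (- (1) - lam) p i j = 0) /\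
  (homogeneous a q /\
   forall i j, (S (i + j) = a)%nat -> bessel (- (1) - lam) (1 - lam) q i j = 0).
Proof.
intros HP HQ; split.
- apply (bessel_D lam 1 a N); [ring|exact HP].
- destruct (bessel_D lam (- (1)) a N q) as [H H']; [ring|exact HQ|].
  replace (- - (1) - lam) with (1 - lam) in H' by ring; auto.
Qed.

Theorem theoremA (lam nu : C) :
  (forall a : nat, nu - lam = INR a ->
     functional_identity lam nu (Rest (D1 lam a) (D2 lam a)) /\
     functional_identity lam nu (Rest (D2 lam a) (op_opp (D1 lam a))))
  /\
  ((forall n : nat, 2 * lam <> - INR n) ->
     ((exists E1 E2 : operator,
         solution lam nu E1 E2 /\ nontrivial (Rest E1 E2)) ->
      exists a : nat, nu - lam = INR a)
     /\
     (forall a : nat, nu - lam = INR a ->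
      forall E1 E2 : operator, solution lam nu E1 E2 ->
      exists p q : C,
        forall F : R -> R -> C * C, smooth_pair F ->
        forall x : R,
          Rest E1 E2 F x =
          p * Rest (D1 lam a) (D2 lam a) F x
          + q * Rest (D2 lam a) (op_opp (D1 lam a)) F x)).
Proof.
split; [|intros Hl; split].
- intros a Ha.
  pose proof (cc_D1 lam a) as H1; pose proof (cc_D2 lam a) as H2.
  destruct (chiral_parts_expand _ _ H1 H2) as (N & p & q & H).
  destruct (H N (le_n N)) as [HP HQ].
  destruct (bessel_D_parts lam a N p q HP HQ) as [[Hp Sp] [Hq Sq]]; split.
  + apply (functional_identity_of_bessel lam nu a _ _ N p q); auto.
  + apply (functional_identity_of_bessel lam nu a _ _ N
      (fun i j => 1 * Ci * p i j) (fun i j => - (1) * Ci * q i j));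
      auto using cc_opp; try (apply expands_dual; auto; ring).
    * intros i j Hij; rewrite Hp by auto; ring.
    * intros i j Hij; rewrite Hq by auto; ring.
    * intros i j Hij; rewrite bessel_scal, Sp by auto; ring.
    * intros i j Hij; rewrite bessel_scal, Sq by auto; ring.
- intros (E1 & E2 & HE & F & x & HF & Hne).
  destruct (solution_cc _ _ _ _ HE) as (E1' & E2' & H1 & H2 & HI & HR).
  destruct (chiral_parts_expand _ _ H1 H2) as (N & p & q & H).
  destruct (H N (le_n N)) as [HP HQ].
  rewrite HR, (Rest_expand E1' E2' N p q) in Hne by auto.
  apply NNPP; intros Hn; apply Hne.
  assert (K : forall k l, p k l = 0 /\ q k l = 0).
  { intros k l; split; apply NNPP; intros Hkl; apply Hn; exists (k + l)%nat;
    apply (exponent_of_functional_identity lam nu E1' E2' N p q); auto. }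
  rewrite !Csum2_0; [ring| |]; intros k l _ _;
    destruct (K k l) as [Kp Kq]; rewrite ?Kp, ?Kq; ring.
- intros a Ha E1 E2 HE.
  destruct (solution_cc _ _ _ _ HE) as (E1' & E2' & H1 & H2 & HI & HR).
  destruct (chiral_parts_expand _ _ H1 H2) as (N & p & q & H).
  pose proof (cc_D1 lam a) as K1; pose proof (cc_D2 lam a) as K2.
  destruct (chiral_parts_expand _ _ K1 K2) as (N0 & p0 & q0 & H0).
  destruct (H (max N N0) ltac:(lia)) as [HP HQ].
  destruct (H0 (max N N0) ltac:(lia)) as [HP0 HQ0].
  destruct (bessel_of_functional_identity lam nu a E1' E2' _ p q Ha H1 H2 HP HQ HI)
    as [[Hp Sp] [Hq Sq]].
  destruct (bessel_D_parts lam a _ p0 q0 HP0 HQ0) as [[Hp0 Sp0] [Hq0 Sq0]].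
  assert (Hbe : forall l : nat, - (1) - lam <> INR l).
  { intros l E; apply (Hl (2 * S l)%nat).
    rewrite mult_INR, RtoC_mult; replace (INR 2) with 2%R by (simpl; ring).
    rewrite INR_S, <- E; ring. }
  destruct (bessel_proportional (1 - lam) (- (1) - lam) a p p0) as [c Hc]; auto.
  { destruct (symbol_chiral_part_neq_0 lam 1 a Hl) as (i & j & Hij).
    apply (expands_neq_0 _ _ _ i j HP0 Hij). }
  destruct (bessel_proportional_transpose (- (1) - lam) (1 - lam) a q q0) as [d Hd]; auto.
  { destruct (symbol_chiral_part_neq_0 lam (- (1)) a Hl) as (i & j & Hij).
    apply (expands_neq_0 _ _ _ i j HQ0 Hij). }
  (* In terms of the two parts of D, D is X + Y and its dual is i X - i Y. *)
exists ((c + d) / 2), (- Ci * (c - d) / 2); intros F HF x.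
  rewrite HR by auto.
  rewrite (Rest_expand E1' E2' (max N N0) p q) by auto.
  rewrite (Rest_expand (D1 lam a) (D2 lam a) (max N N0) p0 q0) by auto.
  rewrite (Rest_expand (D2 lam a) (op_opp (D1 lam a)) (max N N0)
    (fun i j => 1 * Ci * p0 i j) (fun i j => - (1) * Ci * q0 i j))
    by (auto using cc_opp; apply expands_dual; auto; ring).
  set (X := Csum2 _ (fun k l => p0 k l * _)).
  set (Y := Csum2 _ (fun k l => q0 k l * _)).
  transitivity (c * X + d * Y).
  { unfold X, Y; rewrite <- !Csum2_scal; f_equal; apply Csum2_ext; intros k l _ _;
    [rewrite Hc|rewrite Hd]; ring. }
  transitivity ((c + d) / 2 * (X + Y) + - Ci * (c - d) / 2 * (Ci * X + - Ci * Y)).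
  { transitivity ((c + d) / 2 * (X + Y) - (Ci * Ci) * (c - d) / 2 * (X - Y));
      [rewrite Ci_sqr|]; field; exact C2_neq_0. }
  f_equal; f_equal; unfold X, Y; rewrite <- !Csum2_scal; f_equal;
  apply Csum2_ext; intros; ring.
Qed.
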